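(* There is an absolute constant $C_0>0$ such that the following holds. Assume: (a) $d\le n$ and $\eta_1 := C_0\sigma_x^2\sqrt{d/n}<\tfrac12$; (b) (small or moderate tail effective rank) $r_d(\Sigma)/n\le C_1$ for a constant $C_1>0$; (c) (rotational sparsity) for some $0<\delta_1<1$, $\dfrac{\Vert\theta^*_{(d+1):p}\Vert^2_{\Sigma_{(d+1):p}}}{\Vert\theta^*_{1:d}\Vert^2_{\Sigma_{1:d}^{-1}}}\le \dfrac{\delta_1}{4(1+\sigma_x^2)}\lambda_{d+1}^2$. Then for any $\nu$ with $0<\nu<\frac12\min\{1,\sigma_x^2\}$ and any $A_0$ with $A_0\ge 1$ and $(1+A_0)^2<4\delta_1^{-1}$, there are constants $M_1,M_2>0$ depending only on $(\sigma_x,\eta_1,C_1,\delta_1,\nu,A_0)$ such that, with probability at least $$1-2\exp\{-\tfrac{\nu^2 n}{C_0^2\sigma_x^4}\}-2\exp\{-\tfrac{\nu^2 n}{C_0\sigma_x^4}\}-18\exp\{-\tfrac{n}{C_0}\},$$ the following inequalities hold uniformly over all $\tau\ge 0$ in the stated ranges: (i) for $\tau\le A_0^{-1}\lambda_{d+1}$: $\ \mathrm{MSE}_{\mathrm{out}}\ge M_1\,\sigma^2\left(\frac dn+\frac{r_d(\Sigma^2)}{n}\right)$; (ii) for $A_0^{-1}\lambda_{d+1}\le\tau\le A_0\lambda_d$: $$M_2\left(\Vert\theta^*_{1:d}\Vert^2_{\Sigma_{1:d}^{-1}}\tau^2+\sigma^2\Big(\frac dn+\frac{\lambda_{d+1}^2}{\tau^2}\frac{r_d(\Sigma^2)}{n}\Big)\right)\ge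 \mathrm{MSE}_{\mathrm{out}}\ge M_1\left(\Vert\theta^*_{1:d}\Vert^2_{\Sigma_{1:d}^{-1}}\tau^2+\sigma^2\Big(\frac dn+\frac{\lambda_{d+1}^2}{\tau^2}\frac{r_d(\Sigma^2)}{n}\Big)\right);$$ (iii) for $\tau\ge A_0\lambda_d$: $\ \mathrm{MSE}_{\mathrm{out}}\ge M_1\Vert\theta^*_{1:d}\Vert^2_{\Sigma_{1:d}^{-1}}\lambda_d^2$.
   Context: Let $n\ge 1$ and $1\le d<p$ be integers. The data $(y_1,x_1),\dots,(y_n,x_n)$ are i.i.d. from the model $y_i=x_i^\top\theta^*+\epsilon_i$, where $\theta^*\in\mathbb R^p$, $x_i\in\mathbb R^p$ is random with $E(x_i)=0$, $\mathrm{Var}(x_i)=\Sigma$ non-singular, and $\epsilon_i\in\mathbb R$ is independent of $x_i$ with $E(\epsilon_i)=0$, $\mathrm{Var}(\epsilon_i)=\sigma^2$. Throughout, $\Sigma=\mathrm{Diag}(\lambda_1,\dots,\lambda_p)$ with $\lambda_1\ge\dots\ge\lambda_p>0$. The vector $\Sigma^{-1/2}x_i$ is sub-gaussian with sub-gaussian norm $\sigma_x$; here a real random variable $z$ has norm $\Vert z\Vert_{\psi_2}=\inf\{t>0: E\exp(z^2/t^2)\le 2\}$ and a random vector $Z$ has norm $\sup_{s\ne 0}\Vert\langle s,Z\rangle/\Vert s\Vert\,\Vert_{\psi_2}$. $Y=(y_1,\dots,y_n)^\top$, $X=(x_1,\dots,x_n)^\top\in\mathbb R^{n\times p}$. For $\tau>0$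 the ridge estimator is $\hat\theta(\tau)=\arg\min_\theta\{\frac1n\Vert Y-X\theta\Vert^2+\tau\Vert\theta\Vert^2\}=X^\top(XX^\top+n\tau I_n)^{-1}Y$, and $\hat\theta(0)=\lim_{\tau\to0+}\hat\theta(\tau)$. For positive semi-definite $M$, $\Vert b\Vert_M=(b^\top Mb)^{1/2}$. The out-sample error is $\mathrm{MSE}_{\mathrm{out}}=E[\Vert\hat\theta(\tau)-\theta^*\Vert_\Sigma^2\mid X]$, a function of $X$ and $\tau$. $\theta^*_{1:d}$ and $\theta^*_{(d+1):p}$ are the first $d$ and last $p-d$ entries of $\theta^*$; $\Sigma_{1:d}=\mathrm{Diag}(\lambda_1,\dots,\lambda_d)$, $\Sigma_{(d+1):p}=\mathrm{Diag}(\lambda_{d+1},\dots,\lambda_p)$. Tail effective ranks: $r_d(\Sigma)=\frac{\sum_{j>d}\lambda_j}{\lambda_{d+1}}$, $r_d(\Sigma^2)=\frac{\sum_{j>d}\lambda_j^2}{\lambda_{d+1}^2}$. *)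

(* Defs.v *)
(* MathComp / MathComp-Analysis *)
From HB Require Import structures.
From mathcomp Require Import all_boot all_order all_algebra.
From mathcomp Require Import all_classical all_reals all_analysis.
From mathcomp Require Import ring.

Set Implicit Arguments.
Unset Strict Implicit.
Unset Printing Implicit Defensive.

Import Order.TTheory GRing.Theory Num.Theory.
Import numFieldNormedType.Exports.

Local Open Scope classical_set_scope.
Local Open Scope ring_scope.

(* (b^T M b)^(1/2); the library norm `|b| on matrices is the sup norm, so the
   Euclidean norm is written [wnorm 1%:M b]. *)
Definition wnorm (R : realType) (p : nat) (M : 'M[R]_p) (b : 'cV[R]_p) : R :=
  Num.sqrt ((b^T *m M *m b) 0 0).

Definition col_of_tuple (R : realType) (p : nat) (v : p.-tuple R) : 'cV[R]_p :=
  \col_j tnth v j.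

(* The design matrix whose i-th row is the i-th covariate vector. *)
Definition design (R : realType) (n p : nat) (X : n.-tuple (p.-tuple R)) :
    'M[R]_(n, p) :=
  \matrix_(i, j) tnth (tnth X i) j.

(* Indices are 0-based: the first d coordinates are 0, ..., d-1, lambda_{d+1}
   is the entry of index d and lambda_d the entry of index d-1. *)
Definition head_ord (d p : nat) (hdp : (d < p)%N) (i : 'I_d) : 'I_p :=
  widen_ord (ltnW hdp) i.

Definition tail_ord (d p : nat) (hdp : (d < p)%N) (j : 'I_(p - d)) : 'I_p :=
  cast_ord (subnKC (ltnW hdp)) (rshift d j).

Definition lam_d1 (R : realType) (d p : nat) (hdp : (d < p)%N)
    (lam : 'rV[R]_p) : R :=
  lam 0 (Ordinal hdp).

Definition lam_d (R : realType) (d p : nat) (hdp : (d < p)%N)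
    (lam : 'rV[R]_p) : R :=
  lam 0 (Ordinal (leq_ltn_trans (leq_pred d) hdp)).

(* Tail effective rank of Diag(lam); for the rank of Diag(lam)^2 take [lam2]. *)
Definition tail_rank (R : realType) (d p : nat) (hdp : (d < p)%N)
    (lam : 'rV[R]_p) : R :=
  (\sum_(j < p | (d <= j)%N) lam 0 j) / lam_d1 hdp lam.

Definition lam2 (R : realType) (p : nat) (lam : 'rV[R]_p) : 'rV[R]_p :=
  map_mx (fun l => l ^+ 2) lam.

(* Sigma^(-1/2) for Sigma = Diag(lam). *)
Definition inv_sqrt_diag (R : realType) (p : nat) (lam : 'rV[R]_p) :
    'M[R]_p :=
  diag_mx (map_mx (fun l => (Num.sqrt l)^-1) lam).

(* Values in \bar R: the norm is +oo when no t is admissible. *)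
Definition psi2_norm (R : realType) (disp : measure_display)
    (T : measurableType disp) (P : probability T R) (z : T -> R) : \bar R :=
  ereal_inf [set t%:E | t in
    [set t : R | 0 < t /\
      ('E_P[fun w => (expR (z w ^+ 2 / t ^+ 2))%R] <= 2%:E)%E]].

Definition vpsi2_norm (R : realType) (disp : measure_display)
    (T : measurableType disp) (P : probability T R) (p : nat)
    (Z : T -> 'cV[R]_p) : \bar R :=
  ereal_sup [set psi2_norm P (fun w => (s^T *m Z w) 0 0 / wnorm 1%:M s)
            | s in [set s : 'cV[R]_p | s != 0]].

(* Taking some of the B i equal to setT gives the product rule for every
   subfamily, so this is mutual independence. *)
Definition mutually_independent (R : realType) (disp disp' : measure_display)
    (T : measurableType disp) (U : measurableType disp') (P : probability T R)
    (n : nat) (Z : 'I_n -> T -> U) : Prop :=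
  forall B : 'I_n -> set U, (forall i, measurable (B i)) ->
    P (\bigcap_(i in [set: 'I_n]) (Z i @^-1` B i)) =
    (\prod_(i < n) P (Z i @^-1` B i))%E.

Definition identically_distributed (R : realType)
    (disp disp' : measure_display) (T : measurableType disp)
    (U : measurableType disp') (P : probability T R)
    (n : nat) (Z : 'I_n -> T -> U) : Prop :=
  forall (i j : 'I_n) (B : set U), measurable B ->
    P (Z i @^-1` B) = P (Z j @^-1` B).

Definition independent2 (R : realType) (disp disp1 disp2 : measure_display)
    (T : measurableType disp) (U1 : measurableType disp1)
    (U2 : measurableType disp2) (P : probability T R)
    (Z1 : T -> U1) (Z2 : T -> U2) : Prop :=
  forall (B1 : set U1) (B2 : set U2), measurable B1 -> measurable B2 ->
    P ((Z1 @^-1` B1) `&` (Z2 @^-1` B2)) =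
    (P (Z1 @^-1` B1) * P (Z2 @^-1` B2))%E.

Record linear_model (R : realType) (disp : measure_display)
    (T : measurableType disp) (P : probability T R) (n p : nat)
    (theta : 'cV[R]_p) (lam : 'rV[R]_p) (sigma sigma_x : R)
    (x : 'I_n -> {RV P >-> p.-tuple R}) (eps y : 'I_n -> {RV P >-> R}) :
    Prop := LinearModel {
  model_eq : forall i w,
    y i w = ((col_of_tuple (x i w))^T *m theta) 0 0 + eps i w;
  model_indep :
    mutually_independent P (fun i w => (y i w, x i w));
  model_ident :
    identically_distributed P (fun i w => (y i w, x i w));
  model_noise_indep : forall i, independent2 P (eps i) (x i);
  model_noise_mean : forall i, ('E_P[eps i] = 0)%E;
  model_noise_var : forall i, ('V_P[eps i] = (sigma ^+ 2)%:E)%E;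
  model_x_mean : forall i j, ('E_P[fun w => tnth (x i w) j] = 0)%E;
  model_x_cov : forall i j k,
    covariance P (fun w => tnth (x i w) j) (fun w => tnth (x i w) k) =
    (diag_mx lam j k)%:E;
  model_x_subgaussian : forall i,
    vpsi2_norm P (fun w => inv_sqrt_diag lam *m col_of_tuple (x i w)) =
    sigma_x%:E
}.

(* Meaningful for 0 <= tau only. *)
Definition ridge (R : realType) (n p : nat) (X : 'M[R]_(n, p)) (Y : 'cV[R]_n)
    (tau : R) : 'cV[R]_p :=
  let est t : 'cV[R]_p :=
    X^T *m invmx (X *m X^T + (n%:R * t)%:M) *m Y in
  if tau == 0 then lim (est t @[t --> 0^'+]) else est tau.

Definition ridge_objective (R : realType) (n p : nat) (X : 'M[R]_(n, p))
    (Y : 'cV[R]_n) (tau : R) (theta : 'cV[R]_p) : R :=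
  n%:R^-1 * wnorm 1%:M (Y - X *m theta) ^+ 2 + tau * wnorm 1%:M theta ^+ 2.

Lemma wnorm1_sq (R : realType) (p : nat) (b : 'cV[R]_p) :
  wnorm 1%:M b ^+ 2 = \sum_i b i 0 ^+ 2.
Proof.
have E : (b^T *m 1%:M *m b) 0 0 = \sum_i b i 0 ^+ 2.
  by rewrite mulmx1 mxE; apply: eq_bigr => i _; rewrite mxE expr2.
by rewrite /wnorm E sqr_sqrtr//; apply: sumr_ge0 => i _; rewrite sqr_ge0.
Qed.

Lemma wnorm1_sqD (R : realType) (p : nat) (a b : 'cV[R]_p) :
  wnorm 1%:M (a + b) ^+ 2 =
  wnorm 1%:M a ^+ 2 + 2 * (a^T *m b) 0 0 + wnorm 1%:M b ^+ 2.
Proof.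
rewrite !wnorm1_sq mxE mulr_sumr -!big_split; apply: eq_bigr => i _ /=.
by rewrite !mxE sqrrD -mulr_natl.
Qed.

Lemma wnorm1_sq_gt0 (R : realType) (p : nat) (b : 'cV[R]_p) :
  b != 0 -> 0 < wnorm 1%:M b ^+ 2.
Proof.
move=> b0; rewrite lt_neqAle sqr_ge0 andbT eq_sym; apply: contra b0.
rewrite wnorm1_sq psumr_eq0 => [/allP b0|i _]; last exact: sqr_ge0.
apply/eqP/matrixP => i j; rewrite ord1 mxE; apply/eqP.
by have := b0 i (mem_index_enum i); rewrite sqrf_eq0.
Qed.

Lemma ridge_unitmx (R : realType) (n p : nat) (X : 'M[R]_(n, p)) (tau : R) :
  (0 < n)%N -> 0 < tau -> X *m X^T + (n%:R * tau)%:M \in unitmx.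
Proof.
move=> n0 t0; rewrite -row_free_unit -kermx_eq0; apply/eqP/row_matrixP => i.
rewrite row0; set u := row i _.
have uH : u *m (X *m X^T + (n%:R * tau)%:M) = 0.
  by apply/sub_kermxP; exact: row_sub.
move: u uH => u uH.
apply/eqP/negP => /negP u0.
have /wnorm1_sq_gt0 : u^T != 0.
  by apply: contra u0 => /eqP /(congr1 trmx); rewrite trmxK trmx0 => ->.
have : u *m (X *m X^T + (n%:R * tau)%:M) *m u^T = 0 by rewrite uH mul0mx.
rewrite mulmxDr mulmxDl mul_mx_scalar -scalemxAl => /matrixP /(_ 0 0).
have E1 : (u *m (X *m X^T) *m u^T) 0 0 = wnorm 1%:M (X^T *m u^T) ^+ 2.
  rewrite wnorm1_sq mulmxA -mulmxA mxE; apply: eq_bigr => k _.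
  by rewrite -trmx_mul [(_ *m _)^T _ _]mxE expr2.
have E2 : (u *m u^T) 0 0 = wnorm 1%:M u^T ^+ 2.
  by rewrite wnorm1_sq mxE; apply: eq_bigr => k _; rewrite [u^T _ _]mxE expr2.
rewrite mxE [in X in _ + X]mxE [in RHS]mxE E1 E2 => /eqP; rewrite paddr_eq0 ?sqr_ge0//; last first.
  by rewrite mulr_ge0 ?sqr_ge0// mulr_ge0 ?ler0n// ltW.
move=> /andP[_]; rewrite !mulf_eq0 pnatr_eq0 (gt_eqF t0) eqn0Ngt n0 /= orbb.
by move=> /eqP ->; rewrite expr0n ltxx.
Qed.

(* For tau > 0, [ridge] is the unique minimiser of the ridge criterion. *)
Lemma ridge_argmin (R : realType) (n p : nat) (X : 'M[R]_(n, p))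
    (Y : 'cV[R]_n) (tau : R) (theta : 'cV[R]_p) :
  (0 < n)%N -> 0 < tau -> theta != ridge X Y tau ->
  ridge_objective X Y tau (ridge X Y tau) < ridge_objective X Y tau theta.
Proof.
move=> n0 t0 neq; set th := ridge X Y tau in neq *.
have nR : n%:R != 0 :> R by rewrite pnatr_eq0 -lt0n.
pose h := theta - th; have h0 : h != 0 by rewrite subr_eq0.
have foc : X^T *m (Y - X *m th) = (n%:R * tau) *: th.
  rewrite /th /ridge (gt_eqF t0).
  set H := _ + _%:M.
  have HU : H \in unitmx by exact: ridge_unitmx.
  have -> : Y - X *m (X^T *m invmx H *m Y) = (n%:R * tau) *: (invmx H *m Y).
    have {1}-> : Y = H *m (invmx H *m Y) by rewrite mulKVmx.
    by rewrite /H mulmxDl -/H mul_scalar_mx !mulmxA addrAC subrr add0r.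
  by rewrite -scalemxAr mulmxA.
clearbody th.
have -> : theta = th + h by rewrite /h addrC subrK.
have -> : ridge_objective X Y tau (th + h) =
  n%:R^-1 * (wnorm 1%:M (Y - X *m th) ^+ 2 +
             2 * ((Y - X *m th)^T *m - (X *m h)) 0 0 +
             wnorm 1%:M (- (X *m h)) ^+ 2) +
  tau * (wnorm 1%:M th ^+ 2 + 2 * (th^T *m h) 0 0 + wnorm 1%:M h ^+ 2).
  rewrite /ridge_objective; congr (_ * _ + _ * _); last exact: wnorm1_sqD.
  by rewrite mulmxDr opprD addrA; exact: wnorm1_sqD.
rewrite /ridge_objective.
have -> : ((Y - X *m th)^T *m - (X *m h)) 0 0 =
          - (n%:R * tau * (th^T *m h) 0 0).
  rewrite mulmxN mxE mulmxA; congr (- _).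
  rewrite -[X in _^T *m X]trmxK -trmx_mul foc linearZ /= -scalemxAl mxE //.
have Xh : 0 <= wnorm 1%:M (- (X *m h)) ^+ 2 by rewrite sqr_ge0.
have hp := wnorm1_sq_gt0 h0.
set a := wnorm _ _ ^+ 2; set b := wnorm _ th ^+ 2; set c := (_ *m _) 0 0.
set e := wnorm _ _ ^+ 2 in Xh *; set f := wnorm _ h ^+ 2 in hp *.
have -> : n%:R^-1 * (a + 2 * - (n%:R * tau * c) + e) + tau * (b + 2 * c + f) =
   n%:R^-1 * a + tau * b + (n%:R^-1 * e + tau * f) by field.
rewrite ltrDl; apply: ltr_wpDl; last exact: mulr_gt0.
by rewrite mulr_ge0// invr_ge0 ler0n.
Qed.

(* m(X) is a version of E[Z | X], for a nonnegative random variable Z that need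
   not be integrable: both integrals may then be +oo. *)
Definition is_cond_expectation (R : realType) (disp disp' : measure_display)
    (T : measurableType disp) (U : measurableType disp') (P : probability T R)
    (X : T -> U) (Z : T -> R) (m : U -> R) : Prop :=
  measurable_fun setT m /\
  forall B : set U, measurable B ->
    (\int[P]_(w in X @^-1` B) (m (X w))%:E =
     \int[P]_(w in X @^-1` B) (Z w)%:E)%E.

(* mse tau is a version of E[|| ridge tau - theta ||_Sigma^2 | X] for each
   tau >= 0.  Each of these versions is only determined up to a null set which
   may depend on tau; almost sure continuity in tau (which holds for
   E[|| ridge tau - theta ||_Sigma^2 | X = X0] computed by integrating out the
   noise) determines the whole family up to a single null set, so that
   statements holding uniformly in tau make sense. *)
Definition is_mse_out (R : realType) (disp : measure_display)
    (T : measurableType disp) (P : probability T R) (n p : nat)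
    (theta : 'cV[R]_p) (Sigma : 'M[R]_p)
    (x : 'I_n -> {RV P >-> p.-tuple R}) (y : 'I_n -> {RV P >-> R})
    (mse : R -> n.-tuple (p.-tuple R) -> R) : Prop :=
  let X w := [tuple x i w | i < n] in
  let Y w := \col_(i < n) y i w in
  (forall tau, 0 <= tau ->
     is_cond_expectation P X
       (fun w => wnorm Sigma (ridge (design (X w)) (Y w) tau - theta) ^+ 2)
       (mse tau)) /\
  {ae P, forall w, {within `[0, +oo[, continuous (fun tau => mse tau (X w))}}.

(* Main.v *)
Require Import Defs.
From HB Require Import structures.
From mathcomp Require Import all_boot all_order all_algebra.
From mathcomp Require Import all_classical all_reals all_analysis.
From mathcomp Require Import measurable_realfun ring lra zify.

(* Write R for the ridge matrix (theta-hat = R Y) and r_j for its rows.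
   Conditioning on the design X gives
     MSE_out = sum_j lam_j (R X theta - theta)_j^2 + sigma^2 sum_j lam_j |r_j|^2,
   almost surely for all rational tau and then, by continuity, for all tau; so
   the error is a deterministic function of the design.
   Eliminating the tail coordinates turns the head parts of the bias
   and of the variance into solutions (h, t) of one linear system
     h / l1 = g - Z1^T t,   (X2 X2^T + n tau) t = Z1 h + f,
   with Z1 the whitened head and X2 the tail of the design.  The bounds follow
   from it and from a few facts on the design: Z1 is a near-isometry (up to the
   factor sqrt n), X2 and X2 l2^(1/2) have operator norms of the expected order,
   and sum_j l2_j |X2 e_j|^2 is close to its mean.  For the lower bound on the
   tail variance, project out the column space of Z1, which costs d dimensions;
   this is harmless when the tail dominates, and otherwise the head variance
   alone has the right order.

   The design facts hold with high probability by Bernstein's inequality for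
   convex combinations of squared subgaussian linear forms and a lattice net of
   the ball.  For the operator norms of the tail, cut it in blocks of n
   coordinates and average exp(|Z_k v|^2 / K) over the blocks with weights
   proportional to the leading eigenvalue of the block: the failure probability
   then does not depend on the number of blocks. *)

(** The lower bound on the bias is where cancellation threatens: the tail signal [X2 th2] enters the
    system as a perturbation [f] of the head signal. On the good event its contribution is at most
    (7/5) sqrt(phi) / tau, where phi is the squared weighted norm of the tail of [theta]. The
    condition (1 + A0)^2 delta < 4, together with (7/5)^2 < 2, keeps this below the fraction A0 / (1
    + A0) of the head signal, so the fraction 1 / (1 + A0) survives. The factor 1 / (4 (1 +
    sigma_x^2)) of the sparsity condition enters as 1/8, because the unit variance of the whitened
    coordinates forces sigma_x >= 1. The net of the head costs a factor 2^(18 d) in probability;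
    squaring eta1 < 1/2 gives n >= 4 C0^2 sigma_x^4 d, which pays for it. The constants [K] and [K']
    of the operator norms depend only on sigma_x and C1, so M1 and M2 can be fixed before n, p, d
    and the eigenvalues. All bounds are proved for tau > 0 only; tau = 0 is reached by the
    continuity of the conditional risk. *)

Set Implicit Arguments.
Unset Strict Implicit.
Unset Printing Implicit Defensive.

Import Order.TTheory GRing.Theory Num.Theory.
Import numFieldNormedType.Exports.

Local Open Scope classical_set_scope.
Local Open Scope ring_scope.

(** * Euclidean geometry of column vectors *)

Section Euclid.
Variable R : rcfType.
Implicit Types n m : nat.

Definition dot n (u v : 'cV[R]_n) : R := \sum_i u i 0 * v i 0.
Definition sqn n (u : 'cV[R]_n) : R := dot u u.
Definition nrm n (u : 'cV[R]_n) : R := Num.sqrt (sqn u).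

Lemma dotC n (u v : 'cV[R]_n) : dot u v = dot v u.
Proof. by apply: eq_bigr => i _; rewrite mulrC. Qed.

Lemma dotDl n (u v w : 'cV[R]_n) : dot (u + v) w = dot u w + dot v w.
Proof. by rewrite -big_split; apply: eq_bigr => i _; rewrite mxE mulrDl. Qed.

Lemma dotZl n a (u v : 'cV[R]_n) : dot (a *: u) v = a * dot u v.
Proof. by rewrite mulr_sumr; apply: eq_bigr => i _; rewrite mxE mulrA. Qed.

Lemma dotNl n (u v : 'cV[R]_n) : dot (- u) v = - dot u v.
Proof. by rewrite -scaleN1r dotZl mulN1r. Qed.

Lemma dotDr n (u v w : 'cV[R]_n) : dot w (u + v) = dot w u + dot w v.
Proof. by rewrite dotC dotDl ![dot _ w]dotC. Qed.

Lemma dotZr n a (u v : 'cV[R]_n) : dot u (a *: v) = a * dot u v.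
Proof. by rewrite dotC dotZl dotC. Qed.

Lemma dotNr n (u v : 'cV[R]_n) : dot u (- v) = - dot u v.
Proof. by rewrite dotC dotNl dotC. Qed.

Definition dotE := (dotDl, dotDr, dotZl, dotZr, dotNl, dotNr).

Lemma dot_mulmx n m (M : 'M[R]_(n, m)) u v : dot (M *m u) v = dot u (M^T *m v).
Proof.
rewrite /dot; under eq_bigr do rewrite mxE mulr_suml.
rewrite exchange_big; apply: eq_bigr => j _; rewrite mxE mulr_sumr.
apply: eq_bigr => i _; rewrite mxE; ring.
Qed.

Lemma sqn_ge0 n (u : 'cV[R]_n) : 0 <= sqn u.
Proof. by apply: sumr_ge0 => i _; rewrite -expr2 sqr_ge0. Qed.

Lemma sqnE n (u : 'cV[R]_n) : sqn u = \sum_i u i 0 ^+ 2.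
Proof. by apply: eq_bigr => i _; rewrite expr2. Qed.

Lemma sqnZ n a (u : 'cV[R]_n) : sqn (a *: u) = a ^+ 2 * sqn u.
Proof. by rewrite /sqn dotZl dotZr mulrA expr2. Qed.

Lemma sqnD n (u v : 'cV[R]_n) : sqn (u + v) = sqn u + 2 * dot u v + sqn v.
Proof. rewrite /sqn !dotE [dot v u]dotC; ring. Qed.

Lemma sqn_eq0 n (u : 'cV[R]_n) : (sqn u == 0) = (u == 0).
Proof.
apply/eqP/eqP => [|->]; last first.
  by rewrite sqnE big1 // => i _; rewrite mxE expr0n.
rewrite sqnE => /eqP; rewrite psumr_eq0 => [/allP u0|i _]; last exact: sqr_ge0.
apply/matrixP => i j; rewrite ord1 mxE; apply/eqP.
by have := u0 i (mem_index_enum i); rewrite sqrf_eq0.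
Qed.

Lemma sqn_delta n (j : 'I_n) : sqn (delta_mx j 0) = 1.
Proof.
rewrite sqnE (bigD1 j) //= big1 => [|i /negPf ij]; rewrite !mxE ?ij ?eqxx.
  by rewrite addr0 expr1n.
by rewrite expr0n.
Qed.

(** Cauchy-Schwarz: the squared norm of |v|^2 u - <u, v> v is |v|^2 times the gap. *)
Lemma dot_sqr_le n (u v : 'cV[R]_n) : dot u v ^+ 2 <= sqn u * sqn v.
Proof.
have [->|v0] := eqVneq v 0.
  rewrite [dot _ _]big1 ?expr0n ?mulr_ge0 ?sqn_ge0 // => i _.
  by rewrite mxE mulr0.
have vp : 0 < sqn v by rewrite lt_def sqn_eq0 v0 sqn_ge0.
have := sqn_ge0 (sqn v *: u - dot u v *: v).
rewrite sqnD dotNr dotZl dotZr sqnZ [sqn (- _)]/sqn dotNl dotNr opprK -/(sqn _) sqnZ.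
rewrite (_ : _ + _ = sqn v * (sqn u * sqn v - dot u v ^+ 2)); last by ring.
by rewrite pmulr_rge0 // subr_ge0.
Qed.

Lemma nrm_ge0 n (u : 'cV[R]_n) : 0 <= nrm u. Proof. exact: sqrtr_ge0. Qed.

Lemma sqr_nrm n (u : 'cV[R]_n) : nrm u ^+ 2 = sqn u.
Proof. by rewrite sqr_sqrtr // sqn_ge0. Qed.

Lemma dot_le_nrm n (u v : 'cV[R]_n) : dot u v <= nrm u * nrm v.
Proof.
have [?|/ltW ?] := lerP (dot u v) 0.
  by rewrite (le_trans _ (mulr_ge0 _ _)) ?nrm_ge0.
rewrite -(@ler_pXn2r _ 2) ?nnegrE ?mulr_ge0 ?nrm_ge0 //.
by rewrite exprMn !sqr_nrm dot_sqr_le.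
Qed.

Lemma nrmD n (u v : 'cV[R]_n) : nrm (u + v) <= nrm u + nrm v.
Proof.
rewrite -(@ler_pXn2r _ 2) ?nnegrE ?addr_ge0 ?nrm_ge0 // sqrrD !sqr_nrm sqnD.
have := dot_le_nrm u v; lra.
Qed.

Lemma nrm_le n m (u : 'cV[R]_n) (v : 'cV[R]_m) c : 0 <= c ->
  (nrm u <= c * nrm v) = (sqn u <= c ^+ 2 * sqn v).
Proof.
move=> c0; rewrite -(@ler_pXn2r _ 2) ?nnegrE ?mulr_ge0 ?nrm_ge0 //.
by rewrite exprMn !sqr_nrm.
Qed.

(** With w = M^T u one has |w|^2 = <M w, u>; Cauchy-Schwarz and division by |w|^2 give the bound
    without singular values. *)
Lemma sqn_tr_le n m (M : 'M[R]_(n, m)) c : 0 <= c ->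
  (forall v, sqn (M *m v) <= c * sqn v) ->
  forall u, sqn (M^T *m u) <= c * sqn u.
Proof.
move=> c0 H u; set w := M^T *m u.
have [w0|w0] := eqVneq (sqn w) 0; first by rewrite w0 mulr_ge0 ?sqn_ge0.
have wp : 0 < sqn w by rewrite lt_def w0 sqn_ge0.
have E : dot (M *m w) u = sqn w by rewrite dot_mulmx.
have : dot (M *m w) u ^+ 2 <= c * sqn w * sqn u.
  rewrite (le_trans (dot_sqr_le _ _)) // ler_wpM2r ?sqn_ge0 //.
by rewrite E expr2 -mulrA [sqn w * sqn u]mulrC mulrA ler_pM2r.
Qed.

End Euclid.

(** * Deterministic risk bounds *)

Section RegularizedGram.
Variables (R : rcfType) (n q : nat) (X2 : 'M[R]_(n, q)) (a b : R).
Hypotheses (a0 : 0 <= a) (b0 : 0 < b).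
Hypothesis X2_le : forall v, sqn (X2 *m v) <= a * sqn v.

Definition gram (t : 'cV[R]_n) : 'cV[R]_n := X2 *m (X2^T *m t) + b *: t.
Definition gform (t : 'cV[R]_n) : R := sqn (X2^T *m t) + b * sqn t.

Lemma dot_gram t : dot (gram t) t = gform t.
Proof. by rewrite /gram dotDl dot_mulmx dotZl. Qed.

Lemma gform_ge t : b * sqn t <= gform t.
Proof. by rewrite lerDr sqn_ge0. Qed.

Lemma gform_ge_tr t : sqn (X2^T *m t) <= gform t.
Proof. by rewrite lerDl mulr_ge0 ?sqn_ge0 // ltW. Qed.

Lemma gform_le t : gform t <= (a + b) * sqn t.
Proof. by rewrite mulrDl lerD2r; exact: sqn_tr_le. Qed.

(** The operator G = X2 X2^T + b has its spectrum in [b, a + b], so G^2 <= (a + b) G. The bound is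
    kept in terms of the form because that is what [core_energy] controls. *)
Lemma sqn_gram_le_gform t : sqn (gram t) <= (a + b) * gform t.
Proof.
rewrite /gram sqnD dotZr dot_mulmx -/(sqn _) sqnZ /gform.
have := X2_le (X2^T *m t); have := sqn_tr_le a0 X2_le t.
move=> /(ler_wpM2l (ltW b0)).
set s := sqn (X2^T *m t); set w := sqn (X2 *m _); set v := sqn t; nra.
Qed.

Lemma sqn_gram_le t : sqn (gram t) <= (a + b) ^+ 2 * sqn t.
Proof.
rewrite (le_trans (sqn_gram_le_gform t)) // expr2 -mulrA ler_wpM2l ?gform_le //.
by rewrite addr_ge0 // ltW.
Qed.

Lemma nrm_gram_ge t : b * nrm t <= nrm (gram t).
Proof.
have [t0|t0] := eqVneq (nrm t) 0; first by rewrite t0 mulr0 nrm_ge0.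
have tp : 0 < nrm t by rewrite lt_def t0 nrm_ge0.
rewrite -(ler_pM2r tp) -mulrA -expr2 sqr_nrm (le_trans (gform_ge t)) //.
by rewrite -dot_gram dot_le_nrm.
Qed.

End RegularizedGram.

Section Core.
Variables (R : rcfType) (n d q : nat) (N : R).
Variables (Z1 : 'M[R]_(n, d)) (X2 : 'M[R]_(n, q)) (l1 : 'rV[R]_d).
Variables (ld lam tau K : R).
Hypotheses (N0 : 0 < N) (ld0 : 0 < ld) (lam0 : 0 < lam) (tau0 : 0 < tau).
Hypotheses (K0 : 0 < K) (l1_ge : forall j, ld <= l1 0 j).
Hypothesis Z1_ge : forall v, 3 / 5 * N * sqn v <= sqn (Z1 *m v).
Hypothesis Z1_le : forall v, sqn (Z1 *m v) <= 7 / 5 * N * sqn v.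
Hypothesis X2_le : forall v, sqn (X2 *m v) <= N * (K * lam) * sqn v.

(* The common shape of the head part h of the ridge bias (with data term f)
   and of the head columns of the ridge operator (with f = 0). *)
Definition core (h g : 'cV[R]_d) (t f : 'cV[R]_n) : Prop :=
  (forall j, h j 0 / l1 0 j = (g - Z1^T *m t) j 0) /\
  gram X2 (N * tau) t = Z1 *m h + f.

Let a := N * (K * lam).
Let b := N * tau.
Let a0 : 0 <= a. Proof. by rewrite !mulr_ge0 // ltW. Qed.
Let b0 : 0 < b. Proof. by rewrite mulr_gt0. Qed.
Let beta := Num.sqrt (7 / 5 * N).
Let beta0 : 0 <= beta. Proof. exact: sqrtr_ge0. Qed.
Let beta2 : beta ^+ 2 = 7 / 5 * N.
Proof. rewrite sqr_sqrtr //; have := N0; lra. Qed.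

Let Z1n v : nrm (Z1 *m v) <= beta * nrm v.
Proof. by rewrite nrm_le ?beta0 // beta2. Qed.

Let Z1tn v : nrm (Z1^T *m v) <= beta * nrm v.
Proof.
rewrite nrm_le ?beta0 // beta2; apply: sqn_tr_le => //.
have := N0; lra.
Qed.

Let l1_gt0 j : 0 < l1 0 j. Proof. exact: lt_le_trans ld0 (l1_ge j). Qed.

Lemma core_g_le h g t f : core h g t f -> nrm g <= nrm h / ld + beta * nrm t.
Proof.
case=> H1 _; pose k := \col_j (h j 0 / l1 0 j).
have -> : g = k + Z1^T *m t.
  by apply/matrixP => i j; rewrite ord1 mxE mxE H1 2!mxE subrK.
rewrite (le_trans (nrmD _ _)) // lerD // mulrC nrm_le ?invr_ge0 ?(ltW ld0) //.
rewrite !sqnE mulr_sumr; apply: ler_sum => j _; rewrite mxE mulrC exprMn.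
rewrite ler_wpM2r ?sqr_ge0 // lerXn2r ?nnegrE ?invr_ge0 ?(ltW ld0) //.
  exact: ltW.
by rewrite lef_pV2 ?posrE.
Qed.

Lemma core_t_le h g t f : core h g t f -> b * nrm t <= beta * nrm h + nrm f.
Proof.
case=> _ H2; rewrite (le_trans (nrm_gram_ge X2 b t)) // H2.
by rewrite (le_trans (nrmD _ _)) // lerD2r.
Qed.

(** Eliminating t between [core_g_le] and [core_t_le] bounds the data g by h, hence the bias h from
    below, up to the perturbation f. *)
Lemma core_bias_lower h g t f : core h g t f ->
  nrm g <= nrm h * (1 / ld + 7 / 5 / tau) + beta * nrm f / b.
Proof.
move=> H; have := core_g_le H; have /(ler_wpM2l beta0) := core_t_le H.
have -> : beta * (beta * nrm h + nrm f) = 7 / 5 * N * nrm h + beta * nrm f.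
  by rewrite -beta2; ring.
move=> H1 /le_trans; apply.
have bi : 0 < b^-1 by rewrite invr_gt0.
rewrite -(ler_pM2r bi) in H1.
have E1 : beta * (b * nrm t) / b = beta * nrm t by field; rewrite gt_eqF.
have E2 : (7 / 5 * N * nrm h + beta * nrm f) / b =
  nrm h * (7 / 5 / tau) + beta * nrm f / b.
  by rewrite /b; field; rewrite !gt_eqF.
rewrite E1 E2 in H1; rewrite mulrDr -addrA div1r.
exact: lerD.
Qed.

(** To be read as a lower bound on t: Z1 h is the image of t under an operator of norm at most a +
    b, and Z1 is bounded below. *)
Lemma core_var_lower h g t : core h g t 0 ->
  3 / 5 * N * sqn h <= (a + b) ^+ 2 * sqn t.
Proof.
case=> _; rewrite addr0 => H2; rewrite (le_trans (Z1_ge h)) // -H2.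
exact: sqn_gram_le.
Qed.

(** Pair the first equation with h and the second with t: the cross term <Z1 h, t> is common to
    both, and the sum of h_j^2 / l1_j is dropped as nonnegative. The bound therefore does not see
    how large the head eigenvalues are. *)
Lemma core_energy h g t f : core h g t f ->
  gform X2 b t <= nrm h * nrm g + nrm t * nrm f.
Proof.
case=> H1 H2.
have : dot h g - dot h (Z1^T *m t) = \sum_j h j 0 ^+ 2 / l1 0 j.
  rewrite -dotNr -dotDr; apply: eq_bigr => j _.
  by rewrite -H1 expr2 mulrA.
have : 0 <= \sum_j h j 0 ^+ 2 / l1 0 j.
  by apply: sumr_ge0 => j _; rewrite divr_ge0 ?sqr_ge0 // ltW.
move=> p E; rewrite -E -dot_mulmx in p.
rewrite -dot_gram H2 dotDl [dot f t]dotC.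
have := dot_le_nrm h g; have := dot_le_nrm t f.
by lra.
Qed.

(** Young's inequality trades |t| |f| for half of b |t|^2, which the form absorbs, and half of |f|^2
    / b. *)
Lemma core_energy2 h g t f : core h g t f ->
  gform X2 b t <= 2 * (nrm h * nrm g) + sqn f / b.
Proof.
move=> H; have := core_energy H.
have : nrm t * nrm f <= (b * sqn t + sqn f / b) / 2.
  rewrite ler_pdivlMr // -!sqr_nrm -subr_ge0.
  have -> : b * nrm t ^+ 2 + nrm f ^+ 2 / b - nrm t * nrm f * 2 =
    (b * nrm t - nrm f) ^+ 2 / b by field; rewrite gt_eqF.
  by rewrite divr_ge0 ?sqr_ge0 // ltW.
have := @gform_ge _ _ _ X2 b t; lra.
Qed.

(** A quadratic inequality in |h| rather than an explicit bound: the energy controls |Z1 h|^2 = |G t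
    - f|^2 by a term linear in |h|. *)
Lemma core_bias_upper h g t f : core h g t f ->
  3 / 5 * N * sqn h <=
  2 * (a + b) * (2 * (nrm h * nrm g) + sqn f / b) + 2 * sqn f.
Proof.
move=> H; have [_ H2] := H; rewrite (le_trans (Z1_ge h)) //.
have -> : Z1 *m h = gram X2 b t - f by rewrite H2 addrK.
have E := sqn_gram_le_gform a0 b0 X2_le t.
have E2 : (a + b) * gform X2 b t <=
    (a + b) * (2 * (nrm h * nrm g) + sqn f / b).
  by rewrite ler_wpM2l ?core_energy2 // addr_ge0 // ltW.
have := sqn_ge0 (gram X2 b t + f).
rewrite (sqnD (gram X2 b t) f) (sqnD (gram X2 b t) (- f)) dotNr.
have -> : sqn (- f) = sqn f by rewrite -scaleN1r sqnZ sqrrN expr1n mul1r.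
rewrite -[2 * (a + b) * _]mulrA.
move: E E2; set x := (a + b) * gform _ _ _; set y := (a + b) * (_ + _).
lra.
Qed.

End Core.

(** * Projection onto the column space of the whitened head *)

Section ColumnSpace.
Variables (R : rcfType) (n d : nat) (Z : 'M[R]_(n, d)) (c : R).
Hypotheses (c0 : 0 < c) (Z_ge : forall v, c * sqn v <= sqn (Z *m v)).

Lemma gram_unitmx : Z^T *m Z \in unitmx.
Proof.
rewrite -row_free_unit -kermx_eq0; apply/eqP/row_matrixP => i.
rewrite row0; set u := row i _.
have uH : u *m (Z^T *m Z) = 0 by apply/sub_kermxP; exact: row_sub.
have : c * sqn u^T <= 0.
  rewrite (le_trans (Z_ge _)) // /sqn dot_mulmx.
  suff -> : Z^T *m (Z *m u^T) = 0.
    by rewrite [dot _ _]big1 // => k _; rewrite [X in _ * X]mxE mulr0.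
  by apply: trmx_inj; rewrite mulmxA !trmx_mul !trmxK uH trmx0.
rewrite pmulr_rle0 // => u0; have /eqP := le_anti (introT andP (conj u0 (sqn_ge0 _))).
by rewrite sqn_eq0 => /eqP /(congr1 trmx); rewrite trmxK trmx0.
Qed.

Definition colproj : 'M[R]_n := Z *m invmx (Z^T *m Z) *m Z^T.

Lemma tr_colproj : colproj^T = colproj.
Proof. by rewrite /colproj !trmx_mul trmxK trmx_inv trmx_mul trmxK mulmxA. Qed.

Lemma colprojC i j : colproj i j = colproj j i.
Proof. by rewrite -{1}tr_colproj [LHS]mxE. Qed.

Lemma colproj_id : colproj *m Z = Z.
Proof. by rewrite /colproj -!mulmxA mulVmx ?mulmx1 // gram_unitmx. Qed.

Lemma colproj_idem : colproj *m colproj = colproj.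
Proof. by rewrite {2}/colproj !mulmxA colproj_id. Qed.

Lemma mxtrace_colproj : \tr colproj = d%:R.
Proof.
by rewrite /colproj mxtrace_mulC mulmxA mulmxV ?gram_unitmx // mxtrace1.
Qed.

Lemma dot_colproj u v : dot u (colproj *m v) = dot (colproj *m u) (colproj *m v).
Proof. by rewrite dot_mulmx tr_colproj mulmxA colproj_idem. Qed.

(** The left-hand side is |u - P u|^2, and u - Z w has the same component orthogonal to the range of
    Z as u. *)
Lemma sqn_sub_colproj u w : sqn u - sqn (colproj *m u) <= sqn (u - Z *m w).
Proof.
set y := u - Z *m w.
have yE : y - colproj *m y = u - colproj *m u.
  by rewrite mulmxDr mulmxN mulmxA colproj_id opprB addrA subrK.
have H1 : dot y (y - colproj *m y) = sqn y - sqn (colproj *m y).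
  by rewrite dotDr dotNr dot_colproj.
have H2 : dot y (u - colproj *m u) = sqn u - sqn (colproj *m u).
  rewrite dotDl dotNl [dot (Z *m w) _]dot_mulmx mulmxDr mulmxN mulmxA.
  have -> : Z^T *m colproj = Z^T by rewrite -tr_colproj -trmx_mul colproj_id.
  rewrite subrr [X in _ - X]big1 ?subr0 => [|k _]; last by rewrite [X in _ * X]mxE mulr0.
  by rewrite dotDr dotNr dot_colproj.
by have := sqn_ge0 (colproj *m y); rewrite -H2 -yE H1; lra.
Qed.

(** The Frobenius norm of P M is that of M^T P, and the squared norms of the columns of P sum to tr
    P = d. So the projection costs d times a squared operator norm, whatever the number of columns
    of M. *)
Lemma sum_sqn_colproj m (M : 'M[R]_(n, m)) k : 
  (forall v, sqn (M^T *m v) <= k * sqn v) ->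
  \sum_j sqn (colproj *m col j M) <= d%:R * k.
Proof.
move=> Mk; have -> : \sum_j sqn (colproj *m col j M) =
    \sum_i sqn (M^T *m col i colproj).
  under eq_bigr do rewrite sqnE; rewrite exchange_big; apply: eq_bigr => i _.
  rewrite sqnE; apply: eq_bigr => j _; congr (_ ^+ 2); rewrite [LHS]mxE [RHS]mxE.
  apply: eq_bigr => l _.
  by rewrite [col j M _ _]mxE [M^T _ _]mxE [col i _ _ _]mxE colprojC mulrC.
rewrite (le_trans (ler_sum _ (fun i _ => Mk _))) // -mulr_sumr mulrC.
suff -> : \sum_i sqn (col i colproj) = d%:R by [].
have -> : d%:R = \tr (colproj *m colproj).
  by rewrite colproj_idem mxtrace_colproj.
apply: eq_bigr => i _.
rewrite [RHS]mxE; apply: eq_bigr => l _.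
by rewrite [col i _ _ _]mxE {1}colprojC.
Qed.

End ColumnSpace.

(** * The ridge operator in head and tail coordinates *)

Section RidgeOp.
Variables (R : rcfType) (n d q : nat) (Z1 : 'M[R]_(n, d)) (X2 : 'M[R]_(n, q)).
Variables (l1 : 'rV[R]_d) (b : R).
Hypothesis l1_gt0 : forall j, 0 < l1 0 j.
Hypothesis b0 : 0 < b.

Definition scale_cols m k (M : 'M[R]_(m, k)) (l : 'rV[R]_k) : 'M[R]_(m, k) :=
  \matrix_(i, j) (M i j * Num.sqrt (l 0 j)).

Let X1 := scale_cols Z1 l1.

Definition ridgeop (t : 'cV[R]_n) := X1 *m (X1^T *m t) + gram X2 b t.

Lemma scale_cols_mul m k (M : 'M[R]_(m, k)) l (v : 'cV_k) :
  scale_cols M l *m v = M *m \col_j (Num.sqrt (l 0 j) * v j 0).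
Proof.
apply/matrixP => i j; rewrite ord1 !mxE; apply: eq_bigr => k' _.
by rewrite !mxE mulrA.
Qed.

Lemma scale_cols_tr_mul m k (M : 'M[R]_(m, k)) l (v : 'cV_m) j :
  ((scale_cols M l)^T *m v) j 0 = Num.sqrt (l 0 j) * (M^T *m v) j 0.
Proof.
rewrite !mxE mulr_sumr; apply: eq_bigr => i _; rewrite !mxE; ring.
Qed.

Lemma ridgeop_nrm t : b ^+ 2 * sqn t <= sqn (ridgeop t).
Proof.
have [t0|t0] := eqVneq (sqn t) 0; first by rewrite t0 mulr0 sqn_ge0.
have tp : 0 < sqn t by rewrite lt_def t0 sqn_ge0.
rewrite -(ler_pM2r tp).
have H : b * sqn t <= dot (ridgeop t) t.
  rewrite /ridgeop dotDl dot_mulmx dot_gram; have := gform_ge X2 b t.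
  by have := sqn_ge0 (X1^T *m t); rewrite /sqn; lra.
rewrite (le_trans _ (dot_sqr_le _ _)) // -mulrA -expr2 -exprMn.
have p : 0 <= b * sqn t by rewrite mulr_ge0 ?sqn_ge0 // ltW.
by rewrite lerXn2r ?nnegrE // (le_trans p).
Qed.

(** The substitution h = l1^(1/2) (v - X1^T t), g = l1^(-1/2) v. For v the head of [theta], |h|^2 is
    the head bias and |g|^2 is the signal strength of the theorem. *)
Lemma ridgeop_core N tau (v : 'cV[R]_d) t f : b = N * tau ->
  ridgeop t = X1 *m v + f ->
  core N Z1 X2 l1 tau (\col_j (Num.sqrt (l1 0 j) * (v - X1^T *m t) j 0))
    (\col_j (v j 0 / Num.sqrt (l1 0 j))) t f.
Proof.
move=> bE H; split=> [j|]; last first.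
  rewrite -bE -scale_cols_mul mulmxDr mulmxN.
  by rewrite addrAC -H /ridgeop addrAC subrr add0r.
rewrite mxE 2![in X in X / _]mxE scale_cols_tr_mul.
rewrite 3![in RHS]mxE.
have l2 : Num.sqrt (l1 0 j) ^+ 2 = l1 0 j by rewrite sqr_sqrtr // ltW.
have ln0 : Num.sqrt (l1 0 j) != 0 by rewrite gt_eqF // sqrtr_gt0.
by move: l2 ln0; set r := Num.sqrt _ => <- ln0; field.
Qed.

End RidgeOp.

(** * Bias and variance on a good design *)

Section Risk.
Variables (R : rcfType) (n d q : nat).
Variables (Z1 : 'M[R]_(n, d)) (X2 : 'M[R]_(n, q)) (l1 : 'rV[R]_d) (l2 : 'rV[R]_q).
Variables (th1 : 'cV[R]_d) (th2 : 'cV[R]_q).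
Variables (ld lam tau K K' A0 delta : R).

Let N : R := n%:R.
Let S := \sum_j l2 0 j ^+ 2.
Let phi := \sum_j l2 0 j * th2 j 0 ^+ 2.
Let s := \sum_j th1 j 0 ^+ 2 / l1 0 j.
Let X1 := scale_cols Z1 l1.
Let rop := ridgeop Z1 X2 l1 (N * tau).

(* Z1 is the whitened head X1 l1^(-1/2) of the design and X2 its unwhitened
   tail. *)
Record good_design : Prop := GoodDesign {
  gd_head_ge : forall v, 3 / 5 * N * sqn v <= sqn (Z1 *m v);
  gd_head_le : forall v, sqn (Z1 *m v) <= 7 / 5 * N * sqn v;
  gd_tail_op : forall v, sqn (X2 *m v) <= N * (K * lam) * sqn v;
  gd_tail_op2 : forall v, sqn (scale_cols X2 l2 *m v) <=
                  K' * (N * lam ^+ 2 + S) * sqn v;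
  gd_tail_ge : 3 / 5 * N * S <= \sum_j l2 0 j * sqn (col j X2);
  gd_tail_le : \sum_j l2 0 j * sqn (col j X2) <= 7 / 5 * N * S;
  gd_tail_signal : sqn (X2 *m th2) <= 7 / 5 * N * phi
}.

(** Here [ld] and [lam] are the eigenvalues on the two sides of the cut. [so_n] makes the d
    dimensions that are projected out negligible against n, and the 1/8 in [so_sparse] is what
    sigma_x >= 1 leaves of the sparsity condition. *)
Record spectrum_ok : Prop := SpectrumOk {
  so_head : forall j, ld <= l1 0 j;
  so_tail0 : forall j, 0 < l2 0 j;
  so_tail : forall j, l2 0 j <= lam;
  so_lam : 0 < lam;
  so_gap : lam <= ld;
  so_K : 1 <= K;
  so_K' : 0 < K';
  so_n : 5 * K' * d%:R <= N;
  so_N : 0 < N;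
  so_A0 : 1 <= A0;
  so_delta : 0 < delta;
  so_A0delta : (1 + A0) ^+ 2 * delta < 4;
  so_sparse : phi <= delta / 8 * lam ^+ 2 * s
}.

Hypotheses (GD : good_design) (SO : spectrum_ok) (tau0 : 0 < tau).

Let ld0 : 0 < ld. Proof. by case: SO => _ _ _ h h' *; exact: lt_le_trans h h'. Qed.
Let l1_gt0 j : 0 < l1 0 j. Proof. exact: lt_le_trans ld0 (so_head SO j). Qed.
Let lam0 := so_lam SO.
Let N0 : 0 < N := so_N SO.
Let K0 : 0 < K. Proof. exact: lt_le_trans ltr01 (so_K SO). Qed.
Let A00 : 0 < A0. Proof. exact: lt_le_trans ltr01 (so_A0 SO). Qed.
Let b0 : 0 < N * tau. Proof. by rewrite mulr_gt0. Qed.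
Let a0 : 0 <= N * (K * lam). Proof. by rewrite ltW // !mulr_gt0. Qed.

Let s0 : 0 <= s.
Proof. by apply: sumr_ge0 => j _; rewrite divr_ge0 ?sqr_ge0 // ltW. Qed.

Let phi0 : 0 <= phi.
Proof. by apply: sumr_ge0 => j _; rewrite mulr_ge0 ?sqr_ge0 // ltW // (so_tail0 SO). Qed.

Let S0 : 0 <= S.
Proof. by apply: sumr_ge0 => j _; rewrite sqr_ge0. Qed.

Section Bias.
Variable t : 'cV[R]_n.
Hypothesis tE : rop t = X1 *m th1 + X2 *m th2.

Let h := \col_j (Num.sqrt (l1 0 j) * (th1 - X1^T *m t) j 0).
Let g := \col_j (th1 j 0 / Num.sqrt (l1 0 j)).
Let f := X2 *m th2.

Let cr : core N Z1 X2 l1 tau h g t f.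
Proof. exact: (ridgeop_core l1_gt0 _ tE). Qed.

Definition bias1 := \sum_j l1 0 j * ((th1 - X1^T *m t) j 0) ^+ 2.
Definition bias2 := \sum_j l2 0 j * ((th2 - X2^T *m t) j 0) ^+ 2.

Let bias1E : bias1 = sqn h.
Proof.
rewrite sqnE; apply: eq_bigr => j _; rewrite [h _ _]mxE exprMn sqr_sqrtr //.
exact: ltW.
Qed.

Let sE : s = sqn g.
Proof.
rewrite sqnE; apply: eq_bigr => j _; rewrite [g _ _]mxE expr_div_n sqr_sqrtr //.
exact: ltW.
Qed.

Let phi_le : lam <= A0 * tau -> phi <= A0 ^+ 2 / (2 * (1 + A0) ^+ 2) * (tau ^+ 2 * s).
Proof.
move=> lt; apply: (le_trans (so_sparse SO)).
have p : 0 < (1 + A0) ^+ 2 by rewrite exprn_gt0 // addr_gt0.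
have D : delta <= 4 / (1 + A0) ^+ 2.
  by rewrite ler_pdivlMr // mulrC ltW // (so_A0delta SO).
have L : lam ^+ 2 <= A0 ^+ 2 * tau ^+ 2.
  by rewrite -exprMn lerXn2r ?nnegrE // ltW // mulr_gt0.
rewrite mulrA ler_wpM2r //.
have -> : A0 ^+ 2 / (2 * (1 + A0) ^+ 2) * tau ^+ 2 =
   4 / (1 + A0) ^+ 2 / 8 * (A0 ^+ 2 * tau ^+ 2).
  by field; rewrite gt_eqF // addr_gt0.
rewrite ler_pM ?sqr_ge0 ?divr_ge0 ?ler_wpM2r ?invr_ge0 ?ler0n //.
exact: ltW (so_delta SO).
Qed.

Let signal_le : lam <= A0 * tau ->
  nrm g <= (1 + A0) * nrm h * (1 / ld + 7 / 5 / tau).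
Proof.
move=> lt.
have := core_bias_lower N0 ld0 tau0 (so_head SO) (gd_head_le GD) cr.
set x := nrm h * _; set y := Num.sqrt _ * _ / _.
(* The perturbation may use up the share A0 / (1 + A0) of |g|; the head term must then cover the
   remaining share, whence the factor 1 + A0. *)
suff : y <= A0 / (1 + A0) * nrm g.
  move=> H1 H2; have : nrm g <= x + A0 / (1 + A0) * nrm g.
    by rewrite (le_trans H2) // lerD2l.
  have E : nrm g = nrm g / (1 + A0) + A0 / (1 + A0) * nrm g.
    by field; rewrite gt_eqF // addr_gt0.
  rewrite {1}E lerD2r ler_pdivrMr ?addr_gt0 // => H3.
  by rewrite -mulrA -/x mulrC.
rewrite /y ler_pdivrMr // -(@ler_pXn2r _ 2 isT) ?nnegrE; last 2 first.
- by rewrite mulr_ge0 ?sqrtr_ge0.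
- by rewrite !mulr_ge0 ?nrm_ge0 ?divr_ge0 ?addr_ge0 ?invr_ge0 // ltW ?addr_gt0.
have N7 : 0 <= 7 / 5 * N by have := N0; lra.
rewrite exprMn sqr_nrm sqr_sqrtr //.
apply: (@le_trans _ _ (7 / 5 * N * (7 / 5 * N * phi))).
  by rewrite ler_wpM2l ?(gd_tail_signal GD).
have := phi_le lt; rewrite !exprMn sqr_nrm -sE.
set w := A0 ^+ 2 / _ * _; move=> H.
have wE : (A0 ^+ 2 * ((1 + A0)^-1) ^+ 2 * s) * (N ^+ 2 * tau ^+ 2) = 2 * N ^+ 2 * w.
  by rewrite /w; field; rewrite gt_eqF // addr_gt0.
rewrite wE; have : N ^+ 2 * phi <= N ^+ 2 * w by rewrite ler_wpM2l ?sqr_ge0.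
have : 0 <= N ^+ 2 * phi by rewrite mulr_ge0 ?sqr_ge0.
(* Here 49/25 < 2 is what closes the estimate; the 2 is the one in the denominator of [phi_le]. *)
have -> : 7 / 5 * N * (7 / 5 * N * phi) = 49 / 25 * (N ^+ 2 * phi) by field.
rewrite -[2 * _ * w]mulrA; move: (N ^+ 2 * phi) (N ^+ 2 * w) => u v; lra.
Qed.

Lemma bias_lower_mid : lam <= A0 * tau -> tau <= A0 * ld ->
  s * tau ^+ 2 <= ((1 + A0) * (A0 + 7 / 5)) ^+ 2 * bias1.
Proof.
move=> lt tl; rewrite sE bias1E -!sqr_nrm -!exprMn.
have c0 : 0 <= A0 + 7 / 5 by rewrite addr_ge0 ?divr_ge0 ?ler0n // ltW.
have p1 : 0 <= nrm g * tau by rewrite mulr_ge0 ?nrm_ge0 // ltW.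
have c1 : 0 <= 1 + A0 by rewrite addr_ge0 // ltW.
have p2 : 0 <= (1 + A0) * (A0 + 7 / 5) * nrm h.
  by rewrite mulr_ge0 ?nrm_ge0 // mulr_ge0.
rewrite lerXn2r ?nnegrE // -ler_pdivlMr // (le_trans (signal_le lt)) //.
have -> : (1 + A0) * (A0 + 7 / 5) * nrm h / tau =
  (1 + A0) * nrm h * (A0 / tau + 7 / 5 / tau) by ring.
rewrite ler_wpM2l ?mulr_ge0 ?nrm_ge0 // lerD2r.
by rewrite ler_pdivlMr // mulrAC mul1r ler_pdivrMr // mulrC.
Qed.

Lemma bias_lower_large : A0 * ld <= tau ->
  s * ld ^+ 2 <= ((1 + A0) * (12 / 5)) ^+ 2 * bias1.
Proof.
move=> tl; have lt1 : ld <= tau.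
  by rewrite (le_trans _ tl) // ler_peMl ?(so_A0 SO) // ltW.
have lt : lam <= A0 * tau.
  rewrite (le_trans (so_gap SO)) // (le_trans lt1) //.
  by rewrite ler_peMl ?(so_A0 SO) // ltW.
rewrite sE bias1E -!sqr_nrm -!exprMn.
have p1 : 0 <= nrm g * ld by rewrite mulr_ge0 ?nrm_ge0 // ltW.
have c1 : 0 <= 1 + A0 by rewrite addr_ge0 // ltW.
have p2 : 0 <= (1 + A0) * (12 / 5) * nrm h.
  by rewrite mulr_ge0 ?nrm_ge0 // mulr_ge0 // divr_ge0 ?ler0n.
rewrite lerXn2r ?nnegrE // -ler_pdivlMr // (le_trans (signal_le lt)) //.
have -> : (1 + A0) * (12 / 5) * nrm h / ld =
  (1 + A0) * nrm h * (1 / ld + 7 / 5 / ld) by field; rewrite gt_eqF.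
rewrite ler_wpM2l ?mulr_ge0 ?nrm_ge0 // lerD2l.
by rewrite ler_wpM2l ?divr_ge0 // lef_pV2 ?posrE.
Qed.

(** Bound for the condition number (a + b) / b of the regularized tail Gram matrix when lam <= A0
    tau. *)
Let kap := K * A0 + 1.
Let kap1 : 1 <= kap. Proof. by rewrite lerDr mulr_ge0 // ltW. Qed.

Let ab_le : lam <= A0 * tau -> N * (K * lam) + N * tau <= N * tau * kap.
Proof.
move=> lt; rewrite /kap mulrDr mulr1 lerD2r -!mulrA ler_wpM2l ?(ltW N0) //.
by rewrite mulrCA ler_wpM2l ?(ltW K0) // mulrC.
Qed.

(** Everything is measured against G = tau |g|, whose square is s tau^2. The quadratic inequality
    [core_bias_upper] gives |h| <= 10 kap G; the tail bias then follows from the energy bound on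
    X2^T t. *)
Lemma bias_upper : lam <= A0 * tau ->
  bias1 + bias2 <= (100 * kap ^+ 2 + 42 * kap * A0 + 1) * (s * tau ^+ 2).
Proof.
move=> lt.
have ph : phi <= tau ^+ 2 * s / 2.
  rewrite (le_trans (phi_le lt)) // [leLHS]mulrC.
  rewrite (ler_wpM2l (mulr_ge0 (sqr_ge0 _) s0)) //.
  have p : 0 < (1 + A0) ^+ 2 by rewrite exprn_gt0 // addr_gt0.
  have p2 : 0 < 2 * (1 + A0) ^+ 2 by apply: mulr_gt0.
  rewrite ler_pdivrMr // mulrA mulVf ?pnatr_eq0 // mul1r.
  by rewrite lerXn2r ?nnegrE ?addr_ge0 ?lerDr ?(ltW A00).
have fs : sqn f <= N * (tau ^+ 2 * s).
  apply: (le_trans (gd_tail_signal GD)).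
  have := ler_wpM2l (ltW N0) ph.
  have : 0 <= N * phi by rewrite mulr_ge0 // ltW.
  lra.
set G := tau * nrm g; set H := nrm h.
have G0 : 0 <= G by rewrite mulr_ge0 ?nrm_ge0 // ltW.
have H0 : 0 <= H by exact: nrm_ge0.
have G2 : tau ^+ 2 * s = G ^+ 2 by rewrite exprMn sqr_nrm -sE.
rewrite G2 in ph fs.
have fb : sqn f / (N * tau) <= G ^+ 2 / tau.
  rewrite ler_pdivrMr // (le_trans fs) //.
  suff -> : N * G ^+ 2 = G ^+ 2 / tau * (N * tau) by [].
  by field; rewrite gt_eqF.
have en : gform X2 (N * tau) t <= (2 * (H * G) + G ^+ 2) / tau.
  apply: (le_trans (core_energy2 N0 ld0 tau0 (so_head SO) cr)).
  rewrite [leRHS]mulrDl lerD // /G.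
  suff -> : 2 * (H * (tau * nrm g)) / tau = 2 * (H * nrm g) by [].
  by field; rewrite gt_eqF.
have HH : H ^+ 2 <= 10 / 3 * kap * (2 * (H * G) + G ^+ 2) + 10 / 3 * G ^+ 2.
  have := core_bias_upper N0 ld0 lam0 tau0 K0 (so_head SO)
    (gd_head_ge GD) (gd_tail_op GD) cr.
  rewrite -/f -sqr_nrm -/H => B1.
  have B2 : 2 * (N * (K * lam) + N * tau) * (2 * (H * nrm g) + sqn f / (N * tau))
    <= 2 * (N * tau * kap) * ((2 * (H * G) + G ^+ 2) / tau).
    rewrite ler_pM //.
    - by rewrite mulr_ge0 // addr_ge0 // ltW.
    - by rewrite addr_ge0 ?divr_ge0 ?sqn_ge0 ?mulr_ge0 ?nrm_ge0 // ltW.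
    - by rewrite ler_wpM2l // ab_le.
    - rewrite [leRHS]mulrDl lerD // /G.
      suff -> : 2 * (H * (tau * nrm g)) / tau = 2 * (H * nrm g) by [].
      by field; rewrite gt_eqF.
  have B3 : 2 * (N * tau * kap) * ((2 * (H * G) + G ^+ 2) / tau) =
    N * (2 * kap * (2 * (H * G) + G ^+ 2)) by field; rewrite gt_eqF.
  rewrite B3 in B2.
  have : N * (3 / 5 * H ^+ 2) <= N * (2 * kap * (2 * (H * G) + G ^+ 2) + 2 * G ^+ 2).
    rewrite [N * (_ + _)]mulrDr.
    by move: B1 B2 fs; rewrite -/(sqn f); set u := 2 * _ * (_ + _); lra.
  by rewrite ler_pM2l //; lra.
have HG : H <= 10 * kap * G.
  have p : 0 <= 10 * kap * G.
    by rewrite mulr_ge0 // mulr_ge0 ?ler0n // (le_trans ler01).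
  rewrite -(@ler_pXn2r _ 2) ?nnegrE //.
  (* This square trades the cross term (20/3) kap H G for half of H^2 and a multiple of kap^2
     G^2. *)
  have sq : 0 <= (H - 20 / 3 * kap * G) ^+ 2 by rewrite sqr_ge0.
  have k2 : kap * G ^+ 2 <= kap ^+ 2 * G ^+ 2.
    by rewrite ler_wpM2r ?sqr_ge0 // expr2 ler_peMl // (le_trans ler01).
  have k3 : G ^+ 2 <= kap * G ^+ 2 by rewrite ler_peMl ?sqr_ge0.
  have k4 : 0 <= (kap * G) ^+ 2 by rewrite sqr_ge0.
  lra.
have X2t : sqn (X2^T *m t) <= (20 * kap + 1) * G ^+ 2 / tau.
  apply: (le_trans (gform_ge_tr X2 b0 t)); apply: (le_trans en).
  rewrite ler_wpM2r ?invr_ge0 ?(ltW tau0) //.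
  by have := ler_wpM2r G0 HG; lra.
have b2 : bias2 <= 2 * phi + 2 * lam * sqn (X2^T *m t).
  rewrite sqnE /phi !mulr_sumr -big_split /=; apply: ler_sum => j _.
  rewrite mxE [(- (_ *m _)) _ _]mxE; set x := (_ *m _) _ _; set y := th2 _ _.
  have := sqr_ge0 (y + x).
  have /(ler_wpM2r (sqr_ge0 x)) := so_tail SO j.
  move=> i1 /(mulr_ge0 (ltW (so_tail0 SO j))).
  by move: i1; set l := l2 0 j; nra.
have lt2 : lam * sqn (X2^T *m t) <= A0 * (20 * kap + 1) * G ^+ 2.
  apply: (@le_trans _ _ (A0 * tau * ((20 * kap + 1) * G ^+ 2 / tau))).
    by rewrite ler_pM ?sqn_ge0 // ltW.
  suff -> : A0 * tau * ((20 * kap + 1) * G ^+ 2 / tau) = A0 * (20 * kap + 1) * G ^+ 2 by [].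
  by field; rewrite gt_eqF.
have b1 : bias1 <= 100 * kap ^+ 2 * G ^+ 2.
  rewrite bias1E -sqr_nrm -/H (le_trans (_ : _ <= (10 * kap * G) ^+ 2)) //.
    by rewrite lerXn2r ?nnegrE // (le_trans H0).
  by rewrite !exprMn; lra.
have k3 : A0 * G ^+ 2 <= kap * A0 * G ^+ 2.
  by rewrite -mulrA ler_peMl // mulr_ge0 ?sqr_ge0 // ltW.
by rewrite [s * _]mulrC G2; lra.
Qed.

End Bias.
Section Variance.
Variables (t1 : 'I_d -> 'cV[R]_n) (t2 : 'I_q -> 'cV[R]_n).
Hypothesis t1E : forall j, rop (t1 j) = col j X1.
Hypothesis t2E : forall j, rop (t2 j) = col j X2.

Definition var1 := \sum_j l1 0 j * sqn (t1 j).
Definition var2 := \sum_j l2 0 j * sqn (t2 j).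

Let t (j : 'I_d) := Num.sqrt (l1 0 j) *: t1 j.

Let ropZ c u : rop (c *: u) = c *: rop u.
Proof.
by rewrite /rop /ridgeop /gram -!scalemxAr !scalerDr !scalerA [c * _]mulrC.
Qed.

(** After scaling by sqrt(l1_j), head column j solves the system with data the unit vector e_j and
    no perturbation. *)
Let cr j : exists h, core N Z1 X2 l1 tau h (delta_mx j 0) (t j) 0.
Proof.
have H : rop (t j) = X1 *m (Num.sqrt (l1 0 j) *: delta_mx j 0) + 0.
  by rewrite addr0 ropZ t1E -scalemxAr colE.
have := ridgeop_core l1_gt0 (erefl _) H; set h := \col_ _ _; set g := \col_ _ _.
suff -> : g = delta_mx j 0 by exists h.
apply/matrixP => i k; rewrite [k]ord1 !mxE.
case: eqVneq => [->|_] /=; last by rewrite mulr0 mul0r.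
by rewrite mulr1 divff // gt_eqF // sqrtr_gt0.
Qed.

Let nrm_delta j : nrm (delta_mx j 0 : 'cV[R]_d) = 1.
Proof. by rewrite /nrm sqn_delta sqrtr1. Qed.

Let var1E : var1 = \sum_j sqn (t j).
Proof.
by apply: eq_bigr => j _; rewrite sqnZ sqr_sqrtr // ltW.
Qed.

(** The data e_j has norm 1, so h / ld or beta t is of order 1 by [core_g_le]; a large h forces a
    large t by [core_var_lower]. Each column thus contributes at least order 1 / N. *)
Lemma var1_lower : tau <= A0 * ld ->
  d%:R / N <= (4 * (K + A0) ^+ 2 + 3) * var1.
Proof.
move=> tl; rewrite var1E.
have -> : d%:R / N = \sum_(j < d) N^-1.
  by rewrite sumr_const card_ord mulr_natl.
rewrite mulr_sumr; apply: ler_sum => j _.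
have [h H] := cr j; set T := sqn (t j).
have T0 : 0 <= T by exact: sqn_ge0.
have G1 := core_g_le N0 ld0 (so_head SO) (gd_head_le GD) H.
have G2 := core_var_lower N0 lam0 tau0 K0 (gd_head_ge GD) (gd_tail_op GD) H.
rewrite nrm_delta in G1; rewrite -/T in G2.
have ab : N * (K * lam) + N * tau <= N * ld * (K + A0).
  rewrite -mulrA -mulrDr ler_wpM2l ?(ltW N0) // mulrDr lerD //.
    by rewrite mulrC ler_wpM2r ?(ltW K0) // (so_gap SO).
  by rewrite mulrC in tl.
have ab2 : (N * (K * lam) + N * tau) ^+ 2 * T <= (N * ld * (K + A0)) ^+ 2 * T.
  rewrite ler_wpM2r // lerXn2r ?nnegrE //; first by rewrite addr_ge0 // ltW.
  by rewrite !mulr_ge0 ?addr_ge0 // ltW.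
have hT : sqn h <= ld ^+ 2 * (5 / 3 * N * (K + A0) ^+ 2 * T).
  have := le_trans G2 ab2.
  have -> : (N * ld * (K + A0)) ^+ 2 * T =
    (3 / 5 * N) * (ld ^+ 2 * (5 / 3 * N * (K + A0) ^+ 2 * T)) by field.
  by rewrite ler_pM2l // mulr_gt0 // divr_gt0.
have x2 : (nrm h / ld) ^+ 2 <= 5 / 3 * N * (K + A0) ^+ 2 * T.
  by rewrite expr_div_n sqr_nrm ler_pdivrMr ?exprn_gt0 // mulrC.
have y2 : (Num.sqrt (7 / 5 * N) * nrm (t j)) ^+ 2 = 7 / 5 * N * T.
  rewrite exprMn sqr_nrm sqr_sqrtr //; have := N0; lra.
have fin : 1 <= N * T * (4 * (K + A0) ^+ 2 + 3).
  have NT : 0 <= N * T by rewrite mulr_ge0 // ltW.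
  have NKT : 0 <= N * (K + A0) ^+ 2 * T.
    by rewrite mulr_ge0 // mulr_ge0 ?sqr_ge0 // ltW.
  move: G1 x2 y2; set x := nrm h / ld; set y := Num.sqrt _ * _ => G1 x2 y2.
  have := sqr_ge0 (x - y).
  have : 1 <= (x + y) ^+ 2 by rewrite exprn_ege1.
  have -> : N * T * (4 * (K + A0) ^+ 2 + 3) =
    4 * (N * (K + A0) ^+ 2 * T) + 3 * (N * T) by ring.
  have e : 5 / 3 * N * (K + A0) ^+ 2 * T = 5 / 3 * (N * (K + A0) ^+ 2 * T).
    by ring.
  rewrite e in x2; rewrite -mulrA in y2; move: x2 y2 NKT NT.
  move: (N * T) (N * (K + A0) ^+ 2 * T) => u v; lra.
by rewrite -div1r ler_pdivrMr //; lra.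
Qed.

Let kap := K * A0 + 1.

Let ab_le : lam <= A0 * tau -> N * (K * lam) + N * tau <= N * tau * kap.
Proof.
move=> lt; rewrite /kap mulrDr mulr1 lerD2r -!mulrA ler_wpM2l ?(ltW N0) //.
by rewrite mulrCA ler_wpM2l ?(ltW K0) // mulrC.
Qed.

(** Without perturbation the quadratic inequality has no constant term, and division by |h| gives
    |h| of order kap tau; the energy then bounds N tau |t|^2 by 2 |h|. *)
Lemma var1_upper : lam <= A0 * tau -> var1 <= 14 * kap * (d%:R / N).
Proof.
move=> lt; rewrite var1E.
have -> : 14 * kap * (d%:R / N) = \sum_(j < d) (14 * kap / N).
  by rewrite sumr_const card_ord -mulr_natl; ring.
apply: ler_sum => j _; have [h H] := cr j.
have en := core_energy2 N0 ld0 tau0 (so_head SO) H.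
have up := core_bias_upper N0 ld0 lam0 tau0 K0 (so_head SO)
    (gd_head_ge GD) (gd_tail_op GD) H.
have z0 : sqn (0 : 'cV[R]_n) = 0 by apply/eqP; rewrite sqn_eq0.
rewrite nrm_delta z0 mul0r addr0 mulr1 in en.
rewrite nrm_delta z0 mul0r !addr0 !mulr1 mulr0 addr0 in up.
have H0 := nrm_ge0 h.
have kt : 0 <= kap * tau.
  by rewrite mulr_ge0 ?(ltW tau0) // addr_ge0 // ltW // mulr_gt0.
have hh : nrm h <= 20 / 3 * kap * tau.
  have [h0|h0] := eqVneq (nrm h) 0.
    by rewrite h0; lra.
  have hp : 0 < nrm h by rewrite lt_def h0.
  have := ler_wpM2r H0 (ab_le lt) => up2.
  have : N * nrm h * nrm h <= N * nrm h * (20 / 3 * kap * tau).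
    by move: up up2; rewrite -sqr_nrm; lra.
  by rewrite ler_pM2l // mulr_gt0.
have := gform_ge X2 (N * tau) (t j).
have -> : 14 * kap / N = (14 * kap * tau) / (N * tau) by field; rewrite !gt_eqF.
rewrite ler_pdivlMr // [_ * (N * tau)]mulrC => g1.
lra.
Qed.

Lemma var2_upper : (N * tau) ^+ 2 * var2 <= 7 / 5 * N * S.
Proof.
rewrite (le_trans _ (gd_tail_le GD)) // mulr_sumr ler_sum // => j _.
rewrite mulrCA ler_wpM2l ?(ltW (so_tail0 SO j)) // -t2E.
exact: ridgeop_nrm.
Qed.

(** Modulo the range of Z1, column j of X2 is the image of t2 j under the tail Gram operator. Of the
    energy 3/5 N S, projecting out this range removes at most d K' (N lam^2 + S), which is at most
    2/5 N S. *)
Lemma var2_lower : 5 * K' * d%:R * lam ^+ 2 <= S ->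
  1 / 5 * N * S <= (N * (K * lam) + N * tau) ^+ 2 * var2.
Proof.
move=> dS; set L := (_ + _) ^+ 2.
have c0 : 0 < 3 / 5 * N by rewrite mulr_gt0 // divr_gt0.
pose P := colproj Z1.
have step j : sqn (col j X2) - sqn (P *m col j X2) <= L * sqn (t2 j).
  pose w := \col_k (Num.sqrt (l1 0 k) * (X1^T *m t2 j) k 0).
  apply: (le_trans (sqn_sub_colproj c0 (gd_head_ge GD) (col j X2) w)).
  rewrite -t2E /rop /ridgeop scale_cols_mul -/w addrAC subrr add0r.
  exact: (sqn_gram_le a0 b0 (gd_tail_op GD)).
have up : \sum_j l2 0 j * (sqn (col j X2) - sqn (P *m col j X2)) <= L * var2.
  rewrite mulr_sumr ler_sum // => j _.
  by rewrite mulrCA ler_wpM2l ?(ltW (so_tail0 SO j)).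
apply: le_trans up; under eq_bigr do rewrite mulrBr.
rewrite sumrB.
have PE : \sum_j l2 0 j * sqn (P *m col j X2) =
    \sum_j sqn (P *m col j (scale_cols X2 l2)).
  apply: eq_bigr => j _.
  have -> : col j (scale_cols X2 l2) = Num.sqrt (l2 0 j) *: col j X2.
    by apply/matrixP => i k; rewrite !mxE mulrC.
  by rewrite -scalemxAr sqnZ sqr_sqrtr // ltW // (so_tail0 SO).
have K'0 := so_K' SO.
have cc : 0 <= K' * (N * lam ^+ 2 + S).
  by rewrite mulr_ge0 ?(ltW K'0) // addr_ge0 // mulr_ge0 ?sqr_ge0 // ltW.
have := sum_sqn_colproj c0 (gd_head_ge GD)
  (sqn_tr_le cc (gd_tail_op2 GD)).
rewrite -/P -PE => Pu.
have := gd_tail_ge GD.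
have i1 : N * (5 * K' * d%:R * lam ^+ 2) <= N * S by rewrite ler_wpM2l ?(ltW N0).
have i2 : (5 * K' * d%:R) * S <= N * S by rewrite ler_wpM2r // (so_n SO).
lra.
Qed.

End Variance.

Section Combine.
Variables (sig2 : R) (t : 'cV[R]_n).
Variables (t1 : 'I_d -> 'cV[R]_n) (t2 : 'I_q -> 'cV[R]_n).
Hypothesis sig2_ge0 : 0 <= sig2.
Hypothesis tE : rop t = X1 *m th1 + X2 *m th2.
Hypothesis t1E : forall j, rop (t1 j) = col j X1.
Hypothesis t2E : forall j, rop (t2 j) = col j X2.

Definition risk := bias1 t + bias2 t + sig2 * (var1 t1 + var2 t2).
Definition risk_rate := s * tau ^+ 2 + sig2 * (d%:R / N + S / tau ^+ 2 / N).

Let kap := K * A0 + 1.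
Let Cv := (1 + 5 * K' * A0 ^+ 2) * (4 * (K + A0) ^+ 2 + 3) + 5 * kap ^+ 2.
(** A sum of the constants of the variance bound and of the two bias bounds, so that one constant
    serves the three ranges of tau. *)
Definition lower_const := Cv + ((1 + A0) * (A0 + 7 / 5)) ^+ 2
  + ((1 + A0) * (12 / 5)) ^+ 2.
Definition upper_const := 100 * kap ^+ 2 + 42 * kap * A0 + 14 * kap + 3.

Let kap1 : 1 <= kap. Proof. by rewrite lerDr mulr_ge0 // ltW. Qed.
Let c0 : 0 <= 4 * (K + A0) ^+ 2 + 3.
Proof. by have := sqr_ge0 (K + A0); lra. Qed.
Let e0 : 0 <= 1 + 5 * K' * A0 ^+ 2.
Proof. by rewrite addr_ge0 // mulr_ge0 ?sqr_ge0 // mulr_ge0 // ltW // (so_K' SO). Qed.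
Let Cv0 : 0 <= Cv.
Proof. by apply: addr_ge0; [exact: mulr_ge0 | rewrite mulr_ge0 ?sqr_ge0]. Qed.
Let bias0 : 0 <= bias1 t + bias2 t.
Proof.
apply: addr_ge0; apply: sumr_ge0 => j _; rewrite mulr_ge0 ?sqr_ge0 // ltW //.
exact: so_tail0 SO j.
Qed.
Let dN : 0 <= d%:R / N. Proof. by rewrite divr_ge0 ?ler0n // ltW. Qed.
Let var1_ge0 : 0 <= var1 t1.
Proof. by apply: sumr_ge0 => j _; rewrite mulr_ge0 ?sqn_ge0 // ltW. Qed.
Let var2_ge0 : 0 <= var2 t2.
Proof.
by apply: sumr_ge0 => j _; rewrite mulr_ge0 ?sqn_ge0 // ltW // (so_tail0 SO).
Qed.
Let var0 : 0 <= sig2 * (var1 t1 + var2 t2).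
Proof. by rewrite mulr_ge0 // addr_ge0. Qed.
Let risk0 : 0 <= risk. Proof. exact: addr_ge0. Qed.

(* If the tail rank is at most of order d the head variance alone matches the
   rate; otherwise the part of the tail columns along the head is negligible. *)
Let var_lower (v : R) : 0 < v -> lam <= A0 * v ->
  K * lam + tau <= kap * v -> tau <= A0 * ld ->
  d%:R / N + S / v ^+ 2 / N <= Cv * (var1 t1 + var2 t2).
Proof.
move=> v0 lv kv tl; have h1 := var1_lower t1E tl.
have v2 : 0 < v ^+ 2 by rewrite exprn_gt0.
have lv2 : lam ^+ 2 <= A0 ^+ 2 * v ^+ 2.
  by rewrite -exprMn lerXn2r ?nnegrE // ltW // mulr_gt0.
have K'0 := so_K' SO; rewrite mulrDr.
have [dS|/ltW dS] := lerP (5 * K' * d%:R * lam ^+ 2) S; last first.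
  have : S / v ^+ 2 <= 5 * K' * A0 ^+ 2 * d%:R.
    rewrite ler_pdivrMr // (le_trans dS) //.
    have -> : 5 * K' * A0 ^+ 2 * d%:R * v ^+ 2 =
      5 * K' * d%:R * (A0 ^+ 2 * v ^+ 2) by ring.
    by rewrite ler_wpM2l // !mulr_ge0 ?ler0n // ltW.
  rewrite -(ler_pM2r (_ : 0 < N^-1)) ?invr_gt0 // => h2.
  rewrite (@le_trans _ _ ((1 + 5 * K' * A0 ^+ 2) * (d%:R / N))) //; first lra.
  rewrite (le_trans (ler_wpM2l e0 h1)) // mulrA.
  have := mulr_ge0 Cv0 var2_ge0.
  have : 0 <= 5 * kap ^+ 2 * var1 t1.
    by rewrite mulr_ge0 // mulr_ge0 ?sqr_ge0.
  by rewrite /Cv; lra.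
have h2 := var2_lower t2E dS.
have kv2 : (N * (K * lam) + N * tau) ^+ 2 * var2 t2 <= (N * (kap * v)) ^+ 2 * var2 t2.
  rewrite ler_wpM2r // -mulrDr lerXn2r ?nnegrE ?ler_wpM2l ?(ltW N0) //.
    by rewrite mulr_ge0 ?addr_ge0 ?mulr_ge0 // ltW.
  by rewrite mulr_ge0 ?mulr_ge0 ?(ltW N0) ?(ltW v0) // (le_trans ler01).
have h3 : S / v ^+ 2 / N <= 5 * kap ^+ 2 * var2 t2.
  rewrite -mulrA -invfM ler_pdivrMr ?mulr_gt0 //.
  rewrite -(@ler_pM2l _ (1 / 5 * N)); last by rewrite mulr_gt0 // divr_gt0.
  apply: le_trans (le_trans h2 kv2) _.
  suff -> : (N * (kap * v)) ^+ 2 * var2 t2 = 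
     1 / 5 * N * (5 * kap ^+ 2 * var2 t2 * (v ^+ 2 * N)) by [].
  by field.
have h4 : 4 * (K + A0) ^+ 2 + 3 <= Cv.
  have : 0 <= 5 * K' * A0 ^+ 2 * (4 * (K + A0) ^+ 2 + 3).
    by rewrite !mulr_ge0 ?sqr_ge0 // ltW.
  by have := sqr_ge0 kap; rewrite /Cv; lra.
have h5 : 5 * kap ^+ 2 <= Cv by rewrite lerDr mulr_ge0.
rewrite lerD //.
  by rewrite (le_trans h1) // ler_wpM2r.
by rewrite (le_trans h3) // ler_wpM2r.
Qed.

(** Only the variance counts. Since tau <= lam, the tail Gram operator has norm at most N kap lam,
    and [var_lower] applies with [v] equal to lam instead of tau. *)
Lemma risk_small : tau <= A0^-1 * lam ->
  sig2 * (d%:R / N + S / lam ^+ 2 / N) <= lower_const * risk.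
Proof.
move=> tl.
have lt : tau <= lam.
  by rewrite (le_trans tl) // ler_piMl ?(ltW lam0) // invf_le1 // (so_A0 SO).
have lA : lam <= A0 * lam by rewrite ler_peMl ?(ltW lam0) // (so_A0 SO).
have := var_lower lam0 lA; rewrite (_ : K * lam + tau <= _); last first.
  rewrite /kap mulrDl mul1r lerD // ler_wpM2r ?(ltW lam0) //.
  by rewrite ler_peMr ?(ltW K0) // (so_A0 SO).
rewrite (_ : tau <= A0 * ld); last first.
  by rewrite (le_trans lt) // (le_trans lA) // ler_wpM2l ?(ltW A00) // (so_gap SO).
move=> /(_ isT isT) /(ler_wpM2l sig2_ge0) H; apply: (le_trans H).
rewrite mulrCA (le_trans (_ : _ <= Cv * risk)) //.
  by rewrite ler_wpM2l // lerDr.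
by rewrite ler_wpM2r // /lower_const -addrA lerDl addr_ge0 ?sqr_ge0.
Qed.

Lemma risk_mid_lower : lam <= A0 * tau -> tau <= A0 * ld ->
  risk_rate <= lower_const * risk.
Proof.
move=> lt tl.
have kv : K * lam + tau <= kap * tau.
  rewrite /kap mulrDl mul1r lerD2r -mulrA ler_wpM2l // ltW //.
have H := ler_wpM2l sig2_ge0 (var_lower tau0 lt kv tl).
have B := bias_lower_mid tE lt tl.
rewrite /risk_rate /lower_const.
set c1 := (_ * _) ^+ 2 in B *; set c2 := (_ * _) ^+ 2.
have c10 : 0 <= c1 by rewrite sqr_ge0.
have c20 : 0 <= c2 by rewrite sqr_ge0.
have := mulr_ge0 c20 risk0; have := mulr_ge0 Cv0 bias0.
have := mulr_ge0 c10 var0.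
have B2 : 0 <= bias2 t.
  by apply: sumr_ge0 => j _; rewrite mulr_ge0 ?sqr_ge0 // ltW // (so_tail0 SO).
have := mulr_ge0 c10 B2.
by rewrite /risk; lra.
Qed.

Lemma risk_large : A0 * ld <= tau -> s * ld ^+ 2 <= lower_const * risk.
Proof.
move=> tl; have B := bias_lower_large tE tl.
rewrite /lower_const.
set c1 := (_ * _) ^+ 2; set c2 := (_ * _) ^+ 2 in B *.
have c10 : 0 <= c1 by rewrite sqr_ge0.
have c20 : 0 <= c2 by rewrite sqr_ge0.
have := mulr_ge0 c10 risk0; have := mulr_ge0 Cv0 risk0.
have := mulr_ge0 c20 var0.
have B2 : 0 <= bias2 t.
  by apply: sumr_ge0 => j _; rewrite mulr_ge0 ?sqr_ge0 // ltW // (so_tail0 SO).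
have := mulr_ge0 c20 B2.
by rewrite /risk; lra.
Qed.

Lemma risk_mid_upper : lam <= A0 * tau -> risk <= upper_const * risk_rate.
Proof.
move=> lt; have B := bias_upper tE lt; have V1 := var1_upper t1E lt.
have V2 := var2_upper t2E.
have V2' : var2 t2 <= 7 / 5 * (S / tau ^+ 2 / N).
  have p : 0 < (N * tau) ^+ 2 by rewrite exprn_gt0.
  rewrite -(ler_pM2l p) (le_trans V2) // le_eqVlt; apply/orP; left; apply/eqP.
  by field; rewrite !gt_eqF.
have S'0 : 0 <= S / tau ^+ 2 / N.
  by rewrite !divr_ge0 ?sqr_ge0 // ltW.
have st0 : 0 <= s * tau ^+ 2 by rewrite mulr_ge0 ?sqr_ge0.
have := ler_wpM2l sig2_ge0 (lerD V1 V2'); move: B.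
rewrite -/kap /risk /risk_rate /upper_const.
set u := s * _; set v := d%:R / N; set w := S / _ / _.
have k0 : 0 <= kap := le_trans ler01 kap1.
have kA : 0 <= 42 * kap * A0 by rewrite !mulr_ge0 // ltW.
have kk : 0 <= 100 * kap ^+ 2 by rewrite mulr_ge0 ?sqr_ge0.
set m := 100 * _ + _ in kA kk *; have m0 : 0 <= m by rewrite addr_ge0.
have sv0 : 0 <= sig2 * v by rewrite mulr_ge0.
have sw0 : 0 <= sig2 * w by rewrite mulr_ge0.
have := mulr_ge0 m0 sv0; have := mulr_ge0 m0 sw0.
have := mulr_ge0 k0 sw0; have := mulr_ge0 k0 sv0.
have := mulr_ge0 k0 st0; have := st0.
rewrite -/u; move: (bias1 t + bias2 t) (var1 t1 + var2 t2) => x y.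
by lra.
Qed.

End Combine.

End Risk.

Lemma lower_const_gt0 (R : rcfType) (K K' A0 : R) :
  1 <= A0 -> 0 < K' -> 0 < lower_const K K' A0.
Proof.
move=> A1 K1; have p : 0 < (1 + A0) * (12 / 5) by lra.
have := exprn_gt0 2 p; have := sqr_ge0 ((1 + A0) * (A0 + 7 / 5)).
have := sqr_ge0 (K * A0 + 1); have c0 := sqr_ge0 (K + A0).
have : 0 <= (1 + 5 * K' * A0 ^+ 2) * (4 * (K + A0) ^+ 2 + 3).
  apply: mulr_ge0; last by lra.
  by have := mulr_ge0 (ltW K1) (sqr_ge0 A0); lra.
rewrite /lower_const; lra.
Qed.

Lemma upper_const_gt0 (R : rcfType) (K A0 : R) :
  0 <= K -> 1 <= A0 -> 0 < upper_const K A0.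
Proof.
move=> K1 A1; have := sqr_ge0 (K * A0 + 1).
have : 0 <= K * A0 by rewrite mulr_ge0 // (le_trans ler01).
have : 0 <= (K * A0 + 1) * A0.
  by rewrite mulr_ge0 ?addr_ge0 ?mulr_ge0 // (le_trans ler01).
rewrite /upper_const; lra.
Qed.

(** * A lattice net of the unit ball *)

Section LatticeCount.
Variable m : nat.
Local Open Scope nat_scope.
(** The net has mesh 1 / (4 sqrt m). Its points k / (4 sqrt m) in the unit ball satisfy sum k_i^2 <=
    16 m, so |k_i| <= 4 sqrt m <= M. *)
Let M := 4 * m.
Let dist (a : 'I_(M + M).+1) : nat := (a - M) + (M - a).

(* The entry a of f stands for the integer a - M. *)
Definition lattice_pts : {set {ffun 'I_m -> 'I_(M + M).+1}} :=
  [set f : {ffun 'I_m -> 'I_(M + M).+1} | \sum_i (dist (f i)) ^ 2 <= 16 * m].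

Lemma sum_pow2_lt k : \sum_(i < k) 2 ^ i < 2 ^ k.
Proof.
elim: k => [|k IH]; first by rewrite big_ord0.
by rewrite big_ord_recr /= expnS mul2n -addnn -addSn leq_add2r.
Qed.

Lemma sum_dist_le : \sum_(a < (M + M).+1) 2 ^ (M - dist a) <= 3 * 2 ^ M.
Proof.
rewrite -(big_mkord predT (fun a => 2 ^ (M - ((a - M) + (M - a))))).
rewrite -addSn.
rewrite (big_cat_nat (n := M.+1)) //=; last by rewrite leq_addr.
pose W i := 2 ^ (M - (i - M + (M - i))); rewrite -/(W _).
have -> : \sum_(0 <= i < M.+1) W i = \sum_(i < M.+1) 2 ^ i.
  rewrite big_mkord; apply: eq_bigr => i _.
  by congr (2 ^ _); have := ltn_ord i; lia.
have -> : \sum_(M.+1 <= i < M.+1 + M) W i = \sum_(i < M) 2 ^ i.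
  rewrite -{1}[M.+1]add0n big_addn addKn big_nat_rev big_mkord.
  by apply: eq_bigr => i _; congr (2 ^ _); have := ltn_ord i; lia.
have := sum_pow2_lt M.+1; have := sum_pow2_lt M; rewrite expnS.
move: (\sum_(i < M) _) (\sum_(i < M.+1) _) (2 ^ M) => x y z; lia.
Qed.

(* The weights 2^-|k| on Z sum to 3, so at most 3^m 2^s points of Z^m have
   l^1-norm at most s, and the l^1-norm is at most the squared l^2-norm. *)
Lemma card_lattice_pts : #|lattice_pts| <= 2 ^ (18 * m).
Proof.
have dle (a : 'I_(M + M).+1) : dist a <= M by rewrite /dist; have := ltn_ord a; lia.
(* The factor 2^(M m) clears the denominators of the weights 2^-|k|, which keeps the count in the
   natural numbers. *)
suff H : 2 ^ (M * m) * #|lattice_pts| <= 2 ^ (M * m) * 2 ^ (18 * m).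
  by move: H; rewrite leq_pmul2l ?expn_gt0.
pose w (f : {ffun 'I_m -> 'I_(M + M).+1}) := \prod_i 2 ^ (M - dist (f i)).
have wE f : f \in lattice_pts -> 2 ^ (M * m) <= 2 ^ (16 * m) * w f.
  rewrite inE => fin.
  have -> : 2 ^ (M * m) = 2 ^ (\sum_i dist (f i)) * w f.
    rewrite mulnC -[X in X * M]card_ord -sum_nat_const expn_sum.
    rewrite expn_sum -big_split; apply: eq_bigr => i _ /=.
    by rewrite -expnD subnKC.
  rewrite leq_mul2r leq_pexp2l ?orbT // (leq_trans _ fin) //.
  by apply: leq_sum => i _; rewrite -mulnn; case: (dist _) => // k; rewrite leq_pmulr.
rewrite mulnC -sum_nat_const.
apply: (@leq_trans (\sum_(f in lattice_pts) 2 ^ (16 * m) * w f)).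
  exact: leq_sum.
rewrite -big_distrr /=.
rewrite (leq_trans (_ : _ <= 2 ^ (16 * m) * \sum_f w f)) //.
  rewrite leq_mul2l; apply/orP; right.
  by rewrite [leqRHS](bigID (mem lattice_pts)) /= leq_addr.
rewrite -(bigA_distr_bigA (fun (i : 'I_m) (a : 'I_(M + M).+1) => 2 ^ (M - dist a))).
rewrite big_const card_ord iter_muln_1.
rewrite (leq_trans (_ : _ <= 2 ^ (16 * m) * (3 * 2 ^ M) ^ m)) //.
  rewrite leq_mul2l; apply/orP; right.
  by case: (m) (sum_dist_le) => // k h; rewrite leq_exp2r.
rewrite expnMn -expnM mulnCA mulnA [2 ^ (M * m) * _]mulnC leq_mul2r.
apply/orP; right; rewrite mulnC.
have -> : 18 * m = 16 * m + 2 * m by lia.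
rewrite expnD leq_mul2l; apply/orP; right; rewrite expnM.
by case: (m) => // k; rewrite leq_exp2r.
Qed.

End LatticeCount.

Section Net.
Variables (R : realType) (m : nat).

Definition net_vec (f : {ffun 'I_m -> 'I_(4 * m + 4 * m).+1}) : 'cV[R]_m :=
  \col_i (((f i)%:R - (4 * m)%:R) / (4 * Num.sqrt m%:R)).

Lemma sqr_subn_dist (a b : nat) :
  (a%:R - b%:R : R) ^+ 2 = ((a - b + (b - a)) ^ 2)%:R.
Proof.
have [ab|/ltnW ab] := leqP b a.
  rewrite (_ : (b - a)%N = 0%N) ?addn0; last by lia.
  by rewrite natrX natrB.
rewrite (_ : (a - b)%N = 0%N) ?add0n; last by lia.
by rewrite natrX natrB // -sqrrN opprB.
Qed.

Lemma sqn_net_vec f : (0 < m)%N -> f \in lattice_pts m -> sqn (net_vec f) <= 1.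
Proof.
move=> m0; rewrite inE -(ler_nat R) => H.
have mR : 0 < m%:R :> R by rewrite ltr0n.
rewrite sqnE; under eq_bigr do rewrite mxE expr_div_n exprMn sqr_sqrtr ?ler0n //.
rewrite -mulr_suml ler_pdivrMr ?mulr_gt0 ?exprn_gt0 // mul1r.
under eq_bigr do rewrite sqr_subn_dist.
rewrite -natr_sum (le_trans H) // natrM ler_wpM2r ?ler0n //.
by rewrite -natrX.
Qed.

(** Each coordinate is rounded towards 0 to a multiple of 1 / c, c = 4 sqrt m. Rounding towards 0
    keeps the point in the ball, and m errors of at most 1 / c add up to m / c^2 = 1/16 after
    squaring. *)
Lemma net_approx (u : 'cV[R]_m) : (0 < m)%N -> sqn u <= 1 ->
  exists2 f, f \in lattice_pts m & sqn (u - net_vec f) <= 1 / 16.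
Proof.
move=> m0 u1; have mR : 0 < m%:R :> R by rewrite ltr0n.
set c := 4 * Num.sqrt m%:R : R.
have c0 : 0 < c by rewrite mulr_gt0 // sqrtr_gt0.
have c2 : c ^+ 2 = 16 * m%:R.
  by rewrite exprMn sqr_sqrtr ?ler0n // -natrX.
have cm : c <= (4 * m)%:R.
  rewrite natrM ler_wpM2l // -(@ler_pXn2r _ 2) ?nnegrE ?sqrtr_ge0 ?ler0n //.
  by rewrite sqr_sqrtr ?ler0n // -natrX ler_nat -mulnn leq_pmulr.
pose k i := Num.truncn (`|u i 0| * c).
have tk i : (k i)%:R <= `|u i 0| * c.
  by have /andP[] := truncn_itv (mulr_ge0 (normr_ge0 (u i 0)) (ltW c0)).
have kt i : `|u i 0| * c < (k i).+1%:R.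
  by have /andP[] := truncn_itv (mulr_ge0 (normr_ge0 (u i 0)) (ltW c0)).
have u1i i : u i 0 ^+ 2 <= 1.
  rewrite (le_trans _ u1) // sqnE (bigD1 i) //= lerDl.
  by apply: sumr_ge0 => j _; rewrite sqr_ge0.
have km i : (k i <= 4 * m)%N.
  rewrite -(ler_nat R) (le_trans (tk i)) // (le_trans _ cm) //.
  rewrite ler_piMl ?(ltW c0) // -(@ler_pXn2r _ 2 isT) ?nnegrE //.
  by rewrite -normrX ger0_norm ?sqr_ge0 // expr1n.
pose a i := if 0 <= u i 0 then (4 * m + k i)%N else (4 * m - k i)%N.
have am i : (a i < (4 * m + 4 * m).+1)%N.
  by rewrite /a; case: ifP => _; have := km i; lia.
pose f := [ffun i => Ordinal (am i)].
have fE i : ((f i)%:R - (4 * m)%:R : R) = Num.sg (u i 0) * (k i)%:R.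
  rewrite ffunE /= /a; case: sgrP => [ui|ui|ui].
  - by rewrite /k ui normr0 mul0r truncn0 addn0 subrr mulr0.
  - by rewrite natrD addrC addKr mul1r.
  - by rewrite natrB // addrC addKr mulN1r.
exists f.
  rewrite inE -(ler_nat R) natr_sum.
  under eq_bigr do rewrite -sqr_subn_dist fE exprMn.
  rewrite natrM -c2 -[leRHS]mulr1 (le_trans _ (ler_wpM2l (sqr_ge0 _) u1)) //.
  rewrite sqnE mulr_sumr ler_sum // => i _.
  have -> : u i 0 ^+ 2 = `|u i 0| ^+ 2 by rewrite -normrX ger0_norm ?sqr_ge0.
  rewrite -[leRHS]exprMn.
  have [->|un0] := eqVneq (u i 0) 0; first by rewrite sgr0 expr0n mul0r sqr_ge0.
  rewrite sqr_sg un0 mul1r lerXn2r ?nnegrE ?ler0n // ?[c * _]mulrC //.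
  by rewrite mulr_ge0 ?normr_ge0 ?(ltW c0).
rewrite sqnE (@le_trans _ _ (\sum_(i < m) (c^-1) ^+ 2)) //; last first.
  rewrite sumr_const card_ord -mulr_natl exprVn c2 le_eqVlt; apply/orP; left.
  by apply/eqP; field; rewrite gt_eqF.
apply: ler_sum => i _; rewrite mxE [(- net_vec f) _ _]mxE [net_vec f _ _]mxE fE -/c.
have uE : u i 0 = Num.sg (u i 0) * `|u i 0| by rewrite -numEsg.
rewrite {1}uE -mulrA -mulrBr exprMn.
have sg1 : Num.sg (u i 0) ^+ 2 <= 1 by case: sgrP; rewrite ?expr0n ?sqrrN ?expr1n.
rewrite -[leRHS]mul1r ler_pM ?sqr_ge0 // lerXn2r ?nnegrE ?invr_ge0 ?(ltW c0) //.
  by rewrite subr_ge0 ler_pdivrMr.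
rewrite -(ler_pM2r c0) mulrBl mulVf ?gt_eqF // divfK ?gt_eqF //.
by have := kt i; rewrite -natr1; lra.
Qed.

Section Form.
Variable M : 'M[R]_m.
Hypothesis M_sym : M^T = M.

Let qf (u : 'cV[R]_m) := dot u (M *m u).
Let qfZ a u : qf (a *: u) = a ^+ 2 * qf u.
Proof. by rewrite /qf -scalemxAr dotZl dotZr mulrA expr2. Qed.
Let bf_sym u v : dot u (M *m v) = dot v (M *m u).
Proof. by rewrite dotC dot_mulmx M_sym. Qed.

(* A symmetric form is determined up to a factor 2 by its values on a
   1/4-net of the unit ball: q u - q v = b (u - v, u + v). *)
Lemma form_le_net c : (0 < m)%N ->
  (forall f, f \in lattice_pts m ->
     `|dot (net_vec f) (M *m net_vec f)| <= c) ->
  forall u, `|dot u (M *m u)| <= 2 * c * sqn u.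
Proof.
move=> m0 netc.
pose E := [set `|qf u| | u in [set u : 'cV[R]_m | sqn u <= 1]].
have z0 : sqn (0 : 'cV[R]_m) = 0 by apply/eqP; rewrite sqn_eq0.
(* A crude bound by the entries of M: the final inequality S <= c + S / 2 is conclusive only for a
   finite S. *)
have hE : has_sup E.
  split; first by exists `|qf 0|, 0 => //=; rewrite z0.
  exists (1 + \sum_i sqn (row i M)^T) => _ [u /= u1 <-].
  have qu : qf u ^+ 2 <= \sum_i sqn (row i M)^T.
    rewrite (le_trans (dot_sqr_le _ _)) // (@le_trans _ _ (1 * sqn (M *m u))) //.
      by rewrite ler_wpM2r ?sqn_ge0.
    rewrite mul1r sqnE; apply: ler_sum => i _.
    have -> : (M *m u) i 0 = dot (row i M)^T u.
      by rewrite mxE; apply: eq_bigr => j _; rewrite !mxE.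
    rewrite (le_trans (dot_sqr_le _ _)) // -[leRHS]mulr1.
    by rewrite ler_wpM2l ?sqn_ge0.
  have := sqr_ge0 (`|qf u| - 1 / 2); have : qf u ^+ 2 = `|qf u| ^+ 2.
    by rewrite -normrX ger0_norm ?sqr_ge0.
  by move: qu => /[swap] ->; lra.
set S := sup E.
have ES u : sqn u <= 1 -> `|qf u| <= S.
  by move=> u1; apply: sup_upper_bound => //; exists u.
have S0 : 0 <= S by apply: le_trans (ES 0 _); rewrite ?normr_ge0 // z0.
have ESq u : `|qf u| <= S * sqn u.
  have [u0|u0] := eqVneq (sqn u) 0.
    have /eqP := u0; rewrite sqn_eq0 => /eqP ->.
    by rewrite /qf mulmx0 z0 mulr0 [dot _ _]big1 ?normr0 // => i _; rewrite mxE mul0r.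
  have up : 0 < sqn u by rewrite lt_def u0 sqn_ge0.
  have r0 : nrm u != 0 by rewrite gt_eqF // sqrtr_gt0.
  have /ES : sqn ((nrm u)^-1 *: u) <= 1.
    by rewrite sqnZ exprVn sqr_nrm mulVf.
  by rewrite qfZ normrM ger0_norm ?sqr_ge0 // exprVn sqr_nrm ler_pdivrMl // mulrC.
have bS e w : sqn e <= 1 -> sqn w <= 1 -> `|dot e (M *m w)| <= S.
  move=> e1 w1; have pol : 4 * dot e (M *m w) = qf (e + w) - qf (e - w).
    rewrite /qf mulmxDr mulmxDr mulmxN !dotE (bf_sym w e); ring.
  have := ler_normB (qf (e + w)) (qf (e - w)); rewrite -pol normrM ger0_norm //.
  have := ESq (e + w); have := ESq (e - w).
  rewrite !sqnD dotNr (_ : sqn (- w) = sqn w); last first.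
    by rewrite -scaleN1r sqnZ sqrrN expr1n mul1r.
  have := ler_wpM2l S0 e1; have := ler_wpM2l S0 w1; lra.
have step u : sqn u <= 1 -> `|qf u| <= c + S / 2.
  move=> u1; have [f fN uf] := net_approx m0 u1.
  set v := net_vec f in uf; have v1 : sqn v <= 1 by exact: sqn_net_vec.
  have qe : qf u = qf v + dot (u - v) (M *m (u + v)).
    by rewrite /qf mulmxDr !dotE (bf_sym v u); ring.
  rewrite qe (le_trans (ler_normD _ _)) // lerD //; first exact: netc.
  (* The factors 4 and 1/2 bring both arguments into the unit ball; undoing them leaves the
     contraction factor 2 / 4. *)
  have e1 : sqn (4 *: (u - v)) <= 1 by rewrite sqnZ; lra.
  have w1 : sqn (2^-1 *: (u + v)) <= 1.
    rewrite sqnZ; have := sqn_ge0 (u - v); rewrite !sqnD dotNr.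
    rewrite (_ : sqn (- v) = sqn v); last first.
      by rewrite -scaleN1r sqnZ sqrrN expr1n mul1r.
    by lra.
  have := bS _ _ e1 w1; rewrite -scalemxAr !(dotZl, dotZr) mulrA normrM.
  by rewrite ger0_norm ?mulr_ge0 ?invr_ge0 //; lra.
have S2 : S <= c + S / 2.
  by apply: ge_sup; [case: hE | move=> _ [u /= u1 <-]; exact: step].
move=> u; rewrite (le_trans (ESq u)) // ler_wpM2r ?sqn_ge0 //; lra.
Qed.

End Form.
End Net.

(** * Products and pairs of independent variables *)

Section Density.
Context d d' (T : measurableType d) (U : measurableType d') (R : realType).
Variables (P : {measure set T -> \bar R}) (Z : T -> U).
Hypothesis mZ : measurable_fun setT Z.
Import HBNNSimple.

Lemma integral_nnsfun_density (h : {nnsfun U >-> R}) (G : T -> R) :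
  measurable_fun setT G -> (forall w, 0 <= G w) ->
  (\int[P]_w (h (Z w) * G w)%:E =
   \sum_(r \in range h) (r%:E * \int[P]_(w in Z @^-1` (h @^-1` [set r])) (G w)%:E))%E.
Proof.
move=> mG G0.
have mI (r : R) : measurable_fun setT (\1_(h @^-1` [set r]) \o Z : T -> R).
  by apply: measurableT_comp => //; exact: measurable_indic.
have mI2 (r : R) :
    measurable_fun setT (fun w => \1_(h @^-1` [set r]) (Z w) * G w).
  by apply: measurable_funM => //; exact: mI.
transitivity (\int[P]_w (\sum_(r \in range h)
    (r * (\1_(h @^-1` [set r]) (Z w) * G w))%:E))%E.
  apply: eq_integral => w _; rewrite fsumEFin // fimfunE mulr_fsuml //.
  by congr EFin; apply: eq_fsbigr => r _; rewrite mulrA.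
rewrite ge0_integral_fsum //; first last.
- move=> r w _; rewrite lee_fin mulrA mulr_ge0 //.
  by have := nnfun_muleindic_ge0 h r (Z w); rewrite -EFinM lee_fin.
- move=> r; apply/measurable_EFinP; apply: measurable_funM => //.
apply: eq_fsbigr => r; rewrite inE => -[u _ <-].
under eq_integral do rewrite EFinM.
rewrite ge0_integralZl_EFin //; first last.
- exact/measurable_EFinP.
- by move=> w _; rewrite lee_fin mulr_ge0.
congr (_ * _)%E; rewrite [RHS]integral_mkcond; apply: eq_integral => w _.
rewrite /patch /= indicE; case: ifPn => [|]; [rewrite inE|rewrite notin_setE] => /= wA.
  by rewrite (_ : Z w \in _) ?mul1r // inE.
by rewrite memNset ?mul0r.
Qed.

(** The hypothesis is the case where f is an indicator; simple functions and monotone convergence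
    give the rest. It serves to replace, in front of a function of Z, an independent factor by its
    mean. *)
Lemma ge0_integral_density (f : U -> R) (G G' : T -> R) :
  measurable_fun setT f -> (forall u, 0 <= f u) ->
  measurable_fun setT G -> (forall w, 0 <= G w) ->
  measurable_fun setT G' -> (forall w, 0 <= G' w) ->
  (forall B, measurable B ->
    \int[P]_(w in Z @^-1` B) (G w)%:E = \int[P]_(w in Z @^-1` B) (G' w)%:E)%E ->
  (\int[P]_w (f (Z w) * G w)%:E = \int[P]_w (f (Z w) * G' w)%:E)%E.
Proof.
move=> mf f0 mG G0 mG' G'0 GG'.
have mfE : measurable_fun setT (EFin \o f) by exact/measurable_EFinP.
pose h := nnsfun_approx measurableT mfE.
have lim (H : T -> R) : measurable_fun setT H -> (forall w, 0 <= H w) ->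
    (\int[P]_w (f (Z w) * H w)%:E =
     limn (fun n => \int[P]_w (h n (Z w) * H w)%:E))%E.
  move=> mH H0; rewrite -monotone_convergence //; first last.
  - move=> w _ a b ab; rewrite lee_fin ler_wpM2r //.
    exact/lefP/nd_nnsfun_approx.
  - by move=> n w _; rewrite lee_fin mulr_ge0.
  - move=> n; apply/measurable_EFinP; apply: measurable_funM => //.
    by apply: measurableT_comp.
  apply: eq_integral => w _; apply/esym/cvg_lim => //.
  under eq_fun do rewrite EFinM; rewrite EFinM; apply: cvgeZr => //.
  by apply: (cvg_nnsfun_approx measurableT mfE) => // u _; rewrite lee_fin.
rewrite !lim //; congr (limn _); apply/funext => n.
rewrite !integral_nnsfun_density //; apply: eq_fsbigr => r _.
by rewrite GG'.
Qed.

End Density.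

Section Independence.
Context d d' (T : measurableType d) (U : measurableType d') (R : realType).
Variables (P : probability T R) (n : nat) (Z : 'I_n -> T -> U).
Hypothesis mZ : forall i, measurable_fun setT (Z i).
Hypothesis indZ : mutually_independent P Z.

Lemma measurable_prodr (I : Type) (s : seq I) (Q : pred I) (f : I -> T -> R) :
  (forall i, measurable_fun setT (f i)) ->
  measurable_fun setT (fun w => \prod_(i <- s | Q i) f i w).
Proof.
move=> mf; elim: s => [|i s IH].
  rewrite (_ : (fun _ => _) = cst 1) //; apply/funext => w.
  by rewrite big_nil.
rewrite (_ : (fun _ => _) = if Q i then
    (fun w => f i w * \prod_(j <- s | Q j) f j w)
  else fun w => \prod_(j <- s | Q j) f j w); last first.
  by apply/funext => w; rewrite big_cons; case: ifP.
by case: ifP => // _; exact: measurable_funM.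
Qed.

Lemma integral_preimage_indic (V : measurableType d') (Y : T -> V) (B : set V)
    (G : T -> R) :
  (\int[P]_(w in Y @^-1` B) (G w)%:E = \int[P]_w (\1_B (Y w) * G w)%:E)%E.
Proof.
rewrite integral_mkcond; apply: eq_integral => w _.
rewrite /patch /= indicE; case: ifPn => [|]; [rewrite inE|rewrite notin_setE] => /= wA.
  by rewrite mem_set ?mul1r.
by rewrite memNset ?mul0r.
Qed.

Let indep_indic (B : 'I_n -> set U) : (forall k, measurable (B k)) ->
  (\int[P]_w (\prod_k \1_(B k) (Z k w))%:E =
   \prod_k \int[P]_w (\1_(B k) (Z k w) : R)%:E)%E.
Proof.
move=> mB.
have mZB k : measurable (Z k @^-1` B k) by rewrite -[X in measurable X]setTI; exact: mZ.
have E k : (\int[P]_w (\1_(B k) (Z k w) : R)%:E = P (Z k @^-1` B k))%E.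
  rewrite -[in RHS](setIT (Z k @^-1` B k)) -(integral_indic P measurableT) //.
under [RHS]eq_bigr do rewrite E.
rewrite -indZ // -[X in P X]setIT -(integral_indic P measurableT) //; last first.
  by apply: fin_bigcap_measurable => // i _.
apply: eq_integral => w _; congr EFin; rewrite indicE.
have [wB|/existsNP[k wB]] := pselect (forall k, B k (Z k w)).
  rewrite mem_set => [|k _]; last exact: wB.
  by rewrite big1 // => k _; rewrite indicE mem_set //; exact: wB.
rewrite memNset => [|/(_ k)]; last by move/(_ I).
by rewrite (bigD1 k) //= indicE memNset // mul0r.
Qed.

Theorem indep_integral_prod (f : 'I_n -> U -> R) :
  (forall k, measurable_fun setT (f k)) -> (forall k u, 0 <= f k u) ->
  (forall k, \int[P]_w (f k (Z k w))%:E < +oo)%E ->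
  (\int[P]_w (\prod_k f k (Z k w))%:E = \prod_k \int[P]_w (f k (Z k w))%:E)%E.
Proof.
(* Induction on the number m of leading factors that are arbitrary, the others being indicators. For
   m = 0 this is independence; the step frees one more factor by [ge0_integral_density], which
   replaces the product of the others by the constant c. *)
suff H m : forall f : 'I_n -> U -> R,
    (forall k, measurable_fun setT (f k)) -> (forall k u, 0 <= f k u) ->
    (forall k, \int[P]_w (f k (Z k w))%:E < +oo)%E ->
    (forall k : 'I_n, (m <= k)%N -> exists2 B, measurable B & f k = \1_B) ->
    (\int[P]_w (\prod_k f k (Z k w))%:E = \prod_k \int[P]_w (f k (Z k w))%:E)%E.
  move=> mf f0 ff; apply: (H n) => // k.
  by rewrite leqNgt ltn_ord.
elim: m => {f} [|m IH] f mf f0 ff find.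
  have /choice[B BE] k : exists B, measurable B /\ f k = \1_B.
    by have [B] := find k (leq0n k); exists B.
  have fE k : f k = \1_(B k) by have [] := BE k.
  under eq_integral do under eq_bigr do rewrite fE.
  under [RHS]eq_bigr do under eq_integral do rewrite fE.
  by apply: indep_indic => k; have [] := BE k.
have [nm|mn] := leqP n m.
  apply: IH => // k mk; have := ltn_ord k.
  by rewrite ltnNge (leq_trans nm).
pose k0 := Ordinal mn.
pose G w := \prod_(k | k != k0) f k (Z k w).
pose c := (\prod_(k | k != k0) \int[P]_w (f k (Z k w))%:E)%E.
have If0 k : (0 <= \int[P]_w (f k (Z k w))%:E)%E.
  by apply: integral_ge0 => w _; rewrite lee_fin.
have c0 : (0 <= c)%E by apply: prode_ge0.
have cfin : c \is a fin_num.
  by apply: prode_fin_num => k _; rewrite ge0_fin_numE.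
have mfZ k : measurable_fun setT (fun w => f k (Z k w)) by exact: measurableT_comp.
under eq_integral do rewrite (bigD1 k0) //=.
rewrite (bigD1 k0) //= -/c -(fineK cfin) muleC -ge0_integralZl //; first last.
- by rewrite fineK.
- by move=> w _; rewrite lee_fin.
- exact/measurable_EFinP.
under [RHS]eq_integral do rewrite -EFinM mulrC.
apply: (ge0_integral_density (mZ k0)) => //.
- exact: measurable_prodr.
- by move=> w; apply: prodr_ge0 => k _.
- by move=> _; rewrite fine_ge0.
move=> B mB; rewrite !integral_preimage_indic.
pose f' k := if k == k0 then \1_B else f k.
have mZB : measurable (Z k0 @^-1` B) by rewrite -[X in measurable X]setTI; exact: mZ.
have IB : (\int[P]_w (\1_B (Z k0 w) : R)%:E = P (Z k0 @^-1` B))%E.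
  by rewrite -[in RHS](setIT (Z k0 @^-1` B)) -(integral_indic P measurableT).
have f'0 : f' k0 = \1_B by rewrite /f' eqxx.
have f'k k : k != k0 -> f' k = f k by move=> /negPf kk; rewrite /f' kk.
have := IH f'; rewrite (bigD1 k0) //= f'0.
have -> : (\prod_(i < n | i != k0) \int[P]_w (f' i (Z i w))%:E)%E = c.
  by apply: eq_bigr => k kk; rewrite f'k.
have -> : (\int[P]_w (\prod_k f' k (Z k w))%:E =
           \int[P]_w (\1_B (Z k0 w) * G w)%:E)%E.
  apply: eq_integral => w _; rewrite (bigD1 k0) //= f'0; congr (_ * _)%:E.
  by apply: eq_bigr => k kk; rewrite f'k.
move=> ->.
- rewrite -{1}(fineK cfin) muleC -ge0_integralZl //.
  + by apply: eq_integral => w _; rewrite -EFinM mulrC.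
  + by apply/measurable_EFinP; apply: measurableT_comp => //; exact: measurable_indic.
  + by rewrite fineK.
- by move=> k; rewrite /f'; case: ifP => _ //; exact: measurable_indic.
- by move=> k u; rewrite /f'; case: ifP => _ //; rewrite indicE.
- move=> k; rewrite /f'; case: eqVneq => [->|_] //.
  by rewrite IB (le_lt_trans (probability_le1 _ _)) // ltry.
- move=> k; rewrite leq_eqVlt => /orP[/eqP mk|mk].
    exists B => //; rewrite /f' ifT //; exact/eqP/val_inj.
  have [B' mB' fB'] := find k mk.
  exists B' => //; rewrite /f' ifF //; apply/negbTE.
  by apply: contraTneq mk => ->; rewrite ltnn.
Qed.

End Independence.

Definition box (U : Type) n (B : 'I_n -> set U) : set (n.-tuple U) :=
  [set X | forall k, B k (tnth X k)].

Lemma box_setT (U : Type) n : box (fun _ : 'I_n => [set: U]) = setT.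
Proof. by apply/seteqP; split. Qed.

Section TupleBox.
Context d (U : measurableType d) (R : realType) (n : nat).
Implicit Type B : 'I_n -> set U.

Lemma measurable_box B : (forall k, measurable (B k)) -> measurable (box B).
Proof.
move=> mB.
have -> : box B = \bigcap_(k in [set: 'I_n]) ((fun X => tnth X k) @^-1` B k).
  by apply/seteqP; split => X /= H k => [_|]; exact: H.
apply: fin_bigcap_measurable => // k _.
by rewrite -[X in measurable X]setTI; exact: measurable_tnth.
Qed.

(** Boxes are stable under intersection, and they generate the sigma-algebra: a box with all sides
    full but one is the preimage of a set under a coordinate. *)
Lemma tuple_measure_unique (m1 m2 : {measure set (n.-tuple U) -> \bar R}) :
  (forall B, (forall k, measurable (B k)) -> m1 (box B) = m2 (box B)) ->
  (m1 setT < +oo)%E ->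
  forall A, measurable A -> m1 A = m2 A.
Proof.
move=> m12 m1oo; pose G : set (set (n.-tuple U)) :=
  [set box B | B in [set B : 'I_n -> set U | forall k, measurable (B k)]].
apply: (measure_unique G (fun=> setT)) => //.
- apply/seteqP; split => [A|].
    apply: smallest_sub; first exact: smallest_sigma_algebra.
    rewrite -bigcup_seq; apply: bigcup_sub => i /= _ _ [B mB <-].
    apply: sub_sigma_algebra; exists (fun k => if k == i then B else setT).
      by move=> k; case: ifP.
    rewrite setTI; apply/seteqP; split => X /= XB.
      by have := XB i; rewrite eqxx.
    by move=> k; case: ifP => // /eqP ->.
  apply: smallest_sub; first exact: sigma_algebra_measurable.
  by move=> _ [B mB <-]; exact: measurable_box.
- move=> _ _ [B mB <-] [B' mB' <-]; exists (fun k => B k `&` B' k).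
    by move=> k; exact: measurableI.
  apply/seteqP; split => X /=; first by move=> H; split => k; case: (H k).
  by move=> [H H'] k; split; [exact: H|exact: H'].
- by move=> _; exists (fun=> setT) => //; exact: box_setT.
- by rewrite bigcup_const.
- by move=> _ [B mB <-]; exact: m12.
Qed.

End TupleBox.

Section Joint.
Context dT dU dV (T : measurableType dT) (U : measurableType dU)
  (V : measurableType dV) (R : realType) (P : probability T R) (n : nat).

Lemma measurable_tuple_fun dW (W : measurableType dW) (x : 'I_n -> T -> W) :
  (forall i, measurable_fun setT (x i)) ->
  measurable_fun setT (fun w => [tuple x i w | i < n]).
Proof.
move=> mx; apply/measurable_fun_tnthP => i.
by rewrite (_ : _ \o _ = x i) //; apply/funext => w /=; rewrite tnth_mktuple.
Qed.

Lemma measurable_preimage dW (W : measurableType dW) (f : T -> W) B :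
  measurable_fun setT f -> measurable B -> measurable (f @^-1` B).
Proof. by move=> mf mB; rewrite -[X in measurable X]setTI; exact: mf. Qed.

(* The uniqueness of measures on tuples is applied to each factor in turn. *)
Lemma independent2_tuple (e : 'I_n -> T -> U) (x : 'I_n -> T -> V) :
  (forall i, measurable_fun setT (e i)) ->
  (forall i, measurable_fun setT (x i)) ->
  (forall C B, (forall k, measurable (C k)) -> (forall k, measurable (B k)) ->
    P (\bigcap_(i in [set: 'I_n]) ((e i @^-1` C i) `&` (x i @^-1` B i))) =
    (\prod_(i < n) (P (e i @^-1` C i) * P (x i @^-1` B i)))%E) ->
  independent2 P (fun w => [tuple e i w | i < n]) (fun w => [tuple x i w | i < n]).
Proof.
move=> me mx H.
pose eT w := [tuple e i w | i < n]; pose xT w := [tuple x i w | i < n].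
have meT : measurable_fun setT eT by exact: measurable_tuple_fun.
have mxT : measurable_fun setT xT by exact: measurable_tuple_fun.
have boxE C B : (eT @^-1` box C) `&` (xT @^-1` box B) =
    \bigcap_(i in [set: 'I_n]) ((e i @^-1` C i) `&` (x i @^-1` B i)).
  apply/seteqP; split => w /=.
    by move=> [h1 h2] i _; have := h1 i; have := h2 i; rewrite !tnth_mktuple.
  by move=> h; split => i; rewrite tnth_mktuple; case: (h i).
have PeC C : (forall k, measurable (C k)) ->
    P (eT @^-1` box C) = (\prod_(i < n) P (e i @^-1` C i))%E.
  move=> mC; have := H C (fun=> setT) mC (fun=> measurableT).
  rewrite -boxE box_setT preimage_setT setIT => ->.
  by apply: eq_bigr => i _; rewrite preimage_setT probability_setT mule1.
have PxB B : (forall k, measurable (B k)) ->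
    P (xT @^-1` box B) = (\prod_(i < n) P (x i @^-1` B i))%E.
  move=> mB; have := H (fun=> setT) B (fun=> measurableT) mB.
  rewrite -boxE box_setT preimage_setT setTI => ->.
  by apply: eq_bigr => i _; rewrite preimage_setT probability_setT mul1e.
have Pbox C B : (forall k, measurable (C k)) -> (forall k, measurable (B k)) ->
    P ((eT @^-1` box C) `&` (xT @^-1` box B)) =
    (P (eT @^-1` box C) * P (xT @^-1` box B))%E.
  by move=> mC mB; rewrite boxE H // PeC // PxB // big_split.
pose eM : {mfun T >-> n.-tuple U} := HB.pack eT (isMeasurableFun.Build _ _ _ _ _ meT).
pose xM : {mfun T >-> n.-tuple V} := HB.pack xT (isMeasurableFun.Build _ _ _ _ _ mxT).
have step1 C B : (forall k, measurable (C k)) -> measurable B ->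
    P ((eT @^-1` box C) `&` (xT @^-1` B)) = (P (eT @^-1` box C) * P (xT @^-1` B))%E.
  move=> mC mB; have mE : measurable (eT @^-1` box C).
    by apply: measurable_preimage => //; exact: measurable_box.
  have r0 : 0 <= fine (P (eT @^-1` box C)) by exact: fine_ge0.
  pose m1 : {measure set _ -> \bar R} := pushforward (mrestr P mE) xM.
  pose m2 : {measure set _ -> \bar R} := mscale (NngNum r0) (distribution P xM).
  have := @tuple_measure_unique _ _ _ _ (m1 mxT) m2.
  have rE : (fine (P (eT @^-1` box C)))%:E = P (eT @^-1` box C).
    by rewrite fineK // fin_num_measure.
  rewrite /m1 /m2 /= /pushforward /mrestr /mscale /= rE => Q.
  rewrite setIC; apply: (Q _ _ B) => //.
    by move=> B' mB'; rewrite setIC Pbox.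
  by rewrite preimage_setT setTI (le_lt_trans (probability_le1 _ _)) // ltry.
move=> A B mA mB; have mE : measurable (xT @^-1` B) by exact: measurable_preimage.
have r0 : 0 <= fine (P (xT @^-1` B)) by exact: fine_ge0.
pose m1 : {measure set _ -> \bar R} := pushforward (mrestr P mE) eM.
pose m2 : {measure set _ -> \bar R} := mscale (NngNum r0) (distribution P eM).
have := @tuple_measure_unique _ _ _ _ (m1 meT) m2.
have rE : (fine (P (xT @^-1` B)))%:E = P (xT @^-1` B).
  by rewrite fineK // fin_num_measure.
rewrite /m1 /m2 /= /pushforward /mrestr /mscale /= rE => Q.
rewrite [RHS]muleC; apply: (Q _ _ A) => //.
  by move=> C mC; rewrite muleC; exact: step1.
by rewrite preimage_setT setTI (le_lt_trans (probability_le1 _ _)) // ltry.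
Qed.

(** Independence identifies the joint law with the product measure on rectangles, hence everywhere;
    the rest is Tonelli. *)
Lemma independent2_integral (A : {mfun T >-> U}) (B : {mfun T >-> V})
    (F : U * V -> \bar R) :
  independent2 P A B -> measurable_fun setT F -> (forall z, 0 <= F z)%E ->
  (\int[P]_w F (A w, B w) =
   \int[distribution P A]_a \int[distribution P B]_b F (a, b))%E.
Proof.
move=> iAB mF F0.
have mAB : measurable_fun setT (fun w => (A w, B w)) by exact: measurable_fun_pair.
pose AB : {mfun T >-> (U * V)%type} := HB.pack (fun w => (A w, B w))
  (isMeasurableFun.Build _ _ _ _ _ mAB).
transitivity (\int[distribution P AB]_z F z)%E.
  by rewrite ge0_integral_distribution.
rewrite -[RHS](fubini_tonelli1 F) //.
apply: eq_measure_integral => X mX _.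
apply/esym; apply: (product_measure_unique (m' := distribution P AB)) => //.
Qed.

End Joint.

(** * The conditional risk *)

Section HasInt.
Context d (T : measurableType d) (R : realType) (P : probability T R).

(** Integrability and the value travel together, so that the linear rules below need no side
    conditions. *)
Definition has_int (g : T -> R) (r : R) : Prop :=
  P.-integrable setT (EFin \o g) /\ (\int[P]_w (g w)%:E = r%:E)%E.

Lemma has_int_cst c : has_int (cst c) c.
Proof.
split; first exact: finite_measure_integrable_cst.
have -> : (\int[P]_w (cst c w)%:E = \int[P]_(w in setT) cst c%:E w)%E by [].
by rewrite integral_cst // [X in (_ * X)%E]probability_setT mule1.
Qed.

Lemma has_intD g h r s : has_int g r -> has_int h s ->
  has_int (fun w => g w + h w) (r + s).
Proof.
move=> [ig gr] [ih hs]; split; first exact: (integrableD measurableT ig ih).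
by under eq_integral do rewrite EFinD; rewrite integralD // gr hs.
Qed.

Lemma has_intZ c g r : has_int g r -> has_int (fun w => c * g w) (c * r).
Proof.
move=> [ig gr]; split; first exact: (integrableZl measurableT c ig).
by under eq_integral do rewrite EFinM; rewrite integralZl // gr.
Qed.

Lemma has_int_sum I (s : seq I) (Q : pred I) (g : I -> T -> R) r :
  (forall i, Q i -> has_int (g i) (r i)) ->
  has_int (fun w => \sum_(i <- s | Q i) g i w) (\sum_(i <- s | Q i) r i).
Proof.
move=> H; elim: s => [|i s IH].
  rewrite big_nil (_ : (fun _ => _) = cst 0); first exact: has_int_cst.
  by apply/funext => w; rewrite big_nil.
rewrite big_cons (_ : (fun _ => _) = if Q i then
    (fun w => g i w + \sum_(j <- s | Q j) g j w)
  else fun w => \sum_(j <- s | Q j) g j w); last first.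
  by apply/funext => w; rewrite big_cons; case: ifP.
by case: ifP => // Qi; apply: has_intD => //; exact: H.
Qed.

Lemma has_int_eq g h r : has_int g r -> g =1 h -> has_int h r.
Proof. by move=> H /funext <-. Qed.

Lemma has_int_measurable g r : has_int g r -> measurable_fun setT g.
Proof. by move=> [/integrableP[/measurable_EFinP]]. Qed.

Lemma ge0_has_int (g : T -> R) r : measurable_fun setT g -> (forall w, 0 <= g w) ->
  (\int[P]_w (g w)%:E = r%:E)%E -> has_int g r.
Proof.
move=> mg g0 gr; split => //; apply/integrableP; split.
  exact/measurable_EFinP.
under eq_integral => w _ do rewrite /= ger0_norm //.
by rewrite gr ltry.
Qed.

Lemma has_int_dominated (g h : T -> R) r : measurable_fun setT g -> has_int h r ->
  (forall w, `|g w| <= h w) -> exists s, has_int g s.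
Proof.
move=> mg [ih hr] gh.
have ig : P.-integrable setT (EFin \o g).
  apply: le_integrable ih => //; first exact/measurable_EFinP.
  by move=> w _; rewrite /= lee_fin (le_trans (gh w)) // ler_norm.
exists (fine (\int[P]_w (g w)%:E)%E); split => //.
by rewrite fineK // integrable_fin_num.
Qed.

End HasInt.

Section SecondMoments.
Context d (T : measurableType d) (R : realType) (P : probability T R).

Lemma covariance_centered (X Y : T -> R) c :
  ('E_P[X] = 0)%E -> ('E_P[Y] = 0)%E -> covariance P X Y = c%:E ->
  (\int[P]_w (X w * Y w)%:E = c%:E)%E.
Proof.
move=> X0 Y0; rewrite covariance.unlock X0 Y0 expectation.unlock => <-.
by apply: eq_integral => w _; rewrite !fctE /= !subr0.
Qed.

Lemma has_int_sqr (X : T -> R) c : measurable_fun setT X ->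
  ('E_P[X] = 0)%E -> ('V_P[X] = c%:E)%E -> has_int P (fun w => X w ^+ 2) c.
Proof.
move=> mX X0 Xv; apply: ge0_has_int => [|w|]; first exact: measurable_funX.
  exact: sqr_ge0.
by rewrite -(covariance_centered X0 X0 Xv).
Qed.

(** Integrability comes from |X| <= X^2 + 1. *)
Lemma has_int_centered (X : T -> R) c : measurable_fun setT X ->
  ('E_P[X] = 0)%E -> has_int P (fun w => X w ^+ 2) c -> has_int P X 0.
Proof.
move=> mX X0 X2.
have [s Xs] : exists s, has_int P X s.
  apply: (has_int_dominated mX (has_intD X2 (has_int_cst P 1))) => w.
  have : X w ^+ 2 = `|X w| ^+ 2 by rewrite -normrX ger0_norm ?sqr_ge0.
  have := sqr_ge0 `|X w|.
  by have := sqr_ge0 (`|X w| - 1); rewrite /= => ? ? ->; lra.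
have [iX Xi] := Xs; split => //.
by move: X0; rewrite expectation.unlock.
Qed.

End SecondMoments.

Section NoiseMoments.
Context d (T : measurableType d) (R : realType) (P : probability T R).
Variables (n : nat) (e : 'I_n -> {mfun T >-> R}) (s2 : R).
Hypothesis e0 : forall i, has_int P (e i) 0.
Hypothesis e2 : forall i, has_int P (fun w => e i w ^+ 2) s2.
Hypothesis e_indep : forall i j, i != j -> independent2 P (e i) (e j).

(* E (e_i + e_j)^2 = 2 s2 by Tonelli, hence E (e_i e_j) = 0. *)
Lemma has_int_cross i j : i != j -> has_int P (fun w => e i w * e j w) 0.
Proof.
move=> ij.
have H a : (\int[distribution P (e j)]_b ((a + b) ^+ 2)%:E = (a ^+ 2 + s2)%:E)%E.
  rewrite ge0_integral_distribution //; first last.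
  - by move=> b; rewrite lee_fin sqr_ge0.
  - by apply/measurable_EFinP/measurable_funX/measurable_funD.
  have [_ <-] : has_int P (fun w => (a + e j w) ^+ 2) (a ^+ 2 + s2).
    have := has_intD (has_int_cst P (a ^+ 2))
      (has_intD (has_intZ (2 * a) (e0 j)) (e2 j)).
    by rewrite mulr0 add0r => /has_int_eq; apply => w /=; ring.
  by [].
have E2 : has_int P (fun w => (e i w + e j w) ^+ 2) (s2 + s2).
  apply: ge0_has_int => [|w|]; last 2 first.
  - exact: sqr_ge0.
  - rewrite (independent2_integral (F := fun z : R * R => ((z.1 + z.2) ^+ 2)%:E) (e_indep ij)) //.
    + under eq_integral do rewrite H.
      rewrite ge0_integral_distribution //=; first last.
      * by move=> b; rewrite lee_fin addr_ge0 ?sqr_ge0 //; have [_] := e2 i;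
          rewrite -lee_fin => <-; apply: integral_ge0 => w _; rewrite lee_fin sqr_ge0.
      * by apply/measurable_EFinP/measurable_funD.
      by have [_] := has_intD (e2 i) (has_int_cst P s2).
    + by apply/measurable_EFinP/measurable_funX/measurable_funD.
    + by move=> z; rewrite lee_fin sqr_ge0.
  - by apply/measurable_funX/measurable_funD.
have := has_intZ 2^-1 (has_intD E2 (has_intZ (-1) (has_intD (e2 i) (e2 j)))).
rewrite mulN1r subrr mulr0 => /has_int_eq; apply => w /=; by field.
Qed.

(** Bias-variance decomposition of one coordinate of the error: b is its bias and c the row of the
    ridge matrix that acts on the noise. *)
Lemma has_int_quadratic b (c : 'I_n -> R) :
  has_int P (fun w => (b + \sum_i c i * e i w) ^+ 2) (b ^+ 2 + s2 * \sum_i c i ^+ 2).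
Proof.
have L : has_int P (fun w => \sum_i c i * e i w) 0.
  have := has_int_sum (index_enum 'I_n) (Q := predT) (fun i _ => has_intZ (c i) (e0 i)).
  by rewrite big1 // => i _; rewrite mulr0.
have Q : has_int P (fun w => \sum_i \sum_j c i * c j * (e i w * e j w))
    (s2 * \sum_i c i ^+ 2).
  rewrite mulr_sumr; apply: has_int_sum => i _.
  rewrite (_ : s2 * _ = \sum_j c i * c j * (if i == j then s2 else 0)).
    apply: has_int_sum => j _; apply: has_intZ; case: eqVneq => [->|/has_int_cross //].
    by apply: has_int_eq (e2 j) _ => w; rewrite expr2.
  rewrite (bigD1 i) //= eqxx big1 ?addr0 => [|j /negPf]; first by rewrite expr2 mulrC.
  by rewrite eq_sym => ->; rewrite mulr0.
have := has_intD (has_int_cst P (b ^+ 2)) (has_intD (has_intZ (2 * b) L) Q).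
rewrite mulr0 add0r => /has_int_eq; apply => w /=.
set L' := \sum_i c i * e i w.
have -> : \sum_i \sum_j c i * c j * (e i w * e j w) = L' ^+ 2.
  rewrite expr2 mulr_suml; apply: eq_bigr => i _; rewrite mulr_sumr.
  by apply: eq_bigr => j _; ring.
by ring.
Qed.

End NoiseMoments.

(** * Measurability of matrix-valued functions *)

Section MeasurableMatrix.
Context d (T : measurableType d) (R : realType).

Lemma measurable_sumr (I : Type) (s : seq I) (Q : pred I) (f : I -> T -> R) :
  (forall i, measurable_fun setT (f i)) ->
  measurable_fun setT (fun w => \sum_(i <- s | Q i) f i w).
Proof.
move=> mf; elim: s => [|i s IH].
  rewrite (_ : (fun _ => _) = cst 0) //; apply/funext => w.
  by rewrite big_nil.
rewrite (_ : (fun _ => _) = if Q i then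
    (fun w => f i w + \sum_(j <- s | Q j) f j w)
  else fun w => \sum_(j <- s | Q j) f j w); last first.
  by apply/funext => w; rewrite big_cons; case: ifP.
by case: ifP => // _; exact: measurable_funD.
Qed.

(* x^-1 = x (x^2)^-1, and (x^2)^-1 is a real power of a nonnegative number *)
Lemma measurable_funVr (f : T -> R) :
  measurable_fun setT f -> measurable_fun setT (fun w => (f w)^-1).
Proof.
move=> mf; rewrite (_ : (fun _ => _) = fun w => f w * powR (f w ^+ 2) (-1)).
  apply: measurable_funM => //.
  apply: (measurableT_comp (@measurable_powR R (-1)%R)).
  exact: measurable_funX.
apply/funext => w; rewrite powR_inv1 ?sqr_ge0 //.
have [->|f0] := eqVneq (f w) 0; first by rewrite invr0 mul0r.
by rewrite expr2 invfM mulrA divff // mul1r.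
Qed.

Definition mx_measurable m k (M : T -> 'M[R]_(m, k)) : Prop :=
  forall i j, measurable_fun setT (fun w => M w i j).

Lemma mx_measurable_cst m k (M : 'M[R]_(m, k)) : mx_measurable (fun=> M).
Proof. by move=> i j; exact: measurable_cst. Qed.

Lemma mx_measurableD m k (M N : T -> 'M[R]_(m, k)) :
  mx_measurable M -> mx_measurable N -> mx_measurable (fun w => M w + N w).
Proof.
move=> mM mN i j; rewrite (_ : (fun _ => _) = fun w => M w i j + N w i j).
  exact: measurable_funD.
by apply/funext => w; rewrite mxE.
Qed.

Lemma mx_measurable_mul m k l (M : T -> 'M[R]_(m, k)) (N : T -> 'M[R]_(k, l)) :
  mx_measurable M -> mx_measurable N -> mx_measurable (fun w => M w *m N w).
Proof.
move=> mM mN i j; rewrite (_ : (fun _ => _) = fun w => \sum_h M w i h * N w h j).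
  by apply: measurable_sumr => h; exact: measurable_funM.
by apply/funext => w; rewrite mxE.
Qed.

Lemma mx_measurable_tr m k (M : T -> 'M[R]_(m, k)) :
  mx_measurable M -> mx_measurable (fun w => (M w)^T).
Proof.
move=> mM i j; rewrite (_ : (fun _ => _) = fun w => M w j i); first exact: mM.
by apply/funext => w; rewrite mxE.
Qed.

Lemma measurable_det m (M : T -> 'M[R]_m) :
  mx_measurable M -> measurable_fun setT (fun w => \det (M w)).
Proof.
move=> mM; apply: measurable_sumr => s.
by apply: measurable_funM => //; apply: measurable_prodr => i; exact: mM.
Qed.

(** Cramer's rule: the entries of the inverse are cofactors divided by the determinant. *)
Lemma mx_measurable_inv m (M : T -> 'M[R]_m) :
  (forall w, M w \in unitmx) -> mx_measurable M ->
  mx_measurable (fun w => invmx (M w)).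
Proof.
move=> uM mM i j.
rewrite (_ : (fun _ => _) = fun w => (\det (M w))^-1 * cofactor (M w) j i).
  apply: measurable_funM; first by apply: measurable_funVr; exact: measurable_det.
  apply: measurable_funM => //; apply: measurable_det => a b.
  rewrite (_ : (fun _ => _) = fun w => M w (lift j a) (lift i b)) //.
  by apply/funext => w; rewrite !mxE.
by apply/funext => w; rewrite /invmx uM !mxE.
Qed.

End MeasurableMatrix.

Section CondRisk.
Variables (R : realType) (n p : nat).
Implicit Type X : 'M[R]_(n, p).

Definition ridge_mx X (tau : R) : 'M[R]_(p, n) :=
  X^T *m invmx (X *m X^T + (n%:R * tau)%:M).

Definition cond_risk X (theta : 'cV[R]_p) (lam : 'rV[R]_p) (s2 tau : R) : R :=
  \sum_j lam 0 j * ((ridge_mx X tau *m (X *m theta) - theta) j 0 ^+ 2 +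
                    s2 * \sum_i ridge_mx X tau j i ^+ 2).

Lemma wnorm_diag_sqr m (l : 'rV[R]_m) (v : 'cV[R]_m) : (forall j, 0 <= l 0 j) ->
  wnorm (diag_mx l) v ^+ 2 = \sum_j l 0 j * v j 0 ^+ 2.
Proof.
move=> l0; have E : (v^T *m diag_mx l *m v) 0 0 = \sum_j l 0 j * v j 0 ^+ 2.
  rewrite mxE; apply: eq_bigr => j _; rewrite mul_mx_diag !mxE; ring.
by rewrite /wnorm E sqr_sqrtr // sumr_ge0 // => j _; rewrite mulr_ge0 ?sqr_ge0.
Qed.

Let U := n.-tuple (p.-tuple R).

Lemma mx_measurable_design : mx_measurable (fun X : U => design X).
Proof.
move=> i j; rewrite (_ : (fun _ => _) = (fun r : p.-tuple R => tnth r j) \o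
    (fun X : U => tnth X i)).
  by apply: measurableT_comp; exact: measurable_tnth.
by apply/funext => X; rewrite mxE.
Qed.

Variables (theta : 'cV[R]_p) (lam : 'rV[R]_p) (s2 tau : R).
Hypotheses (n0 : (0 < n)%N) (tau0 : 0 < tau) (lam0 : forall j, 0 <= lam 0 j).

Lemma mx_measurable_ridge_mx : mx_measurable (fun X : U => ridge_mx (design X) tau).
Proof.
have mD := mx_measurable_design.
apply: mx_measurable_mul; first exact: mx_measurable_tr.
apply: mx_measurable_inv => [X|]; first exact: ridge_unitmx.
apply: mx_measurableD; last exact: mx_measurable_cst.
by apply: mx_measurable_mul => //; exact: mx_measurable_tr.
Qed.

Lemma measurable_cond_risk :
  measurable_fun setT (fun X : U => cond_risk (design X) theta lam s2 tau).
Proof.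
have mD := mx_measurable_design; have mC := mx_measurable_ridge_mx.
apply: measurable_sumr => j; apply: measurable_funM => //.
apply: measurable_funD.
  apply: measurable_funX; apply: (mx_measurableD _ (mx_measurable_cst (- theta))).
  by do 2 (apply: mx_measurable_mul => //); exact: mx_measurable_cst.
apply: measurable_funM => //; apply: measurable_sumr => i.
by apply: measurable_funX; exact: mC.
Qed.

(** The loss with design and noise as separate arguments, so that the noise can be integrated out at
    a fixed design. *)
Definition sq_loss (z : U * n.-tuple R) : R :=
  \sum_j lam 0 j * ((ridge_mx (design z.1) tau *m (design z.1 *m theta) - theta) j 0
    + \sum_i ridge_mx (design z.1) tau j i * tnth z.2 i) ^+ 2.

Lemma measurable_sq_loss : measurable_fun setT sq_loss.
Proof.
have mD i j : measurable_fun setT (fun z : U * n.-tuple R => design z.1 i j).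
  by apply: measurableT_comp (mx_measurable_design i j) _.
have mC i j : measurable_fun setT
    (fun z : U * n.-tuple R => ridge_mx (design z.1) tau i j).
  by apply: measurableT_comp (mx_measurable_ridge_mx i j) _.
apply: measurable_sumr => j; apply: measurable_funM => //.
apply: measurable_funX; apply: measurable_funD.
  apply: (mx_measurableD _ (mx_measurable_cst (- theta))).
  by do 2 (apply: mx_measurable_mul => //); exact: mx_measurable_cst.
apply: measurable_sumr => i; apply: measurable_funM => //.
by apply: (measurableT_comp (measurable_tnth i)).
Qed.

Lemma sq_lossE (X : U) (e : n.-tuple R) (Y : 'cV[R]_n) :
  (forall i, Y i 0 = (design X *m theta) i 0 + tnth e i) ->
  wnorm (diag_mx lam) (ridge (design X) Y tau - theta) ^+ 2 = sq_loss (X, e).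
Proof.
move=> YE; rewrite wnorm_diag_sqr //; apply: eq_bigr => j _; congr (_ * _ ^+ 2).
rewrite /ridge (gt_eqF tau0) -/(ridge_mx (design X) tau) /=.
have -> : Y = design X *m theta + \col_i tnth e i.
  by apply/matrixP => i k; rewrite [k]ord1 YE [RHS]mxE [X in _ = _ + X]mxE.
rewrite mulmxDr addrAC [LHS]mxE; congr (_ + _).
by rewrite [LHS]mxE; apply: eq_bigr => i _; congr (_ * _); rewrite mxE.
Qed.

End CondRisk.

(** * Identification of the conditional risk *)

Section Model.
Variables (R : realType) (n p : nat) (theta : 'cV[R]_p) (lam : 'rV[R]_p).
Variables (sigma sigma_x : R) (disp : measure_display) (T : measurableType disp).
Variables (P : probability T R) (x : 'I_n -> {RV P >-> p.-tuple R}).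
Variables (eps y : 'I_n -> {RV P >-> R}) (mse : R -> n.-tuple (p.-tuple R) -> R).
Hypothesis LM : linear_model theta lam sigma sigma_x x eps y.

Let U := n.-tuple (p.-tuple R).
Let X w : U := [tuple x i w | i < n].
Let e w : n.-tuple R := [tuple eps i w | i < n].

Lemma measurable_linear_form :
  measurable_fun setT (fun r : p.-tuple R => ((col_of_tuple r)^T *m theta) 0 0).
Proof.
rewrite (_ : (fun _ => _) = fun r => \sum_j tnth r j * theta j 0).
  apply: measurable_sumr => j; apply: measurable_funM => //.
  exact: measurable_tnth.
by apply/funext => r; rewrite mxE; apply: eq_bigr => j _; rewrite !mxE.
Qed.

(** The model gives independence of the pairs (y_i, x_i). The noise y_i - x_i^T theta is a
    measurable function of its pair, and within a pair it is independent of x_i. *)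
Lemma model_box (B : 'I_n -> set (p.-tuple R)) (C : 'I_n -> set R) :
  (forall k, measurable (B k)) -> (forall k, measurable (C k)) ->
  P (\bigcap_(i in [set: 'I_n]) ((x i @^-1` B i) `&` (eps i @^-1` C i))) =
  (\prod_(i < n) (P (x i @^-1` B i) * P (eps i @^-1` C i)))%E.
Proof.
move=> mB mC.
pose D i : set (R * p.-tuple R) := [set z | B i z.2 /\
  C i (z.1 - ((col_of_tuple z.2)^T *m theta) 0 0)].
have ZD i : (x i @^-1` B i) `&` (eps i @^-1` C i) = (fun w => (y i w, x i w)) @^-1` D i.
  apply/seteqP; split => w /=; rewrite /D /= (model_eq LM) addrAC subrr add0r //.
have mD i : measurable (D i).
  have -> : D i = (snd @^-1` B i) `&`
     ((fun z => z.1 - ((col_of_tuple z.2)^T *m theta) 0 0) @^-1` C i) by [].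
  apply: measurableI; first exact: measurable_preimage.
  apply: measurable_preimage => //; apply: measurable_funB => //.
  exact: (measurableT_comp measurable_linear_form measurable_snd).
under eq_bigcapr do rewrite ZD.
rewrite (model_indep LM) //; apply: eq_bigr => i _.
rewrite -ZD setIC muleC; exact: (model_noise_indep LM).
Qed.

Lemma noise_indep2 i j : i != j -> independent2 P (eps i) (eps j).
Proof.
move=> ij A B mA mB.
have := @model_box (fun=> setT) (fun k => if k == i then A else if k == j then B else setT)
  (fun=> measurableT) _.
have ji : (j == i) = false by rewrite eq_sym (negPf ij).
rewrite (bigD1 i) //= (bigD1 j) ?ji //= !eqxx.
rewrite big1 => [|k /andP[/negPf -> /negPf ->]]; last first.
  by rewrite !preimage_setT !probability_setT mule1.
rewrite !preimage_setT !probability_setT !mul1e mule1 => <-; last first.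
  by move=> k; do 2 case: ifP => // _.
congr (P _); apply/seteqP; split => w /=.
  move=> [wA wB] k _; split => //=; case: ifP => [/eqP -> //|_].
  by case: ifP => [/eqP -> //|_].
by move=> H; have [_ /=] := H i I; have [_ /=] := H j I; rewrite !eqxx ji.
Qed.

Lemma noise_sqr i : has_int P (fun w => eps i w ^+ 2) (sigma ^+ 2).
Proof.
apply: has_int_sqr => //; [exact: (model_noise_mean LM)|exact: (model_noise_var LM)].
Qed.

Lemma noise_mean i : has_int P (eps i) 0.
Proof.
by apply: has_int_centered (noise_sqr i) => //; exact: (model_noise_mean LM).
Qed.

Hypotheses (n0 : (0 < n)%N) (lam0 : forall j, 0 <= lam 0 j).
Hypothesis MSE : is_mse_out theta (diag_mx lam) x y mse.

Let mX : measurable_fun setT X. Proof. exact: measurable_tuple_fun. Qed.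
Let me : measurable_fun setT e. Proof. exact: measurable_tuple_fun. Qed.
Let XM : {mfun T >-> U} := HB.pack X (isMeasurableFun.Build _ _ _ _ _ mX).
Let eM : {mfun T >-> n.-tuple R} := HB.pack e (isMeasurableFun.Build _ _ _ _ _ me).

Variable tau : R.
Hypothesis tau0 : 0 < tau.
Let risk (a : n.-tuple (p.-tuple R)) := cond_risk (design a) theta lam (sigma ^+ 2) tau.

Lemma integral_sq_loss a :
  (\int[distribution P eM]_b (sq_loss theta lam tau (a, b))%:E = (risk a)%:E)%E.
Proof.
rewrite ge0_integral_distribution; first last.
- by move=> b; rewrite lee_fin sumr_ge0 // => j _; rewrite mulr_ge0 ?sqr_ge0.
- apply/measurable_EFinP.
  exact: (measurableT_comp (measurable_sq_loss theta lam n0 tau0) (pair1_measurable a)).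
suff [_] : has_int P (fun w => sq_loss theta lam tau (a, e w)) (risk a) by [].
apply: has_int_sum => j _; apply: has_intZ.
apply: has_int_eq (has_int_quadratic noise_mean noise_sqr noise_indep2 _ _) _ => w.
by congr ((_ + _) ^+ 2); apply: eq_bigr => i _; rewrite tnth_mktuple.
Qed.

Lemma risk_ge0 a : 0 <= risk a.
Proof.
apply: sumr_ge0 => j _; rewrite mulr_ge0 // addr_ge0 ?sqr_ge0 // mulr_ge0 ?sqr_ge0 //.
by apply: sumr_ge0 => i _; rewrite sqr_ge0.
Qed.

Let mrisk : measurable_fun setT risk. Proof. exact: measurable_cond_risk. Qed.

Let mse_cond : is_cond_expectation P X
  (fun w => wnorm (diag_mx lam) (ridge (design (X w)) (\col_i y i w) tau - theta) ^+ 2)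
  (mse tau).
Proof. by case: MSE => H _; apply: H; exact: ltW. Qed.

(** The version [mse tau] is not known to be nonnegative or integrable; on a set where it is
    bounded, the change of variables by X is legitimate. *)
Lemma integral_mse_risk B : measurable B -> [bounded mse tau a | a in B] ->
  (\int[distribution P XM]_(a in B) (mse tau a)%:E =
   \int[distribution P XM]_(a in B) (risk a)%:E)%E.
Proof.
move=> mB bB; have [mm /(_ B mB) H] := mse_cond.
have mXB : measurable (X @^-1` B) by exact: measurable_preimage.
rewrite (integral_pushforward mX) //; first last.
- apply: measurable_bounded_integrable => //.
  + by rewrite (le_lt_trans (probability_le1 _ _)) // ltry.
  + by apply: measurable_funTS; apply: measurableT_comp.
  + have [M [Mr HM]] := bB; exists M; split => // k Mk w /= XB.
    exact: (HM k Mk (X w)).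
- exact/measurable_EFinP.
rewrite [LHS]H integral_preimage_indic.
pose G (z : n.-tuple (p.-tuple R) * n.-tuple R) : R :=
  \1_B z.1 * sq_loss theta lam tau z.
transitivity (\int[P]_w (G (X w, e w))%:E)%E.
  apply: eq_integral => w _; congr (_ * _)%:E; apply: sq_lossE => // i.
  rewrite mxE (model_eq LM) !tnth_mktuple; congr (_ + _).
  by rewrite !mxE; apply: eq_bigr => j _; rewrite !mxE tnth_mktuple.
have iXe : independent2 P XM eM.
  by apply: independent2_tuple => // C D mC mD; exact: model_box.
have sl0 z : 0 <= sq_loss theta lam tau z.
  by apply: sumr_ge0 => j _; rewrite mulr_ge0 ?sqr_ge0.
rewrite (independent2_integral (A := XM) (B := eM) (F := EFin \o G)) //=; first last.
- by move=> z; rewrite lee_fin mulr_ge0.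
- apply/measurable_EFinP; apply: measurable_funM; last exact: measurable_sq_loss.
  by apply: (measurableT_comp _ measurable_fst); exact: measurable_indic.
rewrite [RHS]integral_mkcond; apply: eq_integral => a _.
transitivity (\int[distribution P eM]_b
    ((\1_B a)%:E * (sq_loss theta lam tau (a, b))%:E))%E.
  by apply: eq_integral => b _; rewrite -EFinM.
rewrite ge0_integralZl //; first last.
- by move=> b _; rewrite lee_fin.
- apply/measurable_EFinP.
  exact: (measurableT_comp (measurable_sq_loss theta lam n0 tau0) (pair1_measurable a)).
rewrite integral_sq_loss /patch indicE.
by case: (a \in B); rewrite ?mul1e ?mul0e.
Qed.

(** The space is covered by the countably many sets [D k] on which both functions are bounded, and
    on each of them equal integrals force almost sure equality. *)
Lemma mse_eq_risk : {ae P, forall w, mse tau (X w) = risk (X w)}.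
Proof.
have [mm _] := mse_cond.
pose D (k : nat) := [set a | `|mse tau a| <= k%:R] `&` [set a | risk a <= k%:R].
have mset (f : n.-tuple (p.-tuple R) -> R) (k : R) :
    measurable_fun setT f -> measurable [set a | f a <= k].
  move=> mf; have -> : [set a | f a <= k] = f @^-1` `]-oo, k].
    by apply/seteqP; split => a /=; rewrite in_itv.
  exact: measurable_preimage.
have mD k : measurable (D k).
  by apply: measurableI; apply: mset => //; exact: measurableT_comp.
have DT a : exists k, D k a.
  exists (Num.truncn (`|mse tau a| + risk a)).+1.
  have := truncnS_gt (`|mse tau a| + risk a); have := risk_ge0 a.
  have := normr_ge0 (mse tau a); rewrite /D /=.
  by set K : R := _.+1%:R => h1 h2 h3; split; lra.
have bD k : [bounded mse tau a | a in D k].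
  exists k%:R; split => [|M kM a [/= h _]]; first exact: num_real.
  exact: le_trans h (ltW kM).
have rD k : [bounded risk a | a in D k].
  exists k%:R; split => [|M kM a [_ /= h]]; first exact: num_real.
  by rewrite ger0_norm ?risk_ge0 // (le_trans h (ltW kM)).
have aeD k : ae_eq (distribution P XM) (D k) (EFin \o risk) (EFin \o mse tau).
  apply: integral_ae_eq => //.
  - apply: measurable_bounded_integrable => //.
      by rewrite (le_lt_trans (probability_le1 _ _)) // ltry.
    exact: measurable_funTS.
  - by apply/measurable_EFinP; exact: measurable_funTS.
  move=> B BD mB; rewrite integral_mse_risk //.
  have [M [Mr HM]] := bD k; exists M; split => // K MK a /BD.
  exact: HM.
have : {ae distribution P XM, forall a, mse tau a = risk a}.
  have := ae_foralln aeD; apply: filterS => a H.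
  by have [k Dk] := DT a; have [] := H k Dk.
move=> [N [mN N0 NP]]; exists (X @^-1` N); split => //.
  exact: measurable_preimage.
by move=> w /= h; apply: NP.
Qed.

End Model.

(** * Concentration of the whitened design *)

Section SubGaussian.
Variables (R : realType) (n p : nat) (theta : 'cV[R]_p) (lam : 'rV[R]_p).
Variables (sigma sigma_x : R) (disp : measure_display) (T : measurableType disp).
Variables (P : probability T R) (x : 'I_n -> {RV P >-> p.-tuple R}).
Variables (eps y : 'I_n -> {RV P >-> R}).
Hypothesis LM : linear_model theta lam sigma sigma_x x eps y.
Hypothesis lam0 : forall j, 0 < lam 0 j.

(** The whitened linear form <v, Sigma^(-1/2) r>. *)
Definition zeta (v : 'cV[R]_p) (r : p.-tuple R) : R :=
  \sum_j v j 0 * (tnth r j / Num.sqrt (lam 0 j)).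

Lemma zetaE v r : (v^T *m (inv_sqrt_diag lam *m col_of_tuple r)) 0 0 = zeta v r.
Proof.
rewrite mxE; apply: eq_bigr => j _; rewrite mxE; congr (_ * _).
by rewrite mul_diag_mx !mxE mulrC.
Qed.

Lemma measurable_zeta v : measurable_fun setT (zeta v).
Proof.
apply: measurable_sumr => j; apply: measurable_funM => //.
by apply: measurable_funM => //; exact: measurable_tnth.
Qed.

Lemma measurable_coord i j : measurable_fun setT (fun w => tnth (x i w) j).
Proof. exact: (measurableT_comp (measurable_tnth j)). Qed.

Lemma has_int_coord i j k :
  has_int P (fun w => tnth (x i w) j * tnth (x i w) k) (diag_mx lam j k).
Proof.
have sq l : has_int P (fun w => tnth (x i w) l ^+ 2) (lam 0 l).
  apply: has_int_sqr; [exact: measurable_coord|exact: (model_x_mean LM)|].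
  by rewrite /variance (model_x_cov LM) mxE eqxx.
have I := covariance_centered (model_x_mean LM i j) (model_x_mean LM i k)
  (model_x_cov LM i j k).
have mjk : measurable_fun setT (fun w => tnth (x i w) j * tnth (x i w) k).
  by apply: measurable_funM; exact: measurable_coord.
have dom w : `|tnth (x i w) j * tnth (x i w) k| <=
    tnth (x i w) j ^+ 2 + tnth (x i w) k ^+ 2.
  set a := tnth _ j; set b := tnth _ k; rewrite normrM.
  have -> : a ^+ 2 = `|a| ^+ 2 by rewrite -normrX ger0_norm ?sqr_ge0.
  have -> : b ^+ 2 = `|b| ^+ 2 by rewrite -normrX ger0_norm ?sqr_ge0.
  have := sqr_ge0 (`|a| - `|b|); have := sqr_ge0 `|a|; have := sqr_ge0 `|b|; lra.
have [s [H _]] := has_int_dominated mjk (has_intD (sq j) (sq k)) dom.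
by split.
Qed.

Lemma has_int_zeta2 i v : has_int P (fun w => zeta v (x i w) ^+ 2) (sqn v).
Proof.
pose c j := v j 0 / Num.sqrt (lam 0 j).
have H : has_int P (fun w => \sum_j \sum_k c j * c k *
    (tnth (x i w) j * tnth (x i w) k)) (\sum_j \sum_k c j * c k * diag_mx lam j k).
  by apply: has_int_sum => j _; apply: has_int_sum => k _; apply/has_intZ/has_int_coord.
rewrite (_ : sqn v = \sum_j \sum_k c j * c k * diag_mx lam j k).
  apply: has_int_eq H _ => w; rewrite expr2 mulr_suml; apply: eq_bigr => j _.
  by rewrite mulr_sumr; apply: eq_bigr => k _; rewrite /c; ring.
rewrite sqnE; apply: eq_bigr => j _; rewrite (bigD1 j) //= big1 => [|k jk].
  rewrite addr0 mxE eqxx mulr1n /c.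
  have s2 : Num.sqrt (lam 0 j) ^+ 2 = lam 0 j by rewrite sqr_sqrtr // ltW.
  rewrite -{3}s2; field; rewrite gt_eqF // sqrtr_gt0 //.
by rewrite mxE eq_sym (negPf jk) mulr0n mulr0.
Qed.

Lemma wnorm1_nrm (v : 'cV[R]_p) : wnorm 1%:M v = nrm v.
Proof.
rewrite /wnorm /nrm mulmx1 mxE; congr Num.sqrt.
by apply: eq_bigr => j _; rewrite mxE.
Qed.

Lemma psi2_le i v : v != 0 ->
  (psi2_norm P (fun w => (zeta v (x i w) / nrm v)%R) <= sigma_x%:E)%E.
Proof.
move=> v0; rewrite -(model_x_subgaussian LM i); apply: ereal_sup_ubound.
exists v; first exact: v0.
congr (psi2_norm P _); apply/funext => w; by rewrite zetaE wnorm1_nrm.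
Qed.

(** By exp(u) >= 1 + u and unit variance, the exponential moment is at least 1 + 1 / t^2. *)
Lemma admissible_ge1 i v t : v != 0 -> 0 < t ->
  ('E_P[fun w => expR ((zeta v (x i w) / nrm v) ^+ 2 / t ^+ 2)] <= 2%:E)%E -> 1 <= t.
Proof.
move=> v0 t0; rewrite expectation.unlock => H.
have vn : nrm v != 0 by rewrite gt_eqF // sqrtr_gt0 lt_def sqn_eq0 v0 sqn_ge0.
have I := has_intD (has_int_cst P 1)
  (has_intZ ((nrm v ^+ 2)^-1 / t ^+ 2) (has_int_zeta2 i v)).
have : (\int[P]_w (1 + (nrm v ^+ 2)^-1 / t ^+ 2 * zeta v (x i w) ^+ 2)%:E <= 2%:E)%E.
  apply: le_trans H; apply: ge0_le_integral => //.
  - move=> w _; rewrite lee_fin addr_ge0 // mulr_ge0 ?sqr_ge0 //.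
    by rewrite mulr_ge0 ?invr_ge0 ?sqr_ge0.
  - by apply/measurable_EFinP; exact: (has_int_measurable I).
  - apply/measurable_EFinP; apply: measurableT_comp => //.
    apply: measurable_funM => //; apply: measurable_funX; apply: measurable_funM => //.
    exact: (measurableT_comp (measurable_zeta v)).
  - move=> w _; rewrite lee_fin (le_trans _ (expR_ge1Dx _)) // lerD2l le_eqVlt.
    by apply/orP; left; apply/eqP; rewrite expr_div_n; field; rewrite vn gt_eqF.
have [_ /= ->] := I; rewrite lee_fin sqr_nrm.
have -> : (sqn v)^-1 / t ^+ 2 * sqn v = (t ^+ 2)^-1.
  by field; rewrite sqn_eq0 v0 gt_eqF.
move=> h; have : (t ^+ 2)^-1 <= 1 by lra.
rewrite invf_le1 ?exprn_gt0 // -[X in X <= _](expr1n _ 2).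
by rewrite ler_pXn2r ?nnegrE // ltW.
Qed.

Lemma sigma_x_ge1 (i : 'I_n) (j : 'I_p) : 1 <= sigma_x.
Proof.
have v0 : (delta_mx j 0 : 'cV[R]_p) != 0 by rewrite -sqn_eq0 sqn_delta oner_neq0.
rewrite -lee_fin; apply: le_trans (psi2_le i v0).
by apply: le_ereal_inf_tmp => _ [t [t0 H] <-]; rewrite lee_fin (admissible_ge1 v0 t0 H).
Qed.

(** Attainment of the infimum in the psi_2 norm is avoided: some admissible t lies below sqrt 2
    sigma_x, whence the 2 in 2 sigma_x^2. *)
Lemma subgaussian_exp i v : v != 0 ->
  (\int[P]_w (expR (zeta v (x i w) ^+ 2 / (2 * sigma_x ^+ 2) / sqn v))%:E <= 2%:E)%E.
Proof.
move=> v0; have vp : 0 < sqn v by rewrite lt_def sqn_eq0 v0 sqn_ge0.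
have vn : nrm v != 0 by rewrite gt_eqF // sqrtr_gt0.
have [j _] : exists j, v j 0 != 0.
  apply/existsP; apply: contraNT v0; rewrite negb_exists => /forallP v0.
  by apply/eqP/matrixP => k l; rewrite ord1 mxE; apply/eqP; have := v0 k; rewrite negbK.
have s1 := sigma_x_ge1 i j.
have s2 : 1 < Num.sqrt 2 :> R by rewrite -[X in X < _]sqrtr1 ltr_sqrt // ltr1n.
have lt : (psi2_norm P (fun w => (zeta v (x i w) / nrm v)%R) < (sigma_x * Num.sqrt 2)%:E)%E.
  by rewrite (le_lt_trans (psi2_le i v0)) // lte_fin ltr_pMr // (lt_le_trans ltr01).
have [_ [t [t0 H] <-]] := ereal_inf_lt lt.
rewrite lte_fin => tl; rewrite expectation.unlock in H; apply: le_trans H.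
have mz : measurable_fun setT (fun w => zeta v (x i w)).
  exact: (measurableT_comp (measurable_zeta v)).
apply: ge0_le_integral => //.
- apply/measurable_EFinP; apply: measurableT_comp => //.
  by do 2 (apply: measurable_funM => //); exact: measurable_funX.
- apply/measurable_EFinP; apply: measurableT_comp => //.
  by apply: measurable_funM => //; apply: measurable_funX; apply: measurable_funM.
- move=> w _; rewrite lee_fin ler_expR expr_div_n sqr_nrm [leLHS]mulrAC.
  rewrite ler_wpM2l ?divr_ge0 ?sqr_ge0 ?sqn_ge0 //.
  have s0 : 0 < sigma_x := lt_le_trans ltr01 s1.
  rewrite lef_pV2 ?posrE ?mulr_gt0 ?exprn_gt0 //.
  rewrite (le_trans (_ : _ <= (sigma_x * Num.sqrt 2) ^+ 2)) //.
    by rewrite lerXn2r ?nnegrE ?mulr_ge0 ?sqrtr_ge0 // ltW.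
  by rewrite exprMn sqr_sqrtr // mulrC.
Qed.

End SubGaussian.

(** * Exponential inequalities and Bernstein's bound *)

Section Exp.
Variable R : realType.
Implicit Types y z : R.

(** One bound for both signs of y, so that upper and lower deviations are treated together. *)
Lemma expR_le_quadratic y : expR y <= 1 + y + y ^+ 2 * expR `|y|.
Proof.
have [y0|/ltW y0] := lerP 0 y.
  have h1 : expR y - 1 <= y * expR y.
    have := expR_ge1Dx (- y); rewrite expRN => /(ler_wpM2r (expR_ge0 y)).
    by rewrite mulVf ?gt_eqF ?expR_gt0 //; lra.
  by rewrite ger0_norm //; have := ler_wpM2l y0 h1; lra.
rewrite ler0_norm //; set u := - y; have u0 : 0 <= u by rewrite oppr_ge0.
have -> : y = - u by rewrite opprK.
have p1 : 0 < 1 + u by rewrite ltr_pwDl.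
have h1 : expR (- u) <= (1 + u)^-1.
  by rewrite expRN lef_pV2 ?posrE ?expR_gt0 // expR_ge1Dx.
have h2 : (1 + u)^-1 <= 1 - u + u ^+ 2.
  rewrite -div1r ler_pdivrMr //.
  have -> : (1 - u + u ^+ 2) * (1 + u) = 1 + u ^+ 3 by ring.
  by rewrite lerDl exprn_ge0.
have h3 : u ^+ 2 <= u ^+ 2 * expR u.
  by rewrite ler_peMr ?sqr_ge0 // -expR0 ler_expR.
by rewrite sqrrN; lra.
Qed.

Lemma sqr_le_expR z : 0 <= z -> z ^+ 2 <= 4 * expR z.
Proof.
move=> z0; have e : expR z = expR (z / 2) ^+ 2.
  by rewrite expr2 -expRD; congr expR; field.
have : (1 + z / 2) ^+ 2 <= expR (z / 2) ^+ 2.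
  rewrite lerXn2r ?nnegrE ?expR_ge0 ?expR_ge1Dx //.
  by rewrite addr_ge0 // divr_ge0.
by rewrite e; lra.
Qed.

(** Jensen's inequality, from the tangent line of exp at the barycentre b. *)
Lemma convex_expR m (w c : 'I_m -> R) : (forall l, 0 <= w l) -> \sum_l w l = 1 ->
  expR (\sum_l w l * c l) <= \sum_l w l * expR (c l).
Proof.
move=> w0 w1; set b := \sum_l w l * c l.
have -> : expR b = \sum_l w l * (expR b * (1 + (c l - b))).
  transitivity (expR b * ((1 - b) * (\sum_l w l) + b)); first by rewrite w1; ring.
  rewrite {3}/b mulrDr mulrA !mulr_sumr -big_split; apply: eq_bigr => l _ /=; ring.
apply: ler_sum => l _; rewrite ler_wpM2l //.
have -> : expR (c l) = expR b * expR (c l - b) by rewrite -expRD addrC subrK.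
by rewrite ler_wpM2l ?expR_ge0 // expR_ge1Dx.
Qed.

End Exp.

Section Markov.
Context d (T : measurableType d) (R : realType) (P : probability T R).

Lemma markov1 (g : T -> R) c : measurable_fun setT g -> (forall w, 0 <= g w) ->
  (\int[P]_w (g w)%:E <= c%:E)%E -> (P [set w | (1 <= g w)%R] <= c%:E)%E.
Proof.
move=> mg g0 gc; have mA : measurable [set w | 1 <= g w].
  rewrite (_ : [set _ | _] = g @^-1` `[1, +oo[); last first.
    by apply/seteqP; split => w /=; rewrite in_itv /= andbT.
  exact: measurable_preimage.
apply: le_trans gc; rewrite -[X in P X]setIT -(integral_indic P measurableT) //.
apply: ge0_le_integral => //.
- by apply/measurable_EFinP; exact: measurable_indic.
- exact/measurable_EFinP.
- move=> w _; rewrite lee_fin indicE; case: (boolP (w \in _)) => //.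
  by rewrite inE.
Qed.

Lemma has_int_le (g : T -> R) c : measurable_fun setT g -> (forall w, 0 <= g w) ->
  (\int[P]_w (g w)%:E <= c%:E)%E -> exists2 r, has_int P g r & r <= c.
Proof.
move=> mg g0 gc.
have fin : (\int[P]_w (g w)%:E)%E \is a fin_num.
  rewrite ge0_fin_numE ?(le_lt_trans gc) ?ltry //.
  by apply: integral_ge0 => w _; rewrite lee_fin.
exists (fine (\int[P]_w (g w)%:E)%E).
  by apply: ge0_has_int => //; rewrite fineK.
by rewrite -lee_fin fineK.
Qed.

End Markov.

Section Bernstein.
Variables (R : realType) (n p : nat) (disp : measure_display) (T : measurableType disp).
Variables (P : probability T R) (x : 'I_n -> {RV P >-> p.-tuple R}).
Variables (y : 'I_n -> {RV P >-> R}) (K : R).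
Hypothesis K1 : 1 <= K.
Hypothesis ind : mutually_independent P (fun i w => (y i w, x i w)).

Lemma indep_rows (f : 'I_n -> p.-tuple R -> R) :
  (forall i, measurable_fun setT (f i)) -> (forall i r, 0 <= f i r) ->
  (forall i, \int[P]_w (f i (x i w))%:E < +oo)%E ->
  (\int[P]_w (\prod_i f i (x i w))%:E = \prod_i \int[P]_w (f i (x i w))%:E)%E.
Proof.
move=> mf f0 ff.
have := @indep_integral_prod _ _ T _ R P n _ _ ind (fun i z => f i z.2).
apply => //.
- by move=> i; exact: measurable_fun_pair.
- by move=> i; exact: (measurableT_comp (mf i) measurable_snd).
Qed.

Lemma indep_rows_le (f : 'I_n -> p.-tuple R -> R) c : 0 <= c ->
  (forall i, measurable_fun setT (f i)) -> (forall i r, 0 <= f i r) ->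
  (forall i, \int[P]_w (f i (x i w))%:E <= c%:E)%E ->
  (\int[P]_w (\prod_i f i (x i w))%:E <= (c ^+ n)%:E)%E.
Proof.
move=> c0 mf f0 fc; rewrite indep_rows //; last first.
  by move=> i; rewrite (le_lt_trans (fc i)) // ltry.
have H i : exists r, (\int[P]_w (f i (x i w))%:E = r%:E)%E /\ 0 <= r <= c.
  have [||r [_ rE] rc] := has_int_le _ _ (fc i) => //.
    exact: (measurableT_comp (mf i)).
  exists r; rewrite rc andbT -lee_fin -rE; split => //.
  by apply: integral_ge0 => w _; rewrite lee_fin.
have /choice[r Hr] := H; under eq_bigr do rewrite (proj1 (Hr _)).
rewrite prodEFin lee_fin -[X in _ ^+ X](card_ord n) -prodr_const.
by apply: ler_prod => i _; have [] := Hr i.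
Qed.

Record good_row (xi : p.-tuple R -> R) : Prop := GoodRow {
  gr_meas : measurable_fun setT xi;
  gr_ge0 : forall r, 0 <= xi r;
  gr_mean : forall i, has_int P (fun w => xi (x i w)) 1;
  gr_exp : forall i, (\int[P]_w (expR (xi (x i w) / K))%:E <= 2%:E)%E
}.

Let K0 : 0 < K. Proof. exact: lt_le_trans K1. Qed.

(** In the quadratic bound for exp(e s X), both X^2 / (16 K^2) and exp(s X) are at most exp(X / (2
    K)), so the remainder is at most 16 K^2 s^2 exp(X / K), of mean at most 32 K^2 s^2. The sign e
    selects the tail. *)
Lemma mgf_le xi e s i : good_row xi -> e ^+ 2 = 1 -> 0 <= s -> s <= (2 * K)^-1 ->
  (\int[P]_w (expR (e * s * xi (x i w)))%:E <= (expR (e * s + 32 * K ^+ 2 * s ^+ 2))%:E)%E.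
Proof.
move=> G e1 s0 sK.
have mx : measurable_fun setT (fun w => xi (x i w)).
  exact: (measurableT_comp (gr_meas G)).
have me : measurable_fun setT (fun w => expR (xi (x i w) / K)).
  by apply: measurableT_comp => //; exact: measurable_funM.
have [r rI r2] := has_int_le me (fun w => expR_ge0 _) (gr_exp G i).
have I := has_intD (has_int_cst P 1)
  (has_intD (has_intZ (e * s) (gr_mean G i)) (has_intZ (16 * K ^+ 2 * s ^+ 2) rI)).
apply: (@le_trans _ _ (1 + (e * s * 1 + 16 * K ^+ 2 * s ^+ 2 * r))%:E).
  have [_ <-] := I; apply: ge0_le_integral => //.
  - apply/measurable_EFinP; apply: measurableT_comp => //.
    exact: measurable_funM.
  - by apply/measurable_EFinP; exact: (has_int_measurable I).
  move=> w _; rewrite lee_fin /cst; set X := xi (x i w).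
  have X0 : 0 <= X by exact: (gr_ge0 G).
  apply: (le_trans (expR_le_quadratic _)).
  rewrite -addrA lerD2l lerD2l.
  have ae : `|e| = 1.
    by apply/eqP; rewrite -(@eqrXn2 _ 2) ?expr1n -?normrX ?e1 ?normr1.
  rewrite !normrM ae mul1r (ger0_norm s0) (ger0_norm X0) !exprMn e1 mul1r.
  have z0 : 0 <= X / (2 * K) by rewrite divr_ge0 // mulr_ge0 // ltW.
  have h1 : expR (s * X) <= expR (X / (2 * K)).
    by rewrite ler_expR mulrC ler_wpM2l.
  have h2 : X ^+ 2 <= 16 * K ^+ 2 * expR (X / (2 * K)).
    have := sqr_le_expR z0; rewrite expr_div_n ler_pdivrMr; last first.
      by rewrite exprn_gt0 // mulr_gt0.
    by rewrite exprMn; lra.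
  have h3 : expR (X / K) = expR (X / (2 * K)) * expR (X / (2 * K)).
    by rewrite -expRD; congr expR; field; rewrite gt_eqF.
  rewrite h3; have s20 := sqr_ge0 s.
  have -> : 16 * K ^+ 2 * s ^+ 2 * (expR (X / (2 * K)) * expR (X / (2 * K))) =
    s ^+ 2 * (16 * K ^+ 2 * expR (X / (2 * K))) * expR (X / (2 * K)) by ring.
  rewrite ler_pM ?expR_ge0 ?mulr_ge0 ?sqr_ge0 // ler_wpM2l //.
rewrite lee_fin; apply: le_trans (expR_ge1Dx _); rewrite mulr1 lerD2l lerD2l.
have : 0 <= K ^+ 2 * s ^+ 2 by rewrite mulr_ge0 ?sqr_ge0.
by move=> h; have := ler_wpM2l h r2; lra.
Qed.

Lemma bernstein xi e t : good_row xi -> e ^+ 2 = 1 -> 0 < t -> t <= 1 ->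
  (P [set w | (t * n%:R <= e * (\sum_i xi (x i w) - n%:R))%R] <=
   (expR (- (n%:R * t ^+ 2 / (128 * K ^+ 2))))%:E)%E.
Proof.
(* This s minimizes 32 K^2 s^2 - s t, with minimum - t^2 / (128 K^2); t <= 1 <= K makes it small
   enough for [mgf_le]. *)
move=> G e1 t0 t1; pose s := t / (64 * K ^+ 2).
have sp : 0 < s by rewrite divr_gt0 // mulr_gt0 // exprn_gt0.
have s0 := ltW sp.
have sK : s <= (2 * K)^-1.
  rewrite /s ler_pdivrMr ?mulr_gt0 ?exprn_gt0 //.
  have -> : (2 * K)^-1 * (64 * K ^+ 2) = 32 * K by field; rewrite gt_eqF.
  by have := K1; lra.
pose f (i : 'I_n) (r : p.-tuple R) := expR (e * s * xi r - e * s - s * t).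
have fE w : \prod_i f i (x i w) =
    expR (s * (e * (\sum_i xi (x i w) - n%:R) - t * n%:R)).
  rewrite -expR_sum; congr expR; rewrite !sumrB -mulr_sumr !sumr_const card_ord.
  by rewrite -(mulr_natr (e * s)) -(mulr_natr (s * t)); ring.
have mf i : measurable_fun setT (f i).
  apply: measurableT_comp => //; do 2 apply: measurable_funB => //.
  by apply: measurable_funM => //; exact: (gr_meas G).
have fc i : (\int[P]_w (f i (x i w))%:E <= (expR (- (t ^+ 2 / (128 * K ^+ 2))))%:E)%E.
  have -> : (\int[P]_w (f i (x i w))%:E =
     (expR (- e * s - s * t))%:E * \int[P]_w (expR (e * s * xi (x i w)))%:E)%E.
    rewrite -ge0_integralZl //; first last.
    - apply/measurable_EFinP; apply: measurableT_comp => //.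
      by apply: measurable_funM => //; exact: (measurableT_comp (gr_meas G)).
    apply: eq_integral => w _; rewrite -EFinM -expRD; congr (expR _)%:E; ring.
  apply: (@le_trans _ _ ((expR (- e * s - s * t))%:E *
     (expR (e * s + 32 * K ^+ 2 * s ^+ 2))%:E)%E).
    by apply: lee_wpmul2l; [rewrite lee_fin expR_ge0|exact: mgf_le].
  rewrite -EFinM -expRD lee_fin ler_expR /s le_eqVlt; apply/orP; left; apply/eqP.
  by field; rewrite gt_eqF.
have H := indep_rows_le (expR_ge0 _) mf (fun _ _ => expR_ge0 _) fc.
have -> : - (n%:R * t ^+ 2 / (128 * K ^+ 2)) =
    n%:R * (- (t ^+ 2 / (128 * K ^+ 2))) by ring.
rewrite expRM_natl.
rewrite (_ : [set _ | _] = [set w | 1 <= \prod_i f i (x i w)]); last first.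
  apply/seteqP; split => w /=; rewrite fE -[X in X <= expR _]expR0 ler_expR;
    by rewrite pmulr_rge0 // subr_ge0.
apply: markov1 H.
- by apply: measurable_prodr => i; exact: (measurableT_comp (mf i)).
- by move=> w; apply: prodr_ge0 => i _; exact: expR_ge0.
Qed.

End Bernstein.

Section Whp.
Context d (T : measurableType d) (R : realType) (P : probability T R).

(** The event S quantifies over all vectors and need not be measurable, so its failure is only
    required to lie in a measurable set of small probability. *)
Definition fails_with (S : T -> Prop) (c : R) : Prop :=
  exists B, [/\ measurable B, (P B <= c%:E)%E & forall w, ~ B w -> S w].

Lemma fails_with_imp S S' c c' : fails_with S c -> (forall w, S w -> S' w) ->
  c <= c' -> fails_with S' c'.
Proof.
move=> [B [mB Bc BS]] SS cc; exists B; split => //.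
  by rewrite (le_trans Bc) // lee_fin.
by move=> w /BS /SS.
Qed.

Lemma fails_with_and S S' c c' : fails_with S c -> fails_with S' c' ->
  fails_with (fun w => S w /\ S' w) (c + c').
Proof.
move=> [B [mB Bc BS]] [B' [mB' Bc' BS']]; exists (B `|` B'); split.
- exact: measurableU.
- rewrite EFinD (le_trans (measureU2 _ mB mB')) // leeD //.
- by move=> w /not_orP[/BS ? /BS' ?].
Qed.

Lemma fails_with_all (I : eqType) (s : seq I) (S : I -> T -> Prop) c :
  (forall i, i \in s -> fails_with (S i) c) ->
  fails_with (fun w => forall i, i \in s -> S i w) ((size s)%:R * c).
Proof.
elim: s => [|i s IH] H.
  by exists set0; split => //; rewrite measure0 mul0r.
have Hi : fails_with (S i) c by apply: H; rewrite inE eqxx.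
have Hs : fails_with (fun w => forall i, i \in s -> S i w) ((size s)%:R * c).
  by apply: IH => j js; apply: H; rewrite inE js orbT.
apply: fails_with_imp (fails_with_and Hi Hs) _ _.
  by move=> w [Si Ss] j; rewrite inE => /orP[/eqP ->|/Ss].
by rewrite /= -natr1; lra.
Qed.

Lemma fails_with_markov (g : T -> R) c : measurable_fun setT g ->
  (forall w, 0 <= g w) -> (\int[P]_w (g w)%:E <= c%:E)%E ->
  fails_with (fun w => g w < 1) c.
Proof.
move=> mg g0 gc; exists [set w | 1 <= g w]; split.
- rewrite (_ : [set _ | _] = g @^-1` `[1, +oo[); last first.
    by apply/seteqP; split => w /=; rewrite in_itv /= andbT.
  exact: measurable_preimage.
- exact: markov1.
- by move=> w /= /negP; rewrite -ltNge.
Qed.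

End Whp.

Section Concentration.
Variables (R : realType) (n p : nat) (theta : 'cV[R]_p) (lam : 'rV[R]_p).
Variables (sigma sigma_x : R) (disp : measure_display) (T : measurableType disp).
Variables (P : probability T R) (x : 'I_n -> {RV P >-> p.-tuple R}).
Variables (eps y : 'I_n -> {RV P >-> R}).
Hypothesis LM : linear_model theta lam sigma sigma_x x eps y.
Hypothesis lam0 : forall j, 0 < lam 0 j.
Hypothesis sx1 : 1 <= sigma_x.

Let K := 2 * sigma_x ^+ 2.
Let K1 : 1 <= K.
Proof. by have : 1 <= sigma_x ^+ 2; [exact: exprn_ege1|rewrite /K; lra]. Qed.
Let K0 : 0 < K. Proof. exact: lt_le_trans K1. Qed.
Let ind := model_indep LM.

Definition std_design (w : T) : 'M[R]_(n, p) :=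
  \matrix_(i, j) (tnth (x i w) j / Num.sqrt (lam 0 j)).

Lemma std_design_mul w (v : 'cV[R]_p) i : (std_design w *m v) i 0 = zeta lam v (x i w).
Proof. by rewrite mxE; apply: eq_bigr => j _; rewrite mxE mulrC. Qed.

Lemma sqn_std_design w v : sqn (std_design w *m v) = \sum_i zeta lam v (x i w) ^+ 2.
Proof. by rewrite sqnE; apply: eq_bigr => i _; rewrite std_design_mul. Qed.

Lemma subgaussian_exp1 i v : sqn v <= 1 ->
  (\int[P]_w (expR (zeta lam v (x i w) ^+ 2 / K))%:E <= 2%:E)%E.
Proof.
move=> v1; have mz : measurable_fun setT (fun w => zeta lam v (x i w)).
  exact: (measurableT_comp (measurable_zeta lam v)).
have [v0|v0] := eqVneq v 0.
  apply: (@le_trans _ _ 1%:E); last by rewrite lee_fin ler1n.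
  have [_ <-] := has_int_cst P (1 : R); rewrite le_eqVlt; apply/orP; left; apply/eqP.
  apply: eq_integral => w _; rewrite /zeta v0 big1 ?expr0n ?mul0r ?expR0 // => j _.
  by rewrite mxE mul0r.
apply: le_trans (subgaussian_exp LM lam0 i v0).
have vp : 0 < sqn v by rewrite lt_def sqn_eq0 v0 sqn_ge0.
apply: ge0_le_integral => //.
- apply/measurable_EFinP; apply: measurableT_comp => //.
  by apply: measurable_funM => //; exact: measurable_funX.
- apply/measurable_EFinP; apply: measurableT_comp => //.
  by do 2 (apply: measurable_funM => //); exact: measurable_funX.
- move=> w _; rewrite lee_fin ler_expR ler_pdivlMr // ler_piMr //.
  by rewrite divr_ge0 ?sqr_ge0 // ltW.
Qed.

(** By Jensen the exponential moment passes to convex combinations with the same K, so the resulting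
    deviation bound does not depend on m. *)
Lemma good_row_convex m (v : 'I_m -> 'cV[R]_p) (c : 'I_m -> R) :
  (forall l, sqn (v l) = 1) -> (forall l, 0 <= c l) -> \sum_l c l = 1 ->
  good_row x K (fun r => \sum_l c l * zeta lam (v l) r ^+ 2).
Proof.
move=> v1 c0 c1; split.
- apply: measurable_sumr => l; apply: measurable_funM => //.
  by apply: measurable_funX; exact: measurable_zeta.
- by move=> r; apply: sumr_ge0 => l _; rewrite mulr_ge0 ?sqr_ge0.
- move=> i; rewrite -c1; apply: has_int_sum => l _.
  by rewrite -[X in has_int _ _ X]mulr1; apply: has_intZ; have := has_int_zeta2 LM lam0 i (v l); rewrite v1.
move=> i.
have mz l : measurable_fun setT (fun w => zeta lam (v l) (x i w)).
  exact: (measurableT_comp (measurable_zeta lam (v l))).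
have me l : measurable_fun setT (fun w => expR (zeta lam (v l) (x i w) ^+ 2 / K)).
  apply: measurableT_comp => //; apply: measurable_funM => //; exact: measurable_funX.
have /choice[r Hr] l : exists r,
    has_int P (fun w => expR (zeta lam (v l) (x i w) ^+ 2 / K)) r /\ r <= 2.
  have e2 : (\int[P]_w (expR (zeta lam (v l) (x i w) ^+ 2 / K))%:E <= 2%:E)%E.
    by apply: subgaussian_exp1; rewrite v1.
  by have [r rI r2] := has_int_le (me l) (fun w => expR_ge0 _) e2; exists r.
have I : has_int P (fun w => \sum_l c l * expR (zeta lam (v l) (x i w) ^+ 2 / K))
    (\sum_l c l * r l).
  by apply: has_int_sum => l _; apply: has_intZ; have [] := Hr l.
apply: (@le_trans _ _ (\sum_l c l * r l)%:E); last first.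
  rewrite lee_fin (@le_trans _ _ (\sum_l c l * 2)) //; last first.
    by rewrite -mulr_suml c1 mul1r.
  by apply: ler_sum => l _; rewrite ler_wpM2l //; have [] := Hr l.
have [_ <-] := I; apply: ge0_le_integral => //.
- apply/measurable_EFinP; apply: measurableT_comp => //; apply: measurable_funM => //.
  apply: measurable_sumr => l; apply: measurable_funM => //.
  exact: measurable_funX.
- by apply/measurable_EFinP; exact: (has_int_measurable I).
- move=> w _; rewrite lee_fin mulr_suml.
  under eq_bigr do rewrite -mulrA.
  exact: convex_expR.
Qed.

Lemma deviation m (v : 'I_m -> 'cV[R]_p) (c : 'I_m -> R) t :
  (forall l, sqn (v l) = 1) -> (forall l, 0 <= c l) -> \sum_l c l = 1 ->
  0 < t -> t <= 1 ->
  fails_with P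
    (fun w => `|\sum_l c l * sqn (std_design w *m v l) - n%:R| <= t * n%:R)
    (2 * expR (- (n%:R * t ^+ 2 / (128 * K ^+ 2)))).
Proof.
move=> v1 c0 c1 t0 t1; have G := good_row_convex v1 c0 c1.
pose xi w := \sum_i \sum_l c l * zeta lam (v l) (x i w) ^+ 2.
have xiE w : \sum_l c l * sqn (std_design w *m v l) = xi w.
  rewrite /xi exchange_big; apply: eq_bigr => l _.
  by rewrite sqn_std_design mulr_sumr.
have one (e : R) : e ^+ 2 = 1 ->
    fails_with P (fun w => e * (xi w - n%:R) < t * n%:R)
      (expR (- (n%:R * t ^+ 2 / (128 * K ^+ 2)))).
  move=> e1; exists [set w | t * n%:R <= e * (xi w - n%:R)]; split.
  - rewrite (_ : [set _ | _] = (fun w => e * (xi w - n%:R)) @^-1` `[t * n%:R, +oo[).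
      apply: measurable_preimage => //; apply: measurable_funM => //.
      apply: measurable_funB => //; apply: measurable_sumr => i.
      exact: (measurableT_comp (gr_meas G)).
    by apply/seteqP; split => w /=; rewrite in_itv /= andbT.
  - exact: (bernstein K1 ind G e1 t0 t1).
  - by move=> w /= /negP; rewrite -ltNge.
have := fails_with_and (one 1 _) (one (-1) _).
rewrite sqrrN expr1n => /(_ erefl erefl) /fails_with_imp; apply; last by lra.
move=> w; rewrite xiE mul1r mulN1r ler_norml => -[h1 h2]; apply/andP; split; lra.
Qed.

Lemma head_isometry m (J : 'M[R]_(p, m)) : (0 < n)%N -> (0 < m)%N ->
  (forall v, sqn (J *m v) = sqn v) ->
  fails_with P
    (fun w => forall v, 3 / 5 * n%:R * sqn v <= sqn (std_design w *m (J *m v)) /\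
                        sqn (std_design w *m (J *m v)) <= 7 / 5 * n%:R * sqn v)
    (2 ^+ (18 * m) * (2 * expR (- (n%:R / (3200 * K ^+ 2))))).
Proof.
move=> n0 m0 Jiso; have nR : 0 < n%:R :> R by rewrite ltr0n.
pose S f w := `|sqn (std_design w *m (J *m net_vec R f)) - n%:R * sqn (net_vec R f)|
  <= 1 / 5 * n%:R.
have one f : f \in enum (lattice_pts m) -> fails_with P (S f)
    (2 * expR (- (n%:R / (3200 * K ^+ 2)))).
  rewrite mem_enum => fN; set v := net_vec R f; set u := J *m v.
  have v1 : sqn v <= 1 by exact: sqn_net_vec.
  (* The net contains the origin, which cannot be normalized for [deviation]. *)
  have [v0|v0] := eqVneq (sqn v) 0.
    exists set0; split => //; first by rewrite measure0 lee_fin mulr_ge0 ?expR_ge0.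
    move=> w _; rewrite /S -/v -/u v0 mulr0 subr0.
    have /eqP : sqn u = 0 by rewrite Jiso.
    rewrite sqn_eq0 => /eqP ->; rewrite mulmx0.
    have -> : sqn (0 : 'cV[R]_n) = 0 by apply/eqP; rewrite sqn_eq0.
    by rewrite normr0 mulr_ge0 // divr_ge0.
  have vp : 0 < sqn v by rewrite lt_def v0 sqn_ge0.
  have vn0 : nrm v != 0 by rewrite gt_eqF // sqrtr_gt0.
  have u1 : sqn ((nrm v)^-1 *: u) = 1 by rewrite sqnZ exprVn sqr_nrm Jiso mulVf.
  have := @deviation 1 (fun=> (nrm v)^-1 *: u) (fun=> 1) (1 / 5) (fun=> u1)
    (fun=> ler01) _ _ _.
  rewrite big_ord1 => /(_ erefl); have -> : 0 < 1 / 5 :> R by lra.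
  have -> : 1 / 5 <= 1 :> R by lra.
  move=> /(_ isT isT) /fails_with_imp; apply.
    move=> w; rewrite big_ord1 mul1r -scalemxAr sqnZ exprVn sqr_nrm => H.
    rewrite /S -/v -/u.
    have -> : sqn (std_design w *m u) - n%:R * sqn v =
      sqn v * ((sqn v)^-1 * sqn (std_design w *m u) - n%:R) by field.
    rewrite normrM (ger0_norm (ltW vp)) (le_trans _ H) //.
    by rewrite ler_piMl.
  rewrite ler_wpM2l // ler_expR lerN2 le_eqVlt; apply/orP; left; apply/eqP.
  by field; rewrite gt_eqF.
apply: fails_with_imp (fails_with_all one) _ _; last first.
  rewrite -cardE ler_wpM2r ?mulr_ge0 ?expR_ge0 // -natrX ler_nat.
  exact: card_lattice_pts.
move=> w H v; set Z := std_design w *m J.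
pose M : 'M[R]_m := n%:R^-1 *: (Z^T *m Z) - 1%:M.
have Msym : M^T = M.
  by rewrite /M linearB /= linearZ /= trmx_mul trmxK trmx1.
have Mq u : dot u (M *m u) = n%:R^-1 * sqn (Z *m u) - sqn u.
  rewrite /M mulmxBl mul1mx -scalemxAl dotDr dotNr dotZr; congr (_ * _ - _).
  by rewrite -mulmxA -dot_mulmx.
have netM f : f \in lattice_pts m ->
    `|dot (net_vec R f) (M *m net_vec R f)| <= 1 / 5.
  move=> fN; have := H f; rewrite mem_enum => /(_ fN); rewrite /S mulmxA -/Z Mq.
  set a := sqn _; set b := sqn _.
  have -> : n%:R^-1 * a - b = (a - n%:R * b) / n%:R by field; rewrite gt_eqF.
  by rewrite normrM [`|_^-1|]ger0_norm ?invr_ge0 // ler_pdivrMr.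
have := form_le_net Msym m0 netM v; rewrite Mq mulmxA -/Z ler_norml => /andP[].
set a := sqn (Z *m v); set b := sqn v => h1 h2.
have aE : a = n%:R * (n%:R^-1 * a) by rewrite mulVKf // gt_eqF.
have k1 : 3 / 5 * n%:R * b = n%:R * (3 / 5 * b) by ring.
have k2 : 7 / 5 * n%:R * b = n%:R * (7 / 5 * b) by ring.
by rewrite aE k1 k2 !ler_pM2l //; split; lra.
Qed.

End Concentration.

Section Blocks.
Variables (R : realType) (n p : nat) (theta : 'cV[R]_p) (lam : 'rV[R]_p).
Variables (sigma sigma_x : R) (disp : measure_display) (T : measurableType disp).
Variables (P : probability T R) (x : 'I_n -> {RV P >-> p.-tuple R}).
Variables (eps y : 'I_n -> {RV P >-> R}).
Hypothesis LM : linear_model theta lam sigma sigma_x x eps y.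
Hypothesis lam0 : forall j, 0 < lam 0 j.
Hypothesis sx1 : 1 <= sigma_x.
Hypothesis n0 : (0 < n)%N.

Let K := 2 * sigma_x ^+ 2.
Let K0 : 0 < K.
Proof. by rewrite mulr_gt0 // exprn_gt0 // (lt_le_trans ltr01). Qed.
Let Zn := std_design lam x.

Let expZ v w := expR (sqn (Zn w *m v) / K).

Let expZE v w : expZ v w = \prod_i expR (zeta lam v (x i w) ^+ 2 / K).
Proof. by rewrite /expZ sqn_std_design mulr_suml expR_sum. Qed.

Let mexpZ v : measurable_fun setT (expZ v).
Proof.
rewrite (_ : expZ v = fun w => \prod_i expR (zeta lam v (x i w) ^+ 2 / K)); last first.
  by apply/funext => w; rewrite expZE.
apply: measurable_prodr => i; apply: measurableT_comp => //.
apply: measurable_funM => //; apply: measurable_funX.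
exact: (measurableT_comp (measurable_zeta lam v)).
Qed.

Lemma exp_sqn_std_design v : sqn v <= 1 -> (\int[P]_w (expZ v w)%:E <= (2 ^+ n)%:E)%E.
Proof.
move=> v1; under eq_integral do rewrite expZE.
apply: (indep_rows_le (model_indep LM)
    (f := fun (i : 'I_n) r => expR (zeta lam v r ^+ 2 / K))) => //.
- move=> i; apply: measurableT_comp => //; apply: measurable_funM => //.
  by apply: measurable_funX; exact: measurable_zeta.
- move=> i; exact: (subgaussian_exp1 LM lam0 sx1 i v1).
Qed.

(* Averaging exp(|Z J_k v|^2 / K) over the blocks k with weights c_k, and
   summing over the net, controls the weighted sum of the block norms at once,
   uniformly in the number of blocks. *)
Lemma blocks_op (B : nat) (J : 'I_B -> 'M[R]_(p, n)) (c : 'I_B -> R) :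
  (forall k v, sqn (J k *m v) <= sqn v) ->
  (forall k, 0 <= c k) -> \sum_k c k = 1 ->
  fails_with P (fun w => exists mu : 'I_B -> R, [/\ forall k, 0 <= mu k,
      forall k u, sqn (Zn w *m (J k *m u)) <= 2 * mu k * sqn u &
      \sum_k c k * mu k <= 20 * K * n%:R])
    (expR (- n%:R)).
Proof.
(* Each mean is at most 2^n and the net has at most 2^(18 n) points, in total at most e^(19 n); L =
   20 n leaves e^(-n). *)
move=> Jc c0 c1; pose L := 20 * n%:R : R.
pose N := lattice_pts n; pose V := net_vec R (m := n).
pose g w := expR (- L) * \sum_k c k * \sum_(f in N) expZ (J k *m V f) w.
have /choice[r Hr] (kf : 'I_B * {ffun 'I_n -> 'I_(4 * n + 4 * n).+1}) :
    exists r, kf.2 \in N -> has_int P (expZ (J kf.1 *m V kf.2)) r /\ r <= 2 ^+ n.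
  have [fN|_] := boolP (kf.2 \in N); last by exists 0.
  have e : sqn (J kf.1 *m V kf.2) <= 1.
    by rewrite (le_trans (Jc _ _)) // sqn_net_vec.
  have [r rI r2] := has_int_le (mexpZ _) (fun w => expR_ge0 _) (exp_sqn_std_design e).
  by exists r.
have I : has_int P g (expR (- L) * \sum_k c k * \sum_(f in N) r (k, f)).
  apply/has_intZ/has_int_sum => k _; apply/has_intZ/has_int_sum => f fN.
  by have [] := Hr (k, f) fN.
have mg : measurable_fun setT g := has_int_measurable I.
have g0 w : 0 <= g w.
  rewrite mulr_ge0 ?expR_ge0 // sumr_ge0 // => k _; rewrite mulr_ge0 // sumr_ge0 // => f _.
  exact: expR_ge0.
have gI : (\int[P]_w (g w)%:E <= (expR (- n%:R))%:E)%E.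
  have [_ ->] := I; rewrite lee_fin.
  apply: (@le_trans _ _ (expR (- L) * expR (19 * n%:R))); last first.
    by rewrite -expRD ler_expR /L; lra.
  rewrite ler_wpM2l ?expR_ge0 // (@le_trans _ _ (\sum_k c k * 2 ^+ (19 * n))) //.
    apply: ler_sum => k _; rewrite ler_wpM2l //.
    apply: (@le_trans _ _ (\sum_(f in N) 2 ^+ n)).
      by apply: ler_sum => f fN; have [] := Hr (k, f) fN.
    rewrite sumr_const -[leLHS]mulr_natl.
    have -> : 2 ^+ (19 * n) = (2 ^ (18 * n))%:R * 2 ^+ n :> R.
      by rewrite natrX -exprD -mulSnr.
    by rewrite ler_wpM2r ?exprn_ge0 // ler_nat card_lattice_pts.
  rewrite -mulr_suml c1 mul1r -natrM -[(19 * n)%:R]mulr1 expRM_natl.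
  rewrite lerXn2r ?nnegrE ?expR_ge0 //.
  by have := expR_ge1Dx (1 : R); lra.
apply: fails_with_imp (fails_with_markov mg g0 gI) _ (lexx _) => w g1.
(* The net is nonempty, as the maximum over it below requires. *)
have [f0 f0N _] : exists2 f, f \in N & sqn (0 - V f) <= 1 / 16.
  by apply: net_approx => //; rewrite (_ : sqn _ = 0) //; apply/eqP; rewrite sqn_eq0.
pose q k f := sqn (Zn w *m (J k *m V f)).
pose fm k := [arg max_(f > f0 in N) q k f]%O.
have fmP k : fm k \in N /\ forall f, f \in N -> q k f <= q k (fm k).
  rewrite /fm; case: arg_maxP => //.
exists (fun k => q k (fm k)); split.
- by move=> k; exact: sqn_ge0.
- move=> k u; pose Z := Zn w *m J k.
  have Msym : (Z^T *m Z)^T = Z^T *m Z by rewrite trmx_mul trmxK.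
  have Mq v : dot v (Z^T *m Z *m v) = sqn (Zn w *m (J k *m v)).
    by rewrite -mulmxA -dot_mulmx /Z -mulmxA.
  have netM f : f \in lattice_pts n ->
      `|dot (net_vec R f) (Z^T *m Z *m net_vec R f)| <= q k (fm k).
    by move=> fN; rewrite Mq ger0_norm ?sqn_ge0 //; have [_] := fmP k; apply.
  have := form_le_net Msym n0 netM u; rewrite Mq ger0_norm ?sqn_ge0 //.
(* The bound e^u >= 1 + u makes the exponential average linear, so that g < 1 controls the weighted
   sum of the block maxima itself. *)
have h : \sum_k c k * (1 + q k (fm k) / K - L) <= g w.
  rewrite /g mulr_sumr; apply: ler_sum => k _; rewrite mulrCA ler_wpM2l //.
  apply: (@le_trans _ _ (expR (- L) * expR (q k (fm k) / K))).
    by rewrite -expRD (le_trans _ (expR_ge1Dx _)) //; lra.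
  rewrite ler_wpM2l ?expR_ge0 //; have [fN _] := fmP k.
  by rewrite (bigD1 (fm k)) //= lerDl sumr_ge0 // => f _; exact: expR_ge0.
have e : \sum_k c k * (1 + q k (fm k) / K - L) =
    (1 - L) * (\sum_k c k) + (\sum_k c k * q k (fm k)) / K.
  rewrite mulr_sumr mulr_suml -big_split; apply: eq_bigr => k _ /=; ring.
have : (\sum_k c k * q k (fm k)) / K <= L by move: h; rewrite e c1; lra.
by rewrite ler_pdivrMr // /L => h2; rewrite mulrAC.
Qed.

End Blocks.

(** * Operator norms of the tail *)

Section PartialInjection.
Variables (R : rcfType) (a b : nat) (r : 'I_a -> 'I_b -> bool).
Hypothesis r_fun : forall i j j', r i j -> r i j' -> j = j'.

(** A relation instead of a function, because the last block of coordinates may be incomplete: some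
    columns may then be zero. *)
Definition rel_mx : 'M[R]_(a, b) := \matrix_(i, j) (r i j)%:R.

Lemma sqr_sum_rel (i : 'I_a) (f : 'I_b -> R) :
  (\sum_j (r i j)%:R * f j) ^+ 2 = \sum_j (r i j)%:R * f j ^+ 2.
Proof.
case: (pickP (r i)) => [j rij|nr]; last first.
  rewrite !big1 ?expr0n // => j _; first by rewrite nr mul0r.
  by rewrite nr mul0r.
have z j' : j' != j -> r i j' = false.
  by move=> jj; apply: contraNF jj => /r_fun/(_ rij) ->.
rewrite (bigD1 j) //= [in RHS](bigD1 j) //= rij !mul1r !big1 ?addr0 // => j' /z ->;
  by rewrite mul0r.
Qed.

Lemma sqn_rel_mx v : sqn (rel_mx *m v) = \sum_j (\sum_i (r i j)%:R) * v j 0 ^+ 2.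
Proof.
rewrite sqnE (eq_bigr (fun i => \sum_j (r i j)%:R * v j 0 ^+ 2)) => [|i _].
  by rewrite exchange_big; apply: eq_bigr => j _; rewrite mulr_suml.
rewrite -sqr_sum_rel mxE; congr (_ ^+ 2); apply: eq_bigr => j _.
by rewrite mxE.
Qed.

Hypothesis r_inj : forall i i' j, r i j -> r i' j -> i = i'.

Lemma sum_rel_le1 j : \sum_i (r i j)%:R <= 1 :> R.
Proof.
case: (pickP (r ^~ j)) => [i rij|nr]; last first.
  by rewrite big1 // => i _; rewrite nr.
rewrite (bigD1 i) //= rij big1 ?addr0 // => i' ii.
by rewrite (_ : r i' j = false) //; apply: contraNF ii => /r_inj/(_ rij) ->.
Qed.

Lemma sqn_rel_mx_le v : sqn (rel_mx *m v) <= sqn v.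
Proof.
rewrite sqn_rel_mx sqnE; apply: ler_sum => j _.
by rewrite ler_piMl ?sqr_ge0 // sum_rel_le1.
Qed.

Lemma sqn_rel_mx_eq v : (forall j, exists i, r i j) -> sqn (rel_mx *m v) = sqn v.
Proof.
move=> tot; rewrite sqn_rel_mx sqnE; apply: eq_bigr => j _.
have [i rij] := tot j; rewrite (bigD1 i) //= rij big1 ?addr0 ?mul1r // => i' ii.
by rewrite (_ : r i' j = false) //; apply: contraNF ii => /r_inj/(_ rij) ->.
Qed.

End PartialInjection.

Section Blocks.
Variables (R : rcfType) (n q : nat).
Hypotheses (n0 : (0 < n)%N) (q0 : (0 < q)%N).

Definition in_block (k : nat) (t : 'I_q) (m : 'I_n) : bool := (t == k * n + m :> nat)%N.
Definition block_mx_sel (k : nat) : 'M[R]_(q, n) := rel_mx R (in_block k).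

Lemma sqn_block_sel_le k v : sqn (block_mx_sel k *m v) <= sqn v.
Proof.
apply: sqn_rel_mx_le => [t m m'|t t' m] /eqP H /eqP H'; apply: val_inj => /=; lia.
Qed.

(** Taking q blocks of n coordinates always suffices, as n >= 1; the trailing ones are empty. Each
    coordinate t lies in exactly one, by Euclidean division. *)
Lemma sum_in_block (t : 'I_q) : \sum_(k < q) \sum_m (in_block k t m)%:R = 1 :> R.
Proof.
have kq : (t %/ n < q)%N by rewrite (leq_ltn_trans (leq_div _ _)).
rewrite (bigD1 (Ordinal kq)) //= (bigD1 (Ordinal (ltn_pmod t n0))) //=.
rewrite {1}/in_block /= -divn_eq eqxx big1 => [|m mm]; last first.
  rewrite /in_block; case: eqP => // e; case/eqP: mm; apply: val_inj => /=.
  by rewrite e modnMDl modn_small.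
rewrite addr0 big1 ?addr0 // => k kk; rewrite big1 // => m _.
rewrite /in_block; case: eqP => // e; case/eqP: kk; apply: val_inj => /=.
by rewrite e divnMDl // divn_small // addn0.
Qed.

Variable c : 'rV[R]_q.
Hypothesis c0 : forall t, 0 < c 0 t.
Hypothesis c_dec : forall t t' : 'I_q, (t <= t')%N -> c 0 t' <= c 0 t.

(* Extended by 0, since the last blocks of n coordinates may be past the end. *)
Definition cext (i : nat) : R := if insub i is Some t then c 0 t else 0.

Lemma cextE (t : 'I_q) : cext t = c 0 t.
Proof. by rewrite /cext valK. Qed.

Lemma cext_out i : (q <= i)%N -> cext i = 0.
Proof. by move=> qi; rewrite /cext insubN // -leqNgt. Qed.

Lemma cext_ge0 i : 0 <= cext i.
Proof. by rewrite /cext; case: insubP => // t _ _; exact: ltW. Qed.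

Lemma cext_dec i j : (i <= j)%N -> cext j <= cext i.
Proof.
move=> ij; have [qj|jq] := leqP q j; first by rewrite cext_out // cext_ge0.
rewrite -[j]/(val (Ordinal jq)) -[i]/(val (Ordinal (leq_ltn_trans ij jq))) !cextE.
exact: c_dec.
Qed.

Lemma sum_cext_le m : \sum_(0 <= i < m) cext i <= \sum_t c 0 t.
Proof.
have -> : \sum_t c 0 t = \sum_(0 <= i < q) cext i.
  by rewrite big_mkord; apply: eq_bigr => t _; rewrite cextE.
have [mq|qm] := leqP m q.
  by rewrite [leRHS](big_cat_nat (n := m)) //= lerDl sumr_ge0 // => i _; exact: cext_ge0.
rewrite [leLHS](big_cat_nat (n := q)) //=; last exact: ltnW.
rewrite [X in _ + X]big_nat [X in _ + X]big1 ?addr0 // => i /andP[qi _].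
exact: cext_out.
Qed.

(** By monotonicity, n times the head of a block after the first is at most the sum of the preceding
    block. *)
Lemma sum_block_heads m :
  n%:R * \sum_(k < m) cext (k * n) <= n%:R * cext 0 + \sum_t c 0 t.
Proof.
suff H k : n%:R * \sum_(k < k.+1) cext (k * n) <=
    n%:R * cext 0 + \sum_(0 <= i < k * n) cext i.
  apply: (@le_trans _ _ (n%:R * \sum_(k < m.+1) cext (k * n))).
    by rewrite ler_wpM2l // big_ord_recr /= lerDl cext_ge0.
  by rewrite (le_trans (H m)) // lerD2l sum_cext_le.
elim: k => [|k IH].
  by rewrite big_ord_recl big_ord0 /= mul0n big_nil !addr0.
rewrite big_ord_recr /= mulrDr (big_cat_nat (n := (k * n)%N)) //=; last first.
  by rewrite leq_mul2r leqnSn orbT.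
rewrite addrA lerD //.
have -> : n%:R * cext (k.+1 * n) = \sum_(k * n <= i < k.+1 * n) cext (k.+1 * n).
  by rewrite sumr_const_nat mulSn addnK mulr_natl.
rewrite [leLHS]big_nat [leRHS]big_nat; apply: ler_sum => i /andP[_ ik].
exact/cext_dec/ltnW.
Qed.

(* Cauchy-Schwarz over the blocks; the entries of c on the block k are at most
   its value at k n. *)
Lemma blocks_bound m (Z : 'M[R]_(m, q)) (mu : 'I_q -> R) (b : R) :
  (forall k, 0 <= mu k) ->
  (forall (k : 'I_q) u, sqn (Z *m (block_mx_sel k *m u)) <= 2 * mu k * sqn u) ->
  \sum_(k < q) cext (k * n) * mu k <= b ->
  forall s, sqn (scale_cols Z c *m s) <= 2 * b * sqn s.
Proof.
move=> mu0 Zmu bS s; rewrite scale_cols_mul; set s' := \col_j _.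
pose u k := (block_mx_sel k)^T *m s'.
pose Sk (k : nat) := \sum_m \sum_t (in_block k t m)%:R * s t 0 ^+ 2.
have Sk0 k : 0 <= Sk k.
  by apply: sumr_ge0 => m' _; apply: sumr_ge0 => t _; rewrite mulr_ge0 ?sqr_ge0.
have sE : s' = \sum_(k < q) block_mx_sel k *m u k.
  apply/matrixP => t j; rewrite [j]ord1 summxE.
  transitivity ((\sum_(k < q) \sum_m (in_block k t m)%:R) * s' t 0).
    by rewrite sum_in_block mul1r.
  rewrite mulr_suml; apply: eq_bigr => k _.
  rewrite [RHS]mxE mulr_suml; apply: eq_bigr => m' _; rewrite [rel_mx _ _ _ _]mxE.
  case e: (in_block k t m'); last by rewrite !mul0r.
  congr (_ * _); rewrite [RHS]mxE (bigD1 t) //= big1 ?addr0 => [|t' tt].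
    by rewrite !mxE e mul1r.
  rewrite !mxE; case e': (in_block k t' m'); last by rewrite mul0r.
  by case/eqP: tt; apply: val_inj; exact: etrans (eqP e') (esym (eqP e)).
have uS k : sqn (u k) <= cext (k * n) * Sk k.
  rewrite sqnE /Sk mulr_sumr; apply: ler_sum => m' _.
  rewrite mxE; under eq_bigr do rewrite 2!mxE.
  have -> : (\sum_t (in_block k t m')%:R * s' t 0) ^+ 2 =
      \sum_t (in_block k t m')%:R * s' t 0 ^+ 2.
    apply: (@sqr_sum_rel _ _ _ (fun m t => in_block k t m)).
    by move=> i t t' /eqP e /eqP e'; apply: val_inj; exact: etrans e (esym e').
  rewrite mulr_sumr; apply: ler_sum => t _; rewrite [leRHS]mulrCA.
  case e: (in_block k t m'); last by rewrite !mulr0n !mul0r.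
  rewrite !mul1r mxE exprMn sqr_sqrtr ?(ltW (c0 t)) // ler_wpM2r ?sqr_ge0 //.
  have kt : (k * n <= t)%N by have := eqP e; lia.
  by rewrite -cextE; exact: cext_dec.
have SkS : \sum_(k < q) Sk k = sqn s.
  rewrite /Sk sqnE; under eq_bigr do rewrite exchange_big.
  rewrite exchange_big /=; apply: eq_bigr => t _.
  transitivity ((\sum_(k < q) \sum_m (in_block k t m)%:R) * s t 0 ^+ 2).
    by rewrite mulr_suml; apply: eq_bigr => k _; rewrite mulr_suml.
  by rewrite sum_in_block mul1r.
pose va := \col_(k < q) Num.sqrt (2 * mu k * cext (k * n)).
pose vb := \col_(k < q) Num.sqrt (Sk k).
have h1 : nrm (Z *m s') <= dot va vb.
  rewrite sE mulmx_sumr; apply: (@le_trans _ _ (\sum_(k < q) nrm (Z *m (block_mx_sel k *m u k)))).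
    elim/big_ind2: _ => [|x1 x2 y1 y2 h1 h2|//].
      by rewrite /nrm (_ : sqn _ = 0) ?sqrtr0 //; apply/eqP; rewrite sqn_eq0.
    by rewrite (le_trans (nrmD _ _)) // lerD.
  apply: ler_sum => k _; rewrite !mxE -sqrtrM; last first.
    by rewrite !mulr_ge0 ?cext_ge0.
  rewrite ler_sqrt; last by rewrite !mulr_ge0 ?cext_ge0.
  by rewrite (le_trans (Zmu k _)) // -[leRHS]mulrA ler_wpM2l // mulr_ge0.
have h2 : sqn va <= 2 * b.
  rewrite sqnE; under eq_bigr do rewrite mxE sqr_sqrtr ?mulr_ge0 ?cext_ge0 //.
  under eq_bigr do rewrite -mulrA [mu _ * _]mulrC.
  by rewrite -mulr_sumr ler_wpM2l.
have h3 : sqn vb = sqn s.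
  rewrite sqnE -SkS; apply: eq_bigr => k _; rewrite mxE sqr_sqrtr //.
rewrite -sqr_nrm (@le_trans _ _ (dot va vb ^+ 2)) //.
  by rewrite lerXn2r ?nnegrE ?nrm_ge0 // (le_trans (nrm_ge0 _) h1).
by rewrite (le_trans (dot_sqr_le _ _)) // h3 ler_wpM2r ?sqn_ge0.
Qed.

End Blocks.

(** * The conditional risk in head and tail coordinates *)

Section Split.
Variables (R : realType) (d p : nat) (hdp : (d < p)%N).

Lemma sum_head_tail (F : 'I_p -> R) :
  \sum_j F j = \sum_i F (head_ord hdp i) + \sum_i F (tail_ord hdp i).
Proof.
have e := subnKC (ltnW hdp).
rewrite (reindex (cast_ord e)) /=; last first.
  by exists (cast_ord (esym e)) => i _; rewrite ?cast_ordK ?cast_ordKV.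
rewrite big_split_ord /=; by congr (_ + _); apply: eq_bigr => i _; congr F; apply: val_inj.
Qed.

Lemma mul_head_tail m (D : 'M[R]_(m, p)) (v : 'cV[R]_p) :
  D *m v = colsub (head_ord hdp) D *m rowsub (head_ord hdp) v +
           colsub (tail_ord hdp) D *m rowsub (tail_ord hdp) v.
Proof.
apply/matrixP => i j; rewrite [RHS]mxE !mxE sum_head_tail.
by congr (_ + _); apply: eq_bigr => k _; rewrite !mxE.
Qed.

Lemma tr_colsub_mul m k (f : 'I_k -> 'I_p) (D : 'M[R]_(m, p)) (t : 'cV[R]_m) i :
  ((colsub f D)^T *m t) i 0 = (D^T *m t) (f i) 0.
Proof. by rewrite !mxE; apply: eq_bigr => k' _; rewrite !mxE. Qed.

Lemma rowsub_tr_mul m k (f : 'I_k -> 'I_p) (D : 'M[R]_(m, p)) (t : 'cV[R]_m) :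
  rowsub f (D^T *m t) = (colsub f D)^T *m t.
Proof. by apply/matrixP => i j; rewrite [j]ord1 tr_colsub_mul mxE. Qed.

Variables (n : nat) (Z : 'M[R]_(n, p)) (lam : 'rV[R]_p) (theta : 'cV[R]_p).
Variables (s2 tau : R).
Hypotheses (n0 : (0 < n)%N) (tau0 : 0 < tau).

Let D := scale_cols Z lam.
Let Z1 := colsub (head_ord hdp) Z.
Let l1 := colsub (head_ord hdp) lam.
Let l2 := colsub (tail_ord hdp) lam.
Let X2 := colsub (tail_ord hdp) D.
Let A := D *m D^T + (n%:R * tau)%:M.

Lemma colsub_scale_cols k (f : 'I_k -> 'I_p) :
  colsub f D = scale_cols (colsub f Z) (colsub f lam).
Proof. by apply/matrixP => i j; rewrite !mxE. Qed.

Lemma ridgeopE t : ridgeop Z1 X2 l1 (n%:R * tau) t = A *m t.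
Proof.
rewrite /A mulmxDl -mulmxA mul_head_tail !rowsub_tr_mul /ridgeop /gram.
by rewrite mul_scalar_mx -colsub_scale_cols addrA.
Qed.

Let At := invmx A.
Let AU : A \in unitmx. Proof. exact: ridge_unitmx. Qed.
Let Asym : A^T = A.
Proof. by rewrite /A linearD /= trmx_mul trmxK tr_scalar_mx. Qed.
Let Atsym : At^T = At. Proof. by rewrite /At trmx_inv Asym. Qed.

Definition split_risk : R :=
  risk Z1 X2 l1 l2 (rowsub (head_ord hdp) theta) (rowsub (tail_ord hdp) theta)
    s2 (At *m (D *m theta))
    (fun j => At *m col j (scale_cols Z1 l1)) (fun j => At *m col j X2).

Lemma split_risk_t : ridgeop Z1 X2 l1 (n%:R * tau) (At *m (D *m theta)) =
  scale_cols Z1 l1 *m rowsub (head_ord hdp) theta + X2 *m rowsub (tail_ord hdp) theta.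
Proof. by rewrite ridgeopE mulKVmx // mul_head_tail colsub_scale_cols. Qed.

Lemma split_risk_t1 j : ridgeop Z1 X2 l1 (n%:R * tau) (At *m col j (scale_cols Z1 l1)) =
  col j (scale_cols Z1 l1).
Proof. by rewrite ridgeopE mulKVmx. Qed.

Lemma split_risk_t2 j : ridgeop Z1 X2 l1 (n%:R * tau) (At *m col j X2) = col j X2.
Proof. by rewrite ridgeopE mulKVmx. Qed.

(** Since A is symmetric, row j of the ridge matrix is the transpose of A^-1 D e_j: the row norms of
    the variance are norms of solutions of the ridge system. *)
Lemma cond_riskE : cond_risk D theta lam s2 tau = split_risk.
Proof.
have rowE j : \sum_i ridge_mx D tau j i ^+ 2 = sqn (At *m col j D).
  rewrite sqnE; apply: eq_bigr => i _; congr (_ ^+ 2).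
  rewrite /ridge_mx -/A -/At !mxE; apply: eq_bigr => k _.
  by rewrite !mxE -{1}Atsym [_^T _ _]mxE mulrC.
have biasE j : (ridge_mx D tau *m (D *m theta) - theta) j 0 ^+ 2 =
    ((theta - D^T *m (At *m (D *m theta))) j 0) ^+ 2.
  rewrite /ridge_mx -/A -/At !mulmxA -sqrrN; congr (_ ^+ 2).
  by rewrite -[in RHS]opprB [in RHS]mxE.
rewrite /cond_risk; under eq_bigr do rewrite rowE biasE mulrDr [_ * (s2 * _)]mulrCA.
rewrite big_split /= -mulr_sumr !sum_head_tail.
rewrite /split_risk /risk /bias1 /bias2 /var1 /var2.
have colE k (f : 'I_k -> 'I_p) i : col i (colsub f D) = col (f i) D.
  by apply/matrixP => a b; rewrite !mxE.
have resE k (f : 'I_k -> 'I_p) t : rowsub f theta - (colsub f D)^T *m t =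
    rowsub f (theta - D^T *m t).
  by apply/matrixP => a b; rewrite -rowsub_tr_mul !mxE.
have lE k (f : 'I_k -> 'I_p) i : colsub f lam 0 i = lam 0 (f i) by rewrite mxE.
rewrite -colsub_scale_cols /X2 !resE.
by congr (_ + _ + _ * (_ + _)); apply: eq_bigr => i _;
  rewrite lE ?colE // [rowsub _ _ _ _]mxE.
Qed.

End Split.

(** * Probability of a good design *)

Section GoodEvent.
Variables (R : realType) (n p d : nat) (hdp : (d < p)%N).
Variables (theta : 'cV[R]_p) (lam : 'rV[R]_p).
Variables (sigma sigma_x : R) (disp : measure_display) (T : measurableType disp).
Variables (P : probability T R) (x : 'I_n -> {RV P >-> p.-tuple R}).
Variables (eps y : 'I_n -> {RV P >-> R}).
Hypothesis LM : linear_model theta lam sigma sigma_x x eps y.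
Hypothesis lam0 : forall j, 0 < lam 0 j.
Hypothesis lam_dec : forall i j : 'I_p, (i <= j)%N -> lam 0 j <= lam 0 i.
Hypothesis sx1 : 1 <= sigma_x.
Hypotheses (n0 : (0 < n)%N) (d0 : (0 < d)%N).

Let q := (p - d)%N.
Let q0 : (0 < q)%N. Proof. by rewrite subn_gt0. Qed.
Let Zn := std_design lam x.
Let hd := head_ord hdp.
Let tl := tail_ord hdp.
Let l2 : 'rV[R]_q := colsub tl lam.
Let th2 : 'cV[R]_q := rowsub tl theta.

Let hd_inj : injective hd.
Proof. by move=> i j /(congr1 val) /= e; apply: val_inj. Qed.
Let tl_inj : injective tl.
Proof. by move=> i j /(congr1 val) /= /addnI e; apply: val_inj. Qed.

Definition embed k (f : 'I_k -> 'I_p) : 'M[R]_(p, k) := rel_mx R (fun j i => j == f i).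

Lemma sqn_embed k (f : 'I_k -> 'I_p) v : injective f -> sqn (embed f *m v) = sqn v.
Proof.
move=> f_inj; apply: sqn_rel_mx_eq => [j i i' /eqP -> /eqP /f_inj //||].
  by move=> j j' i /eqP -> /eqP ->.
by move=> j; exists (f j).
Qed.

Lemma mul_embed m k (f : 'I_k -> 'I_p) (M : 'M[R]_(m, p)) :
  M *m embed f = colsub f M.
Proof.
apply/matrixP => i j; rewrite !mxE (bigD1 (f j)) //= mxE eqxx mulr1.
by rewrite big1 ?addr0 // => l /negPf lf; rewrite mxE lf mulr0.
Qed.

(** With weights proportional to the block heads c_(k n), the sum controlled by [blocks_op] is the
    one that [blocks_bound] needs, up to the normalization [Lam], which [sum_block_heads] bounds.
    The 80 is 2 * 20 * 2. *)
Lemma tail_op_whp (c : 'rV[R]_q) : (forall t, 0 < c 0 t) ->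
  (forall t t' : 'I_q, (t <= t')%N -> c 0 t' <= c 0 t) ->
  fails_with P (fun w => forall s, sqn (scale_cols (colsub tl (Zn w)) c *m s) <=
      80 * sigma_x ^+ 2 * (n%:R * c 0 (Ordinal q0) + \sum_t c 0 t) * sqn s)
    (expR (- n%:R)).
Proof.
move=> c0 c_dec; pose C k := cext c (k * n).
pose Lam := \sum_(k < q) C k.
have C0 k : 0 <= C k by exact: cext_ge0.
have C00 : C 0%N = c 0 (Ordinal q0) by rewrite /C mul0n -(cextE c (Ordinal q0)).
have Lam0 : 0 < Lam.
  rewrite /Lam (bigD1 (Ordinal q0)) //= ltr_wpDr ?sumr_ge0 //.
  by rewrite C00.
pose J (k : 'I_q) := embed tl *m block_mx_sel R n q k.
have Jc k v : sqn (J k *m v) <= sqn v.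
  by rewrite -mulmxA sqn_embed // sqn_block_sel_le.
have w0 (k : 'I_q) : 0 <= C k / Lam by rewrite divr_ge0 // ltW.
have w1 : \sum_(k < q) C k / Lam = 1 by rewrite -mulr_suml divff // gt_eqF.
apply: fails_with_imp (blocks_op LM lam0 sx1 n0 Jc w0 w1) _ (lexx _).
move=> w [mu [mu0 muJ muS]] s.
set N1 := n%:R * _ + _.
have LN : n%:R * Lam <= N1.
  by rewrite /N1 -(cextE c); exact: sum_block_heads.
have sx0 : 0 <= sigma_x ^+ 2 by rewrite sqr_ge0.
have -> : 80 * sigma_x ^+ 2 * N1 = 2 * (40 * sigma_x ^+ 2 * N1) by ring.
apply: (blocks_bound n0 q0 c0 c_dec mu0) => [k u|].
  by have := muJ k u; rewrite /J -mulmxA mulmxA mul_embed.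
have -> : \sum_(k < q) cext c (k * n) * mu k = Lam * \sum_(k < q) C k / Lam * mu k.
  by rewrite mulr_sumr; apply: eq_bigr => k _; rewrite /C; field; rewrite gt_eqF.
rewrite (le_trans (ler_wpM2l (ltW Lam0) muS)) //.
have := ler_wpM2l sx0 LN; lra.
Qed.

Let S := \sum_j l2 0 j ^+ 2.
Let phi := \sum_j l2 0 j * th2 j 0 ^+ 2.
Let K' := 80 * sigma_x ^+ 2.
Let X2 w := colsub tl (scale_cols (Zn w) lam).
(** The exponent n / (3200 K^2) of [head_isometry] at K = 2 sigma_x^2; the deviations by 2/5 have a
    better exponent and are weakened to this one. *)
Let E0 := expR (- (n%:R / (12800 * sigma_x ^+ 4)) : R).

Let l2_gt0 j : 0 < l2 0 j. Proof. by rewrite mxE. Qed.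
Let l2_dec (t t' : 'I_q) : (t <= t')%N -> l2 0 t' <= l2 0 t.
Proof. by move=> tt; rewrite !mxE; apply: lam_dec => /=; rewrite leq_add2l. Qed.
Let X2E w : X2 w = scale_cols (colsub tl (Zn w)) l2.
Proof. exact: colsub_scale_cols. Qed.

Let sx4 : 0 < sigma_x ^+ 4.
Proof. by rewrite exprn_gt0 // (lt_le_trans ltr01). Qed.

Let dev_E0 (t : R) : t = 2 / 5 ->
  2 * expR (- (n%:R * t ^+ 2 / (128 * (2 * sigma_x ^+ 2) ^+ 2))) <= 2 * E0.
Proof.
move=> ->; rewrite ler_wpM2l // ler_expR lerN2.
have -> : n%:R * (2 / 5) ^+ 2 / (128 * (2 * sigma_x ^+ 2) ^+ 2) =
    4 * (n%:R / (12800 * sigma_x ^+ 4)).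
  by field; rewrite gt_eqF // (lt_le_trans ltr01).
have : 0 <= n%:R / (12800 * sigma_x ^+ 4).
  exact: divr_ge0 (ler0n _ _) (mulr_ge0 (ler0n _ _) (ltW sx4)).
by move: (_ / _) => a; lra.
Qed.

(** Divided by S, the energy is the convex combination, with weights l2_j^2 / S, of the squared
    norms of the whitened tail columns. *)
Lemma tail_energy_whp :
  fails_with P (fun w => 3 / 5 * n%:R * S <= \sum_j l2 0 j * sqn (col j (X2 w)) /\
                         \sum_j l2 0 j * sqn (col j (X2 w)) <= 7 / 5 * n%:R * S)
    (2 * E0).
Proof.
have S0 : 0 < S.
  rewrite /S (bigD1 (Ordinal q0)) //= ltr_wpDr ?exprn_gt0 //.
  by apply: sumr_ge0 => j _; rewrite sqr_ge0.
have c0 j : 0 <= l2 0 j ^+ 2 / S by rewrite divr_ge0 ?sqr_ge0 // ltW.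
have c1 : \sum_j l2 0 j ^+ 2 / S = 1 by rewrite -mulr_suml divff // gt_eqF.
have := @deviation _ _ _ _ _ _ _ _ _ _ _ _ _ LM lam0 sx1 _
  (fun j => delta_mx (tl j) 0) (fun j => l2 0 j ^+ 2 / S) (2 / 5)
  (fun j => sqn_delta R (tl j)) c0 c1.
have -> : 0 < 2 / 5 :> R by lra.
have -> : 2 / 5 <= 1 :> R by lra.
move=> /(_ isT isT) /fails_with_imp; apply; last exact: dev_E0.
move=> w; rewrite -/(Zn w).
have -> : \sum_j l2 0 j ^+ 2 / S * sqn (Zn w *m delta_mx (tl j) 0) =
    (\sum_j l2 0 j * sqn (col j (X2 w))) / S.
  rewrite mulr_suml; apply: eq_bigr => j _.
  have -> : col j (X2 w) = Num.sqrt (l2 0 j) *: col (tl j) (Zn w).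
    by apply/matrixP => a b; rewrite !mxE mulrC.
  rewrite sqnZ sqr_sqrtr ?(ltW (l2_gt0 j)) // -colE; ring.
set a := \sum_j _; rewrite ler_norml => /andP[h1 h2].
have aE : a = S * (a / S) by rewrite mulrC divfK // gt_eqF.
rewrite aE.
have -> : 3 / 5 * n%:R * S = S * (3 / 5 * n%:R) by ring.
have -> : 7 / 5 * n%:R * S = S * (7 / 5 * n%:R) by ring.
by rewrite !ler_pM2l //; split; lra.
Qed.

Lemma tail_signal_whp :
  fails_with P (fun w => sqn (X2 w *m th2) <= 7 / 5 * n%:R * phi) (2 * E0).
Proof.
pose v := \col_j (Num.sqrt (l2 0 j) * th2 j 0).
have vE : sqn v = phi.
  rewrite sqnE; apply: eq_bigr => j _; rewrite mxE exprMn sqr_sqrtr //.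
  exact: ltW.
have XE w : X2 w *m th2 = Zn w *m (embed tl *m v).
  by rewrite X2E scale_cols_mul mulmxA mul_embed.
have [phi0|phi0] := eqVneq phi 0.
  exists set0; split => //.
    by rewrite measure0 lee_fin mulr_ge0 // expR_ge0.
  move=> w _; rewrite XE phi0 mulr0.
  have /eqP : sqn v = 0 by rewrite vE.
  rewrite sqn_eq0 => /eqP ->; rewrite !mulmx0.
  by rewrite (_ : sqn _ = 0) //; apply/eqP; rewrite sqn_eq0.
have phip : 0 < phi by rewrite lt_def phi0 -vE sqn_ge0.
have vn0 : nrm v != 0 by rewrite gt_eqF // sqrtr_gt0 vE.
have u1 : sqn ((nrm v)^-1 *: (embed tl *m v)) = 1.
  by rewrite sqnZ exprVn sqr_nrm sqn_embed // mulVf // vE.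
have := @deviation _ _ _ _ _ _ _ _ _ _ _ _ _ LM lam0 sx1 1
  (fun=> (nrm v)^-1 *: (embed tl *m v)) (fun=> 1) (2 / 5)
  (fun=> u1) (fun=> ler01) _ _ _.
rewrite big_ord1 => /(_ erefl); have -> : 0 < 2 / 5 :> R by lra.
have -> : 2 / 5 <= 1 :> R by lra.
move=> /(_ isT isT) /fails_with_imp; apply; last exact: dev_E0.
move=> w; rewrite big_ord1 mul1r -scalemxAr sqnZ exprVn sqr_nrm vE -/(Zn w) -XE.
rewrite ler_norml => /andP[_]; set a := sqn _ => h.
have aE : a = phi * (phi^-1 * a) by rewrite mulVKf.
rewrite aE; have -> : 7 / 5 * n%:R * phi = phi * (7 / 5 * n%:R) by ring.
by rewrite ler_pM2l //; lra.
Qed.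

Variable C1 : R.
Hypothesis rank_le : tail_rank hdp lam / n%:R <= C1.

Definition good w : Prop :=
  good_design (colsub hd (Zn w)) (X2 w) l2 th2 (lam_d1 hdp lam) (K' * (1 + C1)) K'.

Let lam_d1E : lam_d1 hdp lam = l2 0 (Ordinal q0).
Proof. by rewrite mxE /lam_d1; congr (lam 0 _); apply: val_inj; rewrite /= addn0. Qed.

Lemma sum_tail (F : 'I_p -> R) : \sum_(j < p | (d <= j)%N) F j = \sum_t F (tl t).
Proof.
rewrite big_mkcond (sum_head_tail hdp) /= big1 ?add0r => [|i _]; last first.
  by rewrite leqNgt ltn_ord.
by apply: eq_bigr => t _; rewrite /= leq_addr.
Qed.

Lemma good_whp : fails_with P good
  (2 ^+ (18 * d) * (2 * E0) + expR (- n%:R) + expR (- n%:R) + 2 * E0 + 2 * E0).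
Proof.
have nR : 0 < n%:R :> R by rewrite ltr0n.
have lampos : 0 < lam_d1 hdp lam by rewrite lam_d1E.
have T1 := tail_op_whp l2_gt0 l2_dec.
have l22 j : (map_mx (fun l => l ^+ 2) l2) 0 j = l2 0 j ^+ 2 by rewrite mxE.
have T2 : fails_with P (fun w => forall s,
    sqn (scale_cols (colsub tl (Zn w)) (map_mx (fun l => l ^+ 2) l2) *m s) <=
    80 * sigma_x ^+ 2 * (n%:R * (l2 0 (Ordinal q0) ^+ 2) + S) * sqn s) (expR (- n%:R)).
  have c0 t : 0 < (map_mx (fun l => l ^+ 2) l2) 0 t by rewrite l22 exprn_gt0.
  have c_dec (t t' : 'I_q) : (t <= t')%N -> (map_mx (fun l => l ^+ 2) l2) 0 t' <=
      (map_mx (fun l => l ^+ 2) l2) 0 t.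
    move=> tt; rewrite !l22 lerXn2r ?nnegrE ?(ltW (l2_gt0 _)) //.
    exact: l2_dec.
  apply: fails_with_imp (tail_op_whp c0 c_dec) _ (lexx _) => w H s.
  rewrite (le_trans (H s)) // l22 /S.
  by under [in leLHS]eq_bigr do rewrite l22.
have H0 := head_isometry LM lam0 sx1 n0 d0 (fun v => sqn_embed v hd_inj).
have E0E : expR (- (n%:R / (3200 * (2 * sigma_x ^+ 2) ^+ 2))) = E0.
  rewrite /E0; congr (expR (- (_ / _))); ring.
rewrite E0E in H0.
have := fails_with_and (fails_with_and (fails_with_and (fails_with_and H0 T1) T2)
  tail_energy_whp) tail_signal_whp.
move=> /fails_with_imp; apply; last exact: lexx.
move=> w [[[[h0 h1] h2] [h3 h3']] h4]; split => //.
- by move=> v; have [] := h0 v; rewrite mulmxA mul_embed.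
- by move=> v; have [] := h0 v; rewrite mulmxA mul_embed.
- move=> v; rewrite X2E (le_trans (h1 v)) // ler_wpM2r ?sqn_ge0 //.
  have rk : \sum_t l2 0 t <= C1 * n%:R * lam_d1 hdp lam.
    move: rank_le; rewrite /tail_rank !ler_pdivrMr // sum_tail.
    by move=> h; under eq_bigr do rewrite mxE.
  rewrite -lam_d1E.
  have k0 : 0 <= K' by rewrite mulr_ge0 // sqr_ge0.
  have := ler_wpM2l k0 rk; rewrite /K'; lra.
- move=> v; have -> : scale_cols (X2 w) l2 =
      scale_cols (colsub tl (Zn w)) (map_mx (fun l => l ^+ 2) l2).
    apply/matrixP => i j; rewrite !mxE sqrtr_sqr ger0_norm ?ltW //.
    by rewrite -mulrA -expr2 sqr_sqrtr // ltW.
  by rewrite lam_d1E.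
Qed.

End GoodEvent.

(** * From almost every tau to all tau *)

Lemma dense_ge0 (R : realType) (h : R -> R) (a b t : R) :
  0 <= a -> a < b -> a <= t -> t <= b ->
  h s @[s --> within `[0, +oo[%classic (nbhs t)] --> h t ->
  (forall q : rat, a < ratr q -> ratr q < b -> 0 <= h (ratr q)) -> 0 <= h t.
Proof.
move=> a0 ab at_ tb ht Hq; rewrite leNgt; apply/negP => neg.
have /nbhs_ballP[e /= e0 He] : \forall s \near t, 0 <= s -> h s < 0.
  have H : nbhs t (fun s => `[0, +oo[%classic s -> h s < 0).
    by apply: (cvgr_lt _ ht) neg; exact: within_filter.
  by move: H; apply: filterS => s H s0; apply: H; rewrite /= in_itv /= s0.
(* The point t may be an endpoint, while the rationals are taken strictly inside; a < b ensures that
   every ball around t meets the open interval. *)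
have lt_max : Num.max a (t - e) < Num.min b (t + e).
  by rewrite lt_min !gt_max; apply/andP; split; apply/andP; split; lra.
have [q] := rat_in_itvoo lt_max.
rewrite in_itv /= lt_min gt_max => /andP[/andP[aq tq] /andP[qb qt]].
have := Hq q aq qb; rewrite leNgt He //.
  by rewrite /ball /= ltr_norml; apply/andP; split; lra.
by rewrite (le_trans a0) // ltW.
Qed.

Lemma within_lower (R : realType) (f g : R -> R) (M a b t : R) :
  {within `[0, +oo[%classic, continuous f} ->
  0 <= a -> a < b -> a <= t -> t <= b -> {for t, continuous g} ->
  (forall q : rat, a < ratr q -> ratr q < b -> M * g (ratr q) <= f (ratr q)) ->
  M * g t <= f t.
Proof.
move=> /subspace_continuousP fc a0 ab at_ tb gc Hq.
rewrite -subr_ge0; apply: (@dense_ge0 _ (fun s => f s - M * g s) a b) => //; last first.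
  by move=> q aq qb; rewrite subr_ge0 Hq.
apply: cvgB; first by apply: fc; rewrite /= in_itv /= (le_trans a0 at_).
by apply: cvgMr; apply: cvg_within_filter gc.
Qed.

Lemma within_upper (R : realType) (f g : R -> R) (M a b t : R) :
  {within `[0, +oo[%classic, continuous f} ->
  0 <= a -> a < b -> a <= t -> t <= b -> {for t, continuous g} ->
  (forall q : rat, a < ratr q -> ratr q < b -> f (ratr q) <= M * g (ratr q)) ->
  f t <= M * g t.
Proof.
move=> fc a0 ab at_ tb gc Hq; rewrite -lerN2 -[- (M * _)]mulNr.
have nfc : {within `[0, +oo[%classic, continuous (fun s => - f s)}.
  by move=> s; apply: cvgN; exact: fc.
by apply: (within_lower nfc a0 ab at_ tb gc) => q aq qb; rewrite mulNr lerN2 Hq.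
Qed.

(* The sample size bound makes [v >= d] below, so that [exp (- C0 v)] absorbs
   the cardinality [2 ^ (18 d)] of the net. *)
Lemma failure_prob_le (R : realType) (n d : nat) (sigma_x nu C0 : R) :
  C0 = 3200 -> 1 <= sigma_x -> (0 < n)%N -> (0 < d)%N -> 0 < nu -> nu < 1 / 2 ->
  4 * C0 ^+ 2 * sigma_x ^+ 4 * d%:R <= n%:R ->
  2 ^+ (18 * d) * (2 * expR (- (n%:R / (12800 * sigma_x ^+ 4)))) + expR (- n%:R) +
    expR (- n%:R) + 2 * expR (- (n%:R / (12800 * sigma_x ^+ 4))) +
    2 * expR (- (n%:R / (12800 * sigma_x ^+ 4))) <=
  2 * expR (- (nu ^+ 2 * n%:R / (C0 ^+ 2 * sigma_x ^+ 4)))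
    + 2 * expR (- (nu ^+ 2 * n%:R / (C0 * sigma_x ^+ 4)))
    + 18 * expR (- (n%:R / C0)).
Proof.
move=> C0E sx n0 d0 nu0 nu1 hn.
have s0 : 0 < sigma_x by exact: lt_le_trans sx.
have C00 : 0 < C0 by rewrite C0E ltr0n.
set N := n%:R; pose v := N / (4 * C0 ^+ 2 * sigma_x ^+ 4).
have N0 : 0 <= N by rewrite ler0n.
have dv : d%:R <= v.
  by rewrite /v ler_pdivlMr ?mulr_gt0 ?exprn_gt0 // mulrC.
have d1 : 1 <= d%:R :> R by rewrite ler1n.
have v0 : 0 <= v by lra.
have nu2 : nu ^+ 2 <= 1 / 4.
  have -> : 1 / 4 = (1 / 2) ^+ 2 :> R by field.
  by rewrite lerXn2r ?nnegrE //; lra.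
have -> : N / (12800 * sigma_x ^+ 4) = C0 * v.
  by rewrite /v C0E; field; rewrite gt_eqF.
have t1 : expR (- v) <= expR (- (nu ^+ 2 * N / (C0 ^+ 2 * sigma_x ^+ 4))).
  rewrite ler_expR lerN2.
  have -> : nu ^+ 2 * N / (C0 ^+ 2 * sigma_x ^+ 4) = 4 * nu ^+ 2 * v.
    by rewrite /v; field; rewrite !gt_eqF.
  by rewrite ler_piMl //; lra.
have t2 : expR (- (C0 * v)) <= expR (- (nu ^+ 2 * N / (C0 * sigma_x ^+ 4))).
  rewrite ler_expR lerN2.
  have -> : nu ^+ 2 * N / (C0 * sigma_x ^+ 4) = 4 * nu ^+ 2 * (C0 * v).
    by rewrite /v; field; rewrite !gt_eqF.
  by rewrite ler_piMl //; [rewrite mulr_ge0 // ltW | lra].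
have t3 : expR (- N) <= expR (- (N / C0)).
  rewrite ler_expR lerN2 ler_pdivrMr // ler_peMr // C0E ler1n.
  by [].
(* The net factor is at most e^(19 d), and d <= v with C0 >= 20 gives 19 d - C0 v <= - v. *)
have t4 : (2 ^+ (18 * d) + 1) * expR (- (C0 * v)) <= expR (- v).
  have e2 : 2 <= expR 1 :> R by have := expR_ge1Dx (1 : R); lra.
  apply: (@le_trans _ _ (expR (19 * d%:R) * expR (- (C0 * v)))).
    rewrite ler_wpM2r ?expR_ge0 //.
    apply: (@le_trans _ _ (2 ^+ (19 * d))).
      rewrite (_ : 19 * d = 18 * d + d)%N; last by rewrite addnC -mulSn.
      have a1 : 1 <= 2 ^+ (18 * d) :> R by rewrite exprn_ege1 // ler1n.
      have a2 : 2 <= 2 ^+ d :> R by rewrite ler_eXnr // ler1n.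
      rewrite exprD; have := ler_pM (ler0n _ 1) (ler0n R 2) a1 a2.
      have := ler_wpM2l (le_trans ler01 a1) a2; lra.
    rewrite -natrM -[(19 * d)%:R in leRHS]mulr1 expRM_natl.
    by rewrite lerXn2r ?nnegrE ?expR_ge0.
  rewrite -expRD ler_expR C0E; lra.
have p0 : 0 <= expR (- (N / C0)) by exact: expR_ge0.
(* Accounting: the head and one deviation event go into the first term, the other deviation event
   into the second, and the two operator norm events into the third. *)
move: t1 t2 t3 t4 p0; set e0 := expR (- (C0 * v)).
set X := 2 ^+ _; rewrite mulrDl mul1r [X * (2 * _)]mulrCA.
move: (X * e0) (expR _) (expR (- N)) => z1 z2 z3; lra.
Qed.

Lemma wnorm_inv_diag_sqr (R : realType) m (l : 'rV[R]_m) (v : 'cV[R]_m) :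
  (forall j, 0 < l 0 j) ->
  wnorm (invmx (diag_mx l)) v ^+ 2 = \sum_j v j 0 ^+ 2 / l 0 j.
Proof.
move=> l0; pose l' := map_mx (fun a => a^-1) l.
have ll : diag_mx l *m diag_mx l' = 1%:M.
  rewrite mulmx_diag -diag_const_mx; congr diag_mx; apply/rowP => j.
  by rewrite !mxE divff // gt_eqF.
have [U _] := mulmx1_unit ll.
have -> : invmx (diag_mx l) = diag_mx l' by rewrite -[LHS]mulmx1 -ll mulKmx.
rewrite wnorm_diag_sqr => [|j]; last by rewrite mxE invr_ge0 ltW.
by apply: eq_bigr => j _; rewrite mxE mulrC.
Qed.

(** * From the hypotheses of the theorem to the deterministic bounds *)

Section Model.
Variables (R : realType) (n p d : nat) (hdp : (d < p)%N).
Variables (theta : 'cV[R]_p) (lam : 'rV[R]_p).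
Hypothesis lam0 : forall j, 0 < lam 0 j.
Hypothesis lam_dec : forall i j : 'I_p, (i <= j)%N -> lam 0 j <= lam 0 i.
Hypotheses (n0 : (0 < n)%N) (d0 : (0 < d)%N).

Let hd := head_ord hdp.
Let tl := tail_ord hdp.
Let S := \sum_j colsub tl lam 0 j ^+ 2.

Lemma tail_rank2E : tail_rank hdp (lam2 lam) = S / lam_d1 hdp lam ^+ 2.
Proof.
rewrite /tail_rank sum_tail /lam_d1 [lam2 _ _ _]mxE; congr (_ / _).
by apply: eq_bigr => j _; rewrite !mxE.
Qed.

Lemma design_std disp (T : measurableType disp) (P : probability T R)
    (x : 'I_n -> {RV P >-> p.-tuple R}) w :
  design [tuple x i w | i < n] = scale_cols (std_design lam x w) lam.
Proof.
apply/matrixP => i j; rewrite !mxE tnth_mktuple divfK //.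
by rewrite gt_eqF // sqrtr_gt0.
Qed.

Lemma model_spectrum_ok (sigma_x C1 delta A0 : R) :
  1 <= sigma_x -> 0 < C1 -> 1 <= A0 -> 0 < delta -> (1 + A0) ^+ 2 < 4 * delta^-1 ->
  400 * sigma_x ^+ 2 * d%:R <= n%:R ->
  rowsub hd theta != 0 ->
  wnorm (diag_mx (colsub tl lam)) (rowsub tl theta) ^+ 2 /
    wnorm (invmx (diag_mx (colsub hd lam))) (rowsub hd theta) ^+ 2 <=
    delta / (4 * (1 + sigma_x ^+ 2)) * lam_d1 hdp lam ^+ 2 ->
  spectrum_ok n (colsub hd lam) (colsub tl lam) (rowsub hd theta) (rowsub tl theta)
    (lam_d hdp lam) (lam_d1 hdp lam) (80 * sigma_x ^+ 2 * (1 + C1)) (80 * sigma_x ^+ 2)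
    A0 delta.
Proof.
move=> sx1 C10 A1 delta0 A0d hn th0.
have sx2 : 1 <= sigma_x ^+ 2 by rewrite exprn_ege1.
have h1 j : 0 < colsub hd lam 0 j by rewrite mxE.
have h2 j : 0 < colsub tl lam 0 j by rewrite mxE.
rewrite wnorm_inv_diag_sqr // wnorm_diag_sqr => [|j]; last exact: ltW.
set phi := \sum_j _; set s := \sum_j _ => sparse.
(* A zero signal would make the quotient in the sparsity condition 0 by convention; positivity
   allows clearing the denominator. *)
have s0 : 0 < s.
  have sj j : 0 <= rowsub hd theta j 0 ^+ 2 / colsub hd lam 0 j.
    by rewrite divr_ge0 ?sqr_ge0 // ltW.
  rewrite lt_def sumr_ge0 // andbT; apply: contra th0.
  rewrite psumr_eq0 // => /allP H; apply/eqP/matrixP => i j.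
  rewrite [j]ord1 [RHS]mxE; apply/eqP.
  have := H i (mem_index_enum i); rewrite /= mulf_eq0 invr_eq0.
  by rewrite (gt_eqF (h1 i)) orbF sqrf_eq0.
split => //.
- by move=> j; rewrite mxE; apply: lam_dec; rewrite /= -ltnS prednK.
- by move=> j; rewrite mxE; apply: lam_dec; rewrite /= leq_addr.
- exact: lam0.
- by apply: lam_dec; rewrite /= leq_pred.
- by have := mulr_gt0 (lt_le_trans ltr01 sx2) C10; lra.
- lra.
- lra.
- by rewrite ltr0n.
- by move: A0d; rewrite ltr_pdivlMr.
move: sparse; rewrite ler_pdivrMr // => sparse; apply: (le_trans sparse).
rewrite ler_wpM2r ?(ltW s0) // ler_wpM2r ?sqr_ge0 // ler_wpM2l ?(ltW delta0) //.
rewrite lef_pV2 ?posrE //; lra.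
Qed.

End Model.

Lemma eta_lt_half (R : realType) (n d : nat) (C0 sigma_x eta : R) :
  0 <= C0 -> (0 < n)%N -> eta = C0 * sigma_x ^+ 2 * Num.sqrt (d%:R / n%:R) ->
  eta < 1 / 2 -> 4 * C0 ^+ 2 * sigma_x ^+ 4 * d%:R <= n%:R.
Proof.
move=> C00 n0 -> h; have nR : 0 < n%:R :> R by rewrite ltr0n.
have e0 : 0 <= C0 * sigma_x ^+ 2 * Num.sqrt (d%:R / n%:R).
  exact: mulr_ge0 (mulr_ge0 C00 (sqr_ge0 _)) (sqrtr_ge0 _).
have : (C0 * sigma_x ^+ 2 * Num.sqrt (d%:R / n%:R)) ^+ 2 <= 1 / 4.
  have -> : 1 / 4 = (1 / 2) ^+ 2 :> R by field.
  by apply: lerXn2r; rewrite ?nnegrE ?divr_ge0 // ltW.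
have -> : (C0 * sigma_x ^+ 2 * Num.sqrt (d%:R / n%:R)) ^+ 2 =
    C0 ^+ 2 * sigma_x ^+ 4 * d%:R / n%:R.
  transitivity (C0 ^+ 2 * sigma_x ^+ 4 * Num.sqrt (d%:R / n%:R) ^+ 2); first by ring.
  by rewrite sqr_sqrtr ?divr_ge0 // mulrA.
have -> : 4 * C0 ^+ 2 * sigma_x ^+ 4 * d%:R = 4 * (C0 ^+ 2 * sigma_x ^+ 4 * d%:R).
  by ring.
by rewrite ler_pdivrMr //; move: (C0 ^+ 2 * sigma_x ^+ 4 * d%:R) => a; lra.
Qed.

Section RiskBounds.
Variables (R : realType) (n p d : nat) (hdp : (d < p)%N).
Variables (theta : 'cV[R]_p) (lam : 'rV[R]_p) (sigma sigma_x C1 A0 delta : R).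
Variables (disp : measure_display) (T : measurableType disp) (P : probability T R).
Variables (x : 'I_n -> {RV P >-> p.-tuple R}) (w : T).

Let l1 := colsub (head_ord hdp) lam.
Let l2 := colsub (tail_ord hdp) lam.
Let th1 := rowsub (head_ord hdp) theta.
Let th2 := rowsub (tail_ord hdp) theta.
Let K' := 80 * sigma_x ^+ 2.
Let K := K' * (1 + C1).
Let signal := \sum_j th1 j 0 ^+ 2 / l1 0 j.
Let F tau := cond_risk (design [tuple x i w | i < n]) theta lam (sigma ^+ 2) tau.
Let M1 := (lower_const K K' A0)^-1.
Let M2 := upper_const K A0.
Let rate tau := signal * tau ^+ 2 +
    sigma ^+ 2 * (d%:R / n%:R + lam_d1 hdp lam ^+ 2 / tau ^+ 2 *
                                (tail_rank hdp (lam2 lam) / n%:R)).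

Hypothesis lam0 : forall j, 0 < lam 0 j.
Hypothesis n0 : (0 < n)%N.
Hypothesis SO : spectrum_ok n l1 l2 th1 th2 (lam_d hdp lam) (lam_d1 hdp lam) K K' A0 delta.
Hypothesis GD : good hdp theta lam sigma_x x C1 w.

Lemma good_risk_bounds tau : 0 < tau ->
  [/\ tau <= A0^-1 * lam_d1 hdp lam ->
        M1 * (sigma ^+ 2 * (d%:R / n%:R + tail_rank hdp (lam2 lam) / n%:R)) <= F tau,
      A0^-1 * lam_d1 hdp lam <= tau -> F tau <= M2 * rate tau,
      A0^-1 * lam_d1 hdp lam <= tau -> tau <= A0 * lam_d hdp lam ->
        M1 * rate tau <= F tau
    & A0 * lam_d hdp lam <= tau -> M1 * (signal * lam_d hdp lam ^+ 2) <= F tau].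
Proof.
move=> tau0.
have A1 := so_A0 SO; have A00 : 0 < A0 by exact: lt_le_trans A1.
have L0 : 0 < lower_const K K' A0 := lower_const_gt0 K A1 (so_K' SO).
have s2 : 0 <= sigma ^+ 2 by rewrite sqr_ge0.
have FE : F tau = split_risk hdp (std_design lam x w) lam theta (sigma ^+ 2) tau.
  by rewrite -cond_riskE -(design_std lam0).
have rateE : rate tau = risk_rate n l1 l2 th1 tau (sigma ^+ 2).
  rewrite /rate /risk_rate tail_rank2E; congr (_ + _ * (_ + _)).
  by field; rewrite !gt_eqF ?ltr0n // (so_lam SO).
have t := split_risk_t hdp (std_design lam x w) lam theta n0 tau0.
have t1 := split_risk_t1 hdp (std_design lam x w) lam n0 tau0.
have t2 := split_risk_t2 hdp (std_design lam x w) lam n0 tau0.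
rewrite FE rateE tail_rank2E /M1 !ler_pdivrMl //; split.
- exact: (risk_small GD SO tau0).
- by move=> h; apply: (risk_mid_upper GD SO tau0).
- by move=> h h'; apply: (risk_mid_lower GD SO tau0).
- by move=> h; apply: (risk_large GD SO tau0).
Qed.

End RiskBounds.

Theorem theorem1 (R : realType) :
  exists C0 : R, 0 < C0 /\
  forall sigma_x eta1 C1 delta1 nu A0 : R,
    eta1 < 1 / 2 ->
    0 < C1 ->
    0 < delta1 -> delta1 < 1 ->
    0 < nu -> nu < 1 / 2 * Num.min 1 (sigma_x ^+ 2) ->
    1 <= A0 -> (1 + A0) ^+ 2 < 4 * delta1^-1 ->
  exists M1 M2 : R, 0 < M1 /\ 0 < M2 /\
  forall (n p d : nat) (hn : (1 <= n)%N) (hd : (1 <= d)%N) (hdp : (d < p)%N)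
    (lam : 'rV[R]_p) (theta : 'cV[R]_p) (sigma : R)
    (disp : measure_display) (T : measurableType disp) (P : probability T R)
    (x : 'I_n -> {RV P >-> p.-tuple R}) (eps y : 'I_n -> {RV P >-> R})
    (mse : R -> n.-tuple (p.-tuple R) -> R),
  let Sigma := diag_mx lam in
  let Sigma_head := diag_mx (colsub (head_ord hdp) lam) in
  let Sigma_tail := diag_mx (colsub (tail_ord hdp) lam) in
  let theta_head := rowsub (head_ord hdp) theta in
  let theta_tail := rowsub (tail_ord hdp) theta in
  let signal := wnorm (invmx Sigma_head) theta_head ^+ 2 in
  let rate tau := signal * tau ^+ 2 +
    sigma ^+ 2 * (d%:R / n%:R + lam_d1 hdp lam ^+ 2 / tau ^+ 2 *
                                (tail_rank hdp (lam2 lam) / n%:R)) in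
    (forall i, 0 < lam 0 i) ->
    (forall i j : 'I_p, (i <= j)%N -> lam 0 j <= lam 0 i) ->
    linear_model theta lam sigma sigma_x x eps y ->
    is_mse_out theta Sigma x y mse ->
    (d <= n)%N ->
    eta1 = C0 * sigma_x ^+ 2 * Num.sqrt (d%:R / n%:R) ->
    tail_rank hdp lam / n%:R <= C1 ->
    theta_head != 0 ->
    wnorm Sigma_tail theta_tail ^+ 2 / signal <=
      delta1 / (4 * (1 + sigma_x ^+ 2)) * lam_d1 hdp lam ^+ 2 ->
  exists E : set T, measurable E /\
    ((1 - 2 * expR (- (nu ^+ 2 * n%:R / (C0 ^+ 2 * sigma_x ^+ 4)))
        - 2 * expR (- (nu ^+ 2 * n%:R / (C0 * sigma_x ^+ 4)))
        - 18 * expR (- (n%:R / C0)))%:E <= P E)%E /\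
    forall w, E w ->
    let mse_out tau := mse tau [tuple x i w | i < n] in
    forall tau, 0 <= tau ->
      [/\ tau <= A0^-1 * lam_d1 hdp lam ->
            M1 * (sigma ^+ 2 * (d%:R / n%:R + tail_rank hdp (lam2 lam) / n%:R))
              <= mse_out tau,
          A0^-1 * lam_d1 hdp lam <= tau -> tau <= A0 * lam_d hdp lam ->
            mse_out tau <= M2 * rate tau /\ M1 * rate tau <= mse_out tau
        & A0 * lam_d hdp lam <= tau ->
            M1 * (signal * lam_d hdp lam ^+ 2) <= mse_out tau].
Proof.
(* The value is chosen so that 4 C0 = 12800 matches the exponent of the design events. It is hidden
   behind an equation to remain symbolic. *)
have [C0 C0E] : exists C0 : R, C0 = 3200 by exists 3200.
have C00 : 0 < C0 by rewrite C0E ltr0n.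
exists C0; split => //.
move=> sigma_x eta1 C1 delta1 nu A0 eta_lt C10 delta0 _ nu0 nu_lt A1 A0d.
have A00 : 0 < A0 by exact: lt_le_trans A1.
have sx2 : 0 < sigma_x ^+ 2.
  have : 0 < 1 / 2 * Num.min 1 (sigma_x ^+ 2) by exact: lt_trans nu_lt.
  by rewrite pmulr_rgt0 // lt_min => /andP[].
have nu12 : nu < 1 / 2.
  apply: (lt_le_trans nu_lt); rewrite -[leRHS]mulr1 ler_pM2l //.
  by rewrite ge_min lexx.
pose K' := 80 * sigma_x ^+ 2; pose K := K' * (1 + C1).
have K'0 : 0 < K' by rewrite mulr_gt0.
have K0 : 0 < K by rewrite mulr_gt0 // addr_gt0.
exists (lower_const K K' A0)^-1, (upper_const K A0); split.
  by rewrite invr_gt0 lower_const_gt0.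
split; first by rewrite upper_const_gt0 // ltW.
move=> n p d n0 d0 hdp lam theta sigma disp T P x eps y mse Sigma Sh St thh tht.
move=> signal rate lam0 lam_dec LM MSE dn etaE rank_le th0 sparse.
have sx1 := sigma_x_ge1 LM lam0 (Ordinal n0) (Ordinal hdp).
have hn := eta_lt_half (ltW C00) n0 etaE eta_lt.
have h400 : 400 * sigma_x ^+ 2 * d%:R <= n%:R.
  apply: (le_trans _ hn); rewrite ler_wpM2r ?ler0n //.
  have c1 : 100 <= C0 ^+ 2.
    by rewrite (@le_trans _ _ (10 ^+ 2)) -?natrX ?ler_nat // natrX C0E lerXn2r ?nnegrE ?ler_nat ?ler0n.
  have c2 : 1 <= sigma_x ^+ 2 by rewrite exprn_ege1.
  have -> : 4 * C0 ^+ 2 * sigma_x ^+ 4 = 4 * (C0 ^+ 2 * sigma_x ^+ 2) * sigma_x ^+ 2.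
    by ring.
  rewrite ler_pM2r //; have := ler_pM ler01 (ler0n R 100) c2 c1.
  by rewrite [sigma_x ^+ 2 * _]mulrC; lra.
have SO := model_spectrum_ok lam0 lam_dec n0 d0 sx1 C10 A1 delta0 A0d h400 th0 sparse.
have [B [mB PB HB]] := good_whp LM lam0 lam_dec sx1 n0 d0 rank_le.
have lampos : 0 < lam_d1 hdp lam by exact: lam0.
pose t0 := A0^-1 * lam_d1 hdp lam.
have t00 : 0 < t0 by rewrite mulr_gt0 ?invr_gt0.
pose X w := [tuple x i w | i < n].
pose F tau w := cond_risk (design (X w)) theta lam (sigma ^+ 2) tau.
(* The a.e. identity is used on the rationals and at [t0], to which the range
   in (ii) may shrink; continuity gives all the other values of tau. *)
have lamN j : 0 <= lam 0 j by exact: ltW.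
have aeq tau : 0 < tau -> {ae P, forall w, mse tau (X w) = F tau w}.
  by move=> h; exact: (mse_eq_risk LM n0 lamN MSE h).
(* The rationals are enumerated by [unpickle], so that countably many null sets merge into one. *)
have aeQ : {ae P, forall w, forall k (q : rat), unpickle k = Some q -> 0 < ratr q :> R ->
    mse (ratr q) (X w) = F (ratr q) w}.
  apply/ae_foralln => k; case: (unpickle k : option rat) => [q|]; last exact: aeW.
  have [q0|q0] := ltP 0 (ratr q : R).
    by apply: filterS (aeq _ q0) => w h q' [<-].
  by apply: aeW => w q' [<-]; rewrite ltNge q0.
have [N [mN PN HN]] : {ae P, forall w, [/\ {within `[0, +oo[, continuous (fun tau => mse tau (X w))},
    mse t0 (X w) = F t0 w &
    forall q : rat, 0 < ratr q :> R -> mse (ratr q) (X w) = F (ratr q) w]}.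
  have := aeQ; apply: filterS3 (MSE.2) (aeq _ t00) => w h1 h2 h3; split => // q.
  exact: h3 (pickleK q).
exists (~` (B `|` N)); split; first by apply: measurableC; exact: measurableU.
split.
  have mBN : measurable (B `|` N) by exact: measurableU.
  rewrite probability_setC //.
  have PBN : (P (B `|` N) <= (2 * expR (- (nu ^+ 2 * n%:R / (C0 ^+ 2 * sigma_x ^+ 4)))
    + 2 * expR (- (nu ^+ 2 * n%:R / (C0 * sigma_x ^+ 4)))
    + 18 * expR (- (n%:R / C0)))%:E)%E.
    apply: (le_trans (measureU2 P mB mN)); rewrite -[leRHS]adde0.
    apply: leeD; last by rewrite [leLHS]PN.
    by apply: (le_trans PB); rewrite lee_fin; exact: failure_prob_le.
  rewrite -2!addrA -!opprD [X in 1 - X]addrA EFinB.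
  exact: leeB.
move=> w /not_orP[nB nN] mse_out tau tau0.
have [mc mt0 mq] : [/\ {within `[0, +oo[, continuous (fun tau => mse tau (X w))},
    mse t0 (X w) = F t0 w &
    forall q : rat, 0 < ratr q :> R -> mse (ratr q) (X w) = F (ratr q) w].
  by apply: contrapT => h; apply: nN; apply: HN.
have bd := good_risk_bounds sigma lam0 n0 SO (HB w nB).
have signalE : signal = \sum_j thh j 0 ^+ 2 / colsub (head_ord hdp) lam 0 j.
  by rewrite /signal wnorm_inv_diag_sqr // => j; rewrite mxE.
have rate_cont t : 0 < t -> {for t, continuous rate}.
  move=> tp; have sq : (fun s : R => s ^+ 2) @ t --> t ^+ 2 by exact: exprn_continuous.
  apply: cvgD; first exact: cvgMr.
  apply: cvgMr; apply: cvgD; first exact: cvg_cst.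
  apply: cvgMl; apply: cvgMr; apply: cvgV => //.
  by rewrite expf_neq0 // gt_eqF.
have ldpos : 0 < lam_d hdp lam by exact: lam0.
have t0_le : t0 <= A0 * lam_d hdp lam.
  rewrite ler_pdivrMl // mulrA (le_trans (so_gap SO)) // ler_peMl ?(ltW ldpos) //.
  by rewrite -expr2 exprn_ege1.
have at_rate t (E : 0 < t) : mse t (X w) = F t w -> t0 <= t -> t <= A0 * lam_d hdp lam ->
    mse_out t <= upper_const K A0 * rate t /\
    (lower_const K K' A0)^-1 * rate t <= mse_out t.
  rewrite /mse_out -/(X w) => -> h h'; have [_ u l _] := bd t E.
  by rewrite /rate signalE; split; [exact: u|exact: l].
split.
(* The rationals range over the interval from 0 to [t0]; continuity then includes tau = 0, and the
   limit defining the estimator there is never examined. *)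
- move=> h; rewrite -[sigma ^+ 2 * _]/((fun=> sigma ^+ 2 *
      (d%:R / n%:R + tail_rank hdp (lam2 lam) / n%:R)) tau).
  apply: (within_lower mc (lexx 0) t00 tau0 h); first exact: cvg_cst.
  move=> q q0 qt; rewrite mq //; have [l _ _ _] := bd _ q0.
  exact: l (ltW qt).
- move=> h h'; have [e|e] := eqVneq t0 (A0 * lam_d hdp lam).
    have -> : tau = t0 by apply/eqP; rewrite eq_le h e h'.
    by apply: at_rate => //; rewrite e.
  have lt : t0 < A0 * lam_d hdp lam by rewrite lt_neqAle e.
  have rc := rate_cont _ (lt_le_trans t00 h).
  have at_q (q : rat) : t0 < ratr q -> ratr q < A0 * lam_d hdp lam ->
      mse_out (ratr q) <= upper_const K A0 * rate (ratr q) /\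
      (lower_const K K' A0)^-1 * rate (ratr q) <= mse_out (ratr q).
    move=> q1 q2; have q0 := lt_trans t00 q1.
    by apply: at_rate; rewrite ?mq // ltW.
  split.
    apply: (within_upper mc (ltW t00) lt h h' rc) => q q1 q2.
    by have [] := at_q q q1 q2.
  apply: (within_lower mc (ltW t00) lt h h' rc) => q q1 q2.
  by have [] := at_q q q1 q2.
- move=> h; rewrite -[signal * _]/((fun=> signal * lam_d hdp lam ^+ 2) tau).
  (* The range is unbounded, so tau + 1 serves as an arbitrary right end. *)
  have a0 : 0 <= A0 * lam_d hdp lam by rewrite mulr_ge0 // ltW.
  apply: (within_lower (b := tau + 1) mc a0 _ h).
  - by rewrite ltr_pwDr.
  - by rewrite lerDl.
  - exact: cvg_cst.
  move=> q q1 _; have q0 : 0 < ratr q :> R by exact: le_lt_trans q1.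
  rewrite mq // signalE; have [_ _ _ l] := bd _ q0.
  exact: l (ltW q1).
Qed.
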